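(* There exist non-compact four-dimensional homogeneous pseudo-Riemannian manifolds $(M=G/H,g)$ with non-trivial isotropy, with $g$ a non-trivial (i.e. non-Einstein) homogeneous Ricci soliton, and even an invariant Ricci soliton, such that $(M,g)$ is not isometric to any solvmanifold.
   Context: A pseudo-Riemannian metric $g$ on $M$ is a Ricci soliton if there are a smooth vector field $X$ and $\lambda\in\mathbb R$ with $\mathcal L_Xg+\varrho=\lambda g$, where $\varrho$ is the Ricci tensor of $g$. If $M=G/H$ is a homogeneous space, a homogeneous Ricci soliton on $M$ is a $G$-invariant metric $g$ for which this equation holds; it is an invariant Ricci soliton if the equation holds with a $G$-invariant vector field $X$. Non-trivial isotropy means that $H$ has positive dimension (and $G$ acts almost effectively on $M$). A solvmanifold here is a solvable Lie group equipped with a left-invariant pseudo-Riemannian metric. *)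

(* Defs.v *)
From HB Require Import structures.
From mathcomp Require Import all_boot all_order all_algebra.
From mathcomp Require Import all_classical all_reals all_analysis.

Set Implicit Arguments.
Unset Strict Implicit.
Unset Printing Implicit Defensive.

Import GRing.Theory numFieldNormedType.Exports.
Local Open Scope classical_set_scope.
Local Open Scope ring_scope.

(* Tangent vectors in a chart are row vectors, as for ['J f p], which acts on
   the right: ['d f p v = v *m 'J f p]. *)

(** * Smooth functions *)

(* Meaningful for [U] open. *)
Fixpoint Ck (R : realType) (V W : normedModType R) (k : nat) (U : set V)
    (f : V -> W) : Prop :=
  if k is j.+1 then
    (forall x, U x -> differentiable f x) /\
    (forall v : V, Ck j U (fun x => 'D_v f x))
  else forall x, U x -> {for x, continuous f}.

Definition smooth_on (R : realType) (V W : normedModType R) (U : set V)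
  (f : V -> W) : Prop := forall k : nat, Ck k U f.

(** * Charts and manifolds *)

(* [coord] and [point] are only meaningful on [dom] and on its image under
   [coord], where they are mutually inverse homeomorphisms. *)
Record chart (R : realType) (n : nat) (T : topologicalType) := Chart {
  dom : set T;
  coord : T -> 'rV[R]_n;
  point : 'rV[R]_n -> T;
  dom_open : open dom;
  codom_open : open (coord @` dom);
  coordK : forall p, dom p -> point (coord p) = p;
  coord_continuous : {within dom, continuous coord};
  point_continuous : {within coord @` dom, continuous point} }.

Definition codom (R : realType) (n : nat) (T : topologicalType)
  (c : chart R n T) : set 'rV[R]_n := coord c @` dom c.

Section LocalExpressions.
Context (R : realType) (n m : nat) (T U : topologicalType).
Implicit Types (c : chart R n T) (d : chart R m U) (f : T -> U).

Definition local_dom c d f : set 'rV[R]_n :=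
  [set x | codom c x /\ dom d (f (point c x))].

Definition local_map c d f : 'rV[R]_n -> 'rV[R]_m :=
  fun x => coord d (f (point c x)).

End LocalExpressions.

Definition compatible (R : realType) (n : nat) (T : topologicalType)
    (c d : chart R n T) : Prop :=
  smooth_on (local_dom c d idfun) (local_map c d idfun) /\
  smooth_on (local_dom d c idfun) (local_map d c idfun).

(* A smooth manifold structure of dimension [n] on the topological space [T],
   given by an indexed, not necessarily maximal, atlas. *)
Record manifold (R : realType) (n : nat) (T : topologicalType) := Manifold {
  manifold_hausdorff : hausdorff_space T;
  manifold_second_countable : @second_countable T;
  index : Type;
  charts : index -> chart R n T;
  charts_cover : forall p : T, exists i, dom (charts i) p;
  charts_compatible : forall i j, compatible (charts i) (charts j) }.

Arguments charts {R n T} _ _.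

Section SmoothMaps.
Context (R : realType) (n m l : nat) (T U V : topologicalType).
Context (A : manifold R n T) (B : manifold R m U) (C : manifold R l V).

Definition smooth (f : T -> U) : Prop :=
  continuous f /\
  forall i j, smooth_on (local_dom (charts A i) (charts B j) f)
                        (local_map (charts A i) (charts B j) f).

(* Smoothness on the product manifold, in the product charts. *)
Definition smooth2 (f : T -> U -> V) : Prop :=
  continuous (fun z : T * U => f z.1 z.2) /\
  forall i j k,
    let F (z : 'rV[R]_(n + m)) :=
      f (point (charts A i) (lsubmx z)) (point (charts B j) (rsubmx z)) in
    smooth_on [set z | [/\ codom (charts A i) (lsubmx z),
                           codom (charts B j) (rsubmx z)
                         & dom (charts C k) (F z)]]
              (fun z => coord (charts C k) (F z)).

Definition submersion (f : T -> U) : Prop :=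
  smooth f /\
  forall i j x, local_dom (charts A i) (charts B j) f x ->
    row_full ('J (local_map (charts A i) (charts B j) f) x).

(* [H] is an embedded submanifold of dimension [k]: around each of its points
   it is a coordinate slice. *)
Definition submanifold (k : nat) (H : set T) : Prop :=
  (k <= n)%N /\
  forall p, H p -> exists c : chart R n T,
    [/\ forall i, compatible c (charts A i),
        dom c p
      & forall q, dom c q ->
          (H q <-> forall j : 'I_n, (k <= j)%N -> coord c q 0 j = 0)].

End SmoothMaps.

(** * Metrics and vector fields *)

Section Tensors.
Context (R : realType) (n m : nat) (T U : topologicalType).
Context (A : manifold R n T) (B : manifold R m U).

(* [f^* h = g], for covariant 2-tensors given by their components in the
   charts. *)
Definition pulls_back (f : T -> U) (h : index B -> 'rV[R]_m -> 'M[R]_m)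
    (g : index A -> 'rV[R]_n -> 'M[R]_n) : Prop :=
  forall i j x, local_dom (charts A i) (charts B j) f x ->
    let F := local_map (charts A i) (charts B j) f in
    'J F x *m h j (F x) *m ('J F x)^T = g i x.

(* [df (X p) = Y (f p)] *)
Definition related (f : T -> U) (X : index A -> 'rV[R]_n -> 'rV[R]_n)
    (Y : index B -> 'rV[R]_m -> 'rV[R]_m) : Prop :=
  forall i j x, local_dom (charts A i) (charts B j) f x ->
    let F := local_map (charts A i) (charts B j) f in
    X i x *m 'J F x = Y j (F x).

End Tensors.

(* The condition on [idfun] is the transformation law under change of charts. *)
Record pseudo_metric (R : realType) (n : nat) (T : topologicalType)
    (A : manifold R n T) := PseudoMetric {
  metric_mx :> index A -> 'rV[R]_n -> 'M[R]_n;
  metric_smooth : forall i, smooth_on (codom (charts A i)) (metric_mx i);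
  metric_sym : forall i x, codom (charts A i) x ->
    (metric_mx i x)^T = metric_mx i x;
  metric_nondegenerate : forall i x, codom (charts A i) x ->
    metric_mx i x \in unitmx;
  metric_tensorial : pulls_back idfun metric_mx metric_mx }.

Record vector_field (R : realType) (n : nat) (T : topologicalType)
    (A : manifold R n T) := VectorField {
  field_row :> index A -> 'rV[R]_n -> 'rV[R]_n;
  field_smooth : forall i, smooth_on (codom (charts A i)) (field_row i);
  field_tensorial : related idfun field_row field_row }.

(** * Ricci tensor and Lie derivative in coordinates *)

Section Coordinates.
Context (R : realType) (n : nat).
Implicit Types (g : 'rV[R]_n -> 'M[R]_n) (X : 'rV[R]_n -> 'rV[R]_n).

Definition partial (k : 'I_n) (u : 'rV[R]_n -> R) (x : 'rV[R]_n) : R :=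
  'D_(delta_mx 0 k) u x.

(* Levi-Civita connection: [christoffel g k i j] is Gamma^k_ij. *)
Definition christoffel g (k i j : 'I_n) (x : 'rV[R]_n) : R :=
  2^-1 * \sum_l invmx (g x) k l *
    (partial i (fun y => g y j l) x + partial j (fun y => g y i l) x
     - partial l (fun y => g y i j) x).

(* Sign convention: positive on round spheres. *)
Definition ricci g (x : 'rV[R]_n) : 'M[R]_n :=
  \matrix_(i, j)
    (\sum_k (partial k (christoffel g k i j) x
             - partial j (christoffel g k i k) x)
     + \sum_k \sum_l
         (christoffel g k k l x * christoffel g l i j x
          - christoffel g k j l x * christoffel g l i k x)).

Definition lie_derivative X g (x : 'rV[R]_n) : 'M[R]_n :=
  \matrix_(i, j) \sum_k
    (X x 0 k * partial k (fun y => g y i j) x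
     + g x k j * partial i (fun y => X y 0 k) x
     + g x i k * partial j (fun y => X y 0 k) x).

End Coordinates.

Section Solitons.
Context (R : realType) (n : nat) (T : topologicalType) (A : manifold R n T).
Implicit Types (g : pseudo_metric A) (X : vector_field A).

Definition soliton_equation g X (lambda : R) : Prop :=
  forall i x, codom (charts A i) x ->
    lie_derivative (X i) (g i) x + ricci (g i) x = lambda *: g i x.

Definition einstein g : Prop :=
  exists mu : R, forall i x, codom (charts A i) x ->
    ricci (g i) x = mu *: g i x.

End Solitons.

Definition isometric (R : realType) (n m : nat) (T U : topologicalType)
    (A : manifold R n T) (B : manifold R m U)
    (g : pseudo_metric A) (h : pseudo_metric B) : Prop :=
  exists (f : T -> U) (f' : U -> T),
    [/\ cancel f f', cancel f' f, smooth A B f, smooth B A f'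
      & pulls_back f h g].

(** * Lie groups and homogeneous spaces *)

#[short(type="preTopologicalGroupType")]
HB.structure Definition PreTopologicalGroup := {G of Topological G & Group G}.

Definition lie_group (R : realType) (m : nat) (G : preTopologicalGroupType)
    (AG : manifold R m G) : Prop :=
  smooth2 AG AG AG (fun a b : G => (a * b)%g) /\
  smooth AG AG (fun a : G => (a^-1)%g).

Definition subgroup (G : groupType) (H : set G) : Prop :=
  H 1%g /\ forall a b, H a -> H b -> H (a * b^-1)%g.

Fixpoint derived_series (G : groupType) (k : nat) : set G :=
  if k is j.+1 then
    smallest (@subgroup G)
      [set [~ a, b]%g | a in derived_series j & b in derived_series j]
  else setT.

Definition solvable_group (G : groupType) : Prop :=
  exists k, @derived_series G k = [set 1%g].

Section Homogeneous.
Context (R : realType) (n m : nat) (G : preTopologicalGroupType).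
Context (M : topologicalType) (AG : manifold R m G) (AM : manifold R n M).

(* [M] is [G/H], with its quotient manifold structure and the action of [G] by
   left translations; [o] is the coset of [H].  The orbit map of [o] is then
   the projection of [G] onto [G/H], which is a submersion. *)
Definition homogeneous_space (H : set G) (act : G -> M -> M) (o : M) : Prop :=
  [/\ [/\ subgroup H & closed H],
      (forall p, act 1%g p = p) /\
        (forall a b p, act (a * b)%g p = act a (act b p)),
      smooth2 AG AM AM act,
      forall p, exists a, act a o = p
    & (forall a, act a o = o <-> H a) /\
        submersion AG AM (fun a => act a o)].

(* The ineffective kernel is discrete. *)
Definition almost_effective (act : G -> M -> M) : Prop :=
  let N := [set a | forall p, act a p = p] in N `<=` isolated N.

Definition positive_dimensional (H : set G) : Prop :=
  exists k, (0 < k)%N /\ submanifold AG k H.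

Definition invariant_metric (act : G -> M -> M) (g : pseudo_metric AM) : Prop :=
  forall a, pulls_back (act a) g g.

Definition invariant_field (act : G -> M -> M) (X : vector_field AM) : Prop :=
  forall a, related (act a) X X.

Definition homogeneous_ricci_soliton (act : G -> M -> M)
    (g : pseudo_metric AM) : Prop :=
  invariant_metric act g /\
  exists (X : vector_field AM) (lambda : R), soliton_equation g X lambda.

Definition invariant_ricci_soliton (act : G -> M -> M)
    (g : pseudo_metric AM) : Prop :=
  invariant_metric act g /\
  exists (X : vector_field AM) (lambda : R),
    invariant_field act X /\ soliton_equation g X lambda.

End Homogeneous.

(* [G], with the left-invariant metric [g], is a solvmanifold. *)
Definition solvmanifold (R : realType) (m : nat) (G : preTopologicalGroupType)
    (AG : manifold R m G) (g : pseudo_metric AG) : Prop :=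
  [/\ lie_group AG, solvable_group G
    & forall a : G, pulls_back (fun b : G => (a * b)%g) g g].

(* Main.v *)
Require Import Defs.
From HB Require Import structures.
From mathcomp Require Import all_boot all_order all_algebra.
From mathcomp Require Import ring lra.
From mathcomp Require Import all_classical all_reals all_analysis.
Import Order.TTheory GRing.Theory Num.Theory numFieldNormedType.Exports.
Local Open Scope classical_set_scope.
Local Open Scope ring_scope.

Set Implicit Arguments.
Unset Strict Implicit.
Unset Printing Implicit Defensive.

(* Let [M] be the product of R^3 minus the origin with R, with coordinates (x, v) and
   r = |x|, and let
     g = |dx|^2 / r^2 - (x . dx)^2 / r^4 + 2 (x . dx) dv.
   In terms of x / r and of u = r^2 / 2 this is the product of the round sphere of
   curvature 1 and of the half plane u > 0 with the flat metric 2 du dv.  The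
   sphere has Ricci tensor equal to its metric, and the radial field (x / 2, 0) is
   u d/du, whose flow scales du dv: this gives the soliton equation with lambda = 1,
   while the Ricci tensor is degenerate and non-zero.  The pairs (q, b) of a non-zero
   quaternion and a real number act by x |-> q x q^* and v |-> v / N(q)^2 + b,
   which preserves g and the radial field, is transitive, and has the circle in the
   first factor as isotropy group.

   An isometry phi of [M] preserves the Ricci tensor, that is, the pull-back of the
   sphere metric, and Hessians.  The restrictions n_k of the coordinates to the
   sphere satisfy Hess n_k = - n_k Ric; so do the n_k o phi, which are moreover
   constant along the half plane factor, and such functions are linear combinations of
   the n_k.  Hence the isometries act on the sphere factor by orthogonal matrices.
   If [M] were isometric to a solvmanifold, left translations would give a
   solvable group acting transitively on the sphere through orthogonal 3 x 3
   matrices.  This is impossible: the last term of the derived series that does not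
   act by scalars acts by commuting matrices, hence has a common
   eigenvector; by normality and transitivity every vector is one. *)

(** The product of a sphere with a half plane is an open subset of R^4, although the sphere alone
    has no global chart. In the Cartesian coordinates (x, v) one chart suffices and the metric, its
    connection and the group action have rational components, so most tensor identities reduce to
    [ring] or [field] entry by entry; the n_k bring in the root |x|. The obstacle is an isometry
    about which nothing is known: it need not respect the product decomposition a priori. The Ricci
    tensor supplies the missing structure. It is positive semidefinite with the half plane
    directions as kernel, and it is the sum of the squares dn_k^2. Pulled back, this identity shows
    that the differentials of the n_k o phi vanish on that kernel. Hence naturality of the
    Levi-Civita connection, of the Ricci tensor and of Hessians has to be proved for general
    isometries, from the coordinate definitions. No structure theory of Lie groups or of the
    isometry group enters: solvability is used only through commutators of abstract group elements,
    each acting by one orthogonal matrix. *)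

Section Differentiation.
Context {R : realType} {V : normedModType R}.
Implicit Types (W : normedModType R).

Lemma near_zero_differentiable {W} (f : V -> W) x :
  (\near x, f x = 0) -> differentiable f x.
Proof.
move=> f0; have fx : f x = 0 := nbhs_singleton f0.
have E : f \o shift x = cst (f x) + (\0 : {linear V -> W}) +o_ (0 : V) id.
  apply/eqaddoP => _/posnumP[e].
  have := f0; rewrite (near_shift 0 x); apply: filterS => y /=.
  rewrite /= subr0 => fy0.
  rewrite (_ : (_ - _) y = 0) ?normr0 ?mulr_ge0 //.
  by rewrite !fctE /= fy0 fx addr0 subrr.
have d0 : 'd f x = \0 :> (V -> W) by apply: diff_unique E; exact: cst_continuous.
apply/diff_locallyP; rewrite d0; split; [exact: cst_continuous|exact: E].
Qed.

Lemma near_eq_differentiable {W} (f g : V -> W) x :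
  (\near x, f x = g x) -> differentiable f x -> differentiable g x.
Proof.
move=> fg df; have -> : g = f + (g - f) by rewrite addrC subrK.
apply: differentiableD => //; apply: near_zero_differentiable.
by apply: filterS fg => y E; rewrite -[LHS]/(g y - f y) E subrr.
Qed.

Lemma derive_comp_linear {W W' : normedModType R} (L : {linear W -> W'})
    (f : V -> W) x v : continuous L -> differentiable f x ->
  'D_v (L \o f) x = L ('D_v f x).
Proof.
move=> cL df; have dL := linear_differentiable (f x) cL.
rewrite !deriveE //; last exact: differentiable_comp.
by rewrite diff_comp //= diff_lin.
Qed.

Lemma derive_entry m n (f : V -> 'M[R]_(m, n)) x v i j : differentiable f x ->
  'D_v (fun y => f y i j) x = ('D_v f x) i j.
Proof.
move=> df.
have @L : {linear 'M[R]_(m, n) -> R}.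
  by exists (fun N : 'M[R]_(_, _) => N i j); do 2![eexists]; do ?[constructor];
     rewrite ?mxE// => ? *; rewrite ?mxE//; move=> ?; rewrite !mxE.
by rewrite -[RHS]/(L _) -derive_comp_linear //; exact: coord_continuous.
Qed.

Lemma differentiable_entry m n (f : V -> 'M[R]_(m, n)) x i j :
  differentiable f x -> differentiable (fun y => f y i j) x.
Proof. by move=> df; apply: differentiable_comp df (differentiable_coord _ _ _). Qed.

Lemma entries_differentiable m n (f : V -> 'M[R]_(m, n)) x :
  (forall i j, differentiable (fun y => f y i j) x) -> differentiable f x.
Proof.
move=> df.
have -> : f = \sum_i \sum_j (fun y => f y i j *: delta_mx i j).
  by apply/funext => y; rewrite fct_sumE [LHS]matrix_sum_delta;
     apply: eq_bigr => i _; rewrite fct_sumE.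
apply: differentiable_sum => i; apply: differentiable_sum => j.
exact: differentiableZl.
Qed.

Lemma entries_continuous m n (T : topologicalType) (f : T -> 'M[R]_(m, n)) x :
  (forall i j, {for x, continuous (fun y => f y i j)}) -> {for x, continuous f}.
Proof.
move=> cf A [P Pf PA]; apply: (@filterS _ (nbhs x) _ _ _ _ (_ : nbhs x [set y | forall i j, P i j (f y i j)])).
  by move=> y /= Py; exact: PA.
by apply: filter_forall => i; apply: filter_forall => j; apply: cf; exact: Pf.
Qed.
End Differentiation.

(** * Functions of class [Ck] *)

Section CkTheory.
Context {R : realType} {V : normedModType R}.
Implicit Types (W : normedModType R) (U : set V).

(** Openness of [U] turns agreement on [U] into agreement near each of its points, which is all that
    derivatives see; values outside [U] are irrelevant. *)
Lemma Ck_ext {W} k U (f g : V -> W) : open U -> (forall x, U x -> f x = g x) ->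
  Ck k U f -> Ck k U g.
Proof.
move=> oU; elim: k f g => [|k IH] f g fg.
  move=> cf x Ux; rewrite /prop_for /continuous_at -fg //.
  apply: cvg_trans (cf x Ux); apply: near_eq_cvg.
  by near=> y; rewrite fg //; near: y; exact: open_nbhs_nbhs.
have nfg x : U x -> \near x, f x = g x.
  by move=> Ux; near=> y; rewrite fg //; near: y; exact: open_nbhs_nbhs.
case=> df Df; split=> [x Ux|v].
  exact: near_eq_differentiable (nfg x Ux) (df x Ux).
by apply: IH (Df v) => x Ux; apply: near_eq_derive; exact: nfg.
Unshelve. all: by end_near. Qed.

Lemma Ck_subset {W} k U U' (f : V -> W) : U' `<=` U -> Ck k U f -> Ck k U' f.
Proof.
move=> sU; elim: k f => [|k IH] f; first by move=> cf x /sU/cf.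
by case=> df Df; split=> [x /sU/df//|v]; exact: IH (Df v).
Qed.

Lemma CkW {W} k U (f : V -> W) : Ck k.+1 U f -> Ck k U f.
Proof.
elim: k f => [|k IH] f [df Df].
  by move=> x /df/differentiable_continuous.
by split=> // v; apply: IH.
Qed.

Lemma Ck_differentiable {W} k U (f : V -> W) x :
  Ck k.+1 U f -> U x -> differentiable f x.
Proof. by case=> df _; exact: df. Qed.

Lemma Ck_derive {W} k U (f : V -> W) v : Ck k.+1 U f -> Ck k U (fun x => 'D_v f x).
Proof. by case=> _ H; exact: H. Qed.

Lemma Ck_local {W} k U (f : V -> W) :
  (forall x, U x -> exists U', U' x /\ Ck k U' f) -> Ck k U f.
Proof.
elim: k f => [|k IH] f cf.
  by move=> x /cf[U' [U'x]]; apply.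
split=> [x /cf[U' [U'x [+ _]]]|v]; first exact.
by apply: IH => x /cf[U' [U'x [_ /(_ v) ?]]]; exists U'.
Qed.

Lemma Ck_cst {W} k U (c : W) : Ck k U (fun _ : V => c).
Proof.
elim: k c => [|k IH] c; first by move=> x _; exact: cst_continuous.
split=> [x _|v]; first exact: differentiable_cst.
have -> : (fun x => 'D_v (fun=> c) x) = (fun _ : V => 0 : W).
  by apply/funext => x; exact: derive_cst.
exact: IH.
Qed.

Lemma Ck_id k U : Ck k U (fun x : V => x).
Proof.
case: k => [|k]; first by move=> x _; exact: cvg_id.
split=> [x _|v]; first exact: ex_diff.
have -> : (fun x => 'D_v (fun x : V => x) x) = (fun _ : V => v).
  by apply/funext => x; exact: derive_id.
exact: Ck_cst.
Qed.

Lemma CkD {W} k U (f g : V -> W) : open U -> Ck k U f -> Ck k U g ->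
  Ck k U (fun x => f x + g x).
Proof.
move=> oU; elim: k f g => [|k IH] f g.
  by move=> cf cg x Ux; apply: cvgD; [exact: cf|exact: cg].
move=> [df Df] [dg Dg]; split=> [x Ux|v].
  by apply: differentiableD; [exact: df|exact: dg].
apply: Ck_ext (IH _ _ (Df v) (Dg v)) => // x Ux.
by rewrite [RHS]deriveD //; apply: diff_derivable; [exact: df|exact: dg].
Qed.

Lemma Ck_sum {W} k U (I : Type) (r : seq I) (f : I -> V -> W) : open U ->
  (forall i, Ck k U (f i)) -> Ck k U (fun x => \sum_(i <- r) f i x).
Proof.
move=> oU cf; elim: r => [|i r IH].
  by apply: Ck_ext (@Ck_cst _ k U 0) => // x _; rewrite big_nil.
by apply: Ck_ext (CkD oU (cf i) IH) => // x _; rewrite big_cons.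
Qed.

Lemma CkM k U (f g : V -> R) : open U -> Ck k U f -> Ck k U g ->
  Ck k U (fun x => f x * g x).
Proof.
move=> oU; elim: k f g => [|k IH] f g.
  by move=> cf cg x Ux; apply: cvgM; [exact: cf|exact: cg].
move=> cf cg; have [df Df] := cf; have [dg Dg] := cg; split=> [x Ux|v].
  by apply: differentiableM; [exact: df|exact: dg].
apply: Ck_ext (CkD oU (IH _ _ (CkW cf) (Dg v)) (IH _ _ (CkW cg) (Df v))) => //.
move=> x Ux.
by rewrite [RHS]deriveM //; apply: diff_derivable; [exact: df|exact: dg].
Qed.

Lemma CkN k U (f : V -> R) : open U -> Ck k U f -> Ck k U (fun x => - f x).
Proof.
move=> oU cf; apply: Ck_ext (CkM oU (Ck_cst k U (-1 : R)) cf) => // x _.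
by rewrite mulN1r.
Qed.

Lemma CkB k U (f g : V -> R) : open U -> Ck k U f -> Ck k U g ->
  Ck k U (fun x => f x - g x).
Proof. by move=> oU cf cg; apply: CkD => //; apply: CkN. Qed.

Lemma CkX k U (f : V -> R) n : open U -> Ck k U f -> Ck k U (fun x => f x ^+ n).
Proof.
move=> oU cf; elim: n => [|n IH].
  by apply: Ck_ext (Ck_cst k U (1 : R)) => // x _; rewrite expr0.
by apply: Ck_ext (CkM oU cf IH) => // x _; rewrite exprS.
Qed.

Lemma CkV k U (f : V -> R) : open U -> (forall x, U x -> f x != 0) ->
  Ck k U f -> Ck k U (fun x => (f x)^-1).
Proof.
move=> oU f0; elim: k f f0 => [|k IH] f f0.
  by move=> cf x Ux; apply: cvgV; [exact: f0|exact: cf].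
move=> cf; have [df Df] := cf; split=> [x Ux|v].
  by apply: differentiableV; [exact: df|exact: f0].
have cV := IH f f0 (CkW cf).
apply: Ck_ext (CkN oU (CkM oU (CkM oU cV cV) (Df v))) => //.
move=> x Ux.
rewrite [RHS]deriveV; [|exact: f0|by apply: diff_derivable; exact: df].
by rewrite -exprVn expr2 scaleNr.
Qed.

Lemma Ck_mx k U m n (f : V -> 'M[R]_(m, n)) : open U ->
  (forall i j, Ck k U (fun x => f x i j)) -> Ck k U f.
Proof.
move=> oU; elim: k f => [|k IH] f cf.
  by move=> x Ux; apply: entries_continuous => i j; exact: cf.
have df x : U x -> differentiable f x.
  by move=> Ux; apply: entries_differentiable => i j; have [+ _] := cf i j; apply.
split=> // v; apply: IH => i j; have [_ /(_ v)] := cf i j.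
by apply: Ck_ext => // x Ux; apply: derive_entry; exact: df.
Qed.

Lemma Ck_entry k U m n (f : V -> 'M[R]_(m, n)) i j : open U ->
  Ck k U f -> Ck k U (fun x => f x i j).
Proof.
move=> oU; elim: k f => [|k IH] f.
  move=> cf x Ux; apply: (@continuous_comp _ _ _ f (fun N : 'M[R]_(m, n) => N i j)).
    exact: cf.
  exact: coord_continuous.
move=> [df Df]; split=> [x Ux|v]; first by apply: differentiable_entry; exact: df.
by apply: Ck_ext (IH _ (Df v)) => // x Ux; rewrite derive_entry //; exact: df.
Qed.

End CkTheory.

(** The chain rule is expanded over constant basis directions because [Ck] differentiates in fixed
    directions, whereas the direction ['D_v f x] moves with [x]. *)
Lemma derive_comp_row (R : realType) (V W : normedModType R) n
    (f : V -> 'rV[R]_n) (g : 'rV[R]_n -> W) x v :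
  differentiable f x -> differentiable g (f x) ->
  'D_v (g \o f) x = \sum_j ('D_v f x) 0 j *: 'D_(delta_mx 0 j) g (f x).
Proof.
move=> df dg; rewrite !deriveE //; last exact: differentiable_comp.
rewrite diff_comp //= [X in 'd g _ X]row_sum_delta linear_sum.
by apply: eq_bigr => j _; rewrite linearZ deriveE.
Qed.

Lemma Ck_comp_scalar (R : realType) (V : normedModType R) n k (U : set V)
    (U' : set 'rV[R]_n) (f : V -> 'rV[R]_n) (g : 'rV[R]_n -> R) :
  open U -> (forall x, U x -> U' (f x)) ->
  Ck k U f -> Ck k U' g -> Ck k U (fun x => g (f x)).
Proof.
move=> oU fU; elim: k f g fU => [|k IH] f g fU.
  move=> cf cg x Ux; apply: (@continuous_comp _ _ _ f g); first exact: cf.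
  by apply: cg; exact: fU.
move=> cf [dg Dg]; have [df Df] := cf; split=> [x Ux|v].
  by apply: differentiable_comp; [exact: df|apply: dg; exact: fU].
have step j := CkM oU (Ck_entry 0 j oU (Df v)) (IH _ _ fU (CkW cf) (Dg (delta_mx 0 j))).
apply: Ck_ext (Ck_sum (index_enum _) oU step) => // x Ux.
by rewrite [RHS]derive_comp_row //; [exact: df|apply: dg; exact: fU].
Qed.

Lemma Ck_comp (R : realType) (V : normedModType R) m n p k (U : set V)
    (U' : set 'rV[R]_n) (f : V -> 'rV[R]_n) (g : 'rV[R]_n -> 'M[R]_(m, p)) :
  open U -> open U' -> (forall x, U x -> U' (f x)) ->
  Ck k U f -> Ck k U' g -> Ck k U (fun x => g (f x)).
Proof.
move=> oU oU' fU cf cg; apply: Ck_mx => // i j.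
exact: (Ck_comp_scalar oU fU cf (Ck_entry i j oU' cg)).
Qed.

(** * Symmetry of second derivatives *)

Section Schwarz.
Context {R : realType} {V : normedModType R}.
Implicit Types (f : V -> R) (x u v : V).

Lemma is_derive_line f x v (t : R) : differentiable f (x + t *: v) ->
  is_derive t 1 (fun s => f (x + s *: v)) ('D_v f (x + t *: v)).
Proof.
move=> df.
have [ds dsE] := is_diff_scalel t v.
have dd : differentiable (fun s : R => x + s *: v) t.
  by have := differentiableD (differentiable_cst x t) ds.
have dv : 'd (fun s : R => x + s *: v) t 1 = v.
  transitivity ('d (cst x + *:%R^~ v) t 1) => //.
  by rewrite diffD //= diff_cst dsE /= add0r scale1r.
have dc : differentiable (f \o (fun s : R => x + s *: v)) t.
  by have := differentiable_comp dd df.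
apply: DeriveDef; first exact: diff_derivable.
transitivity ('d (f \o (fun s : R => x + s *: v)) t 1); first exact: deriveE.
by rewrite diff_comp //= dv deriveE.
Qed.

Lemma mean_value_line f x v (t : R) : 0 < t ->
  (forall s, 0 <= s <= t -> differentiable f (x + s *: v)) ->
  exists2 s, 0 <= s <= t & f (x + t *: v) - f x = t * 'D_v f (x + s *: v).
Proof.
move=> t0 df.
have dl s : 0 <= s <= t ->
    is_derive s 1 (fun s => f (x + s *: v)) ('D_v f (x + s *: v)).
  by move=> /df; exact: is_derive_line.
case: (@MVT_segment R (fun s => f (x + s *: v)) (fun s => 'D_v f (x + s *: v)) 0 t (ltW t0)).
- by move=> s; rewrite in_itv /= => /andP[/ltW s0 /ltW st]; apply: dl; rewrite s0.
- apply: derivable_within_continuous => s; rewrite in_itv /= => sb.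
  by have [] := dl s sb.
move=> s; rewrite in_itv /= => st e; exists s => //.
by move: e; rewrite scale0r addr0 subr0 mulrC.
Qed.

(** The mean value theorem along [u] is applied to the increment of [f] by [t *: v], and then along
    [v] to ['D_u f]. The left-hand side is symmetric in [u] and [v], which is what makes the mixed
    derivatives agree in the limit. *)
Lemma mixed_difference f (W : set V) x u v (t : R) : 0 < t -> Ck 2 W f ->
  (forall s r, 0 <= s <= t -> 0 <= r <= t -> W (x + s *: u + r *: v)) ->
  exists s r, [/\ 0 <= s <= t, 0 <= r <= t &
    f (x + t *: u + t *: v) - f (x + t *: u) - f (x + t *: v) + f x
    = t ^+ 2 * 'D_v (fun y => 'D_u f y) (x + s *: u + r *: v)].
Proof.
move=> t0 [df /(_ u)[dDf _]] inW.
have t1 : 0 <= t <= t by rewrite lexx ltW.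
have t2 : (0 : R) <= 0 <= t by rewrite lexx ltW.
pose h y := f (y + t *: v) - f y.
have dsh y : differentiable (fun y : V => y + t *: v) y.
  exact: (@differentiableD _ _ _ id (cst (t *: v))).
have dft y : differentiable f (y + t *: v) -> differentiable (fun y => f (y + t *: v)) y.
  by move=> dy; apply: (@differentiable_comp _ _ _ _ (fun y => y + t *: v) f).
have Wu s : 0 <= s <= t -> W (x + s *: u).
  by move=> st; rewrite -[_ + _]addr0 -(scale0r v); apply: inW.
have dh s : 0 <= s <= t -> differentiable h (x + s *: u).
  move=> st; apply: (@differentiableB _ _ _ (fun y => f (y + t *: v)) f).
    by apply: dft; apply: df; apply: inW.
  by apply: df; apply: Wu.
have [s st hs] := mean_value_line t0 dh.
have [r rt Dr] := mean_value_line (f := fun y => 'D_u f y) (x := x + s *: u) (v := v) t0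
  (fun r rt => dDf _ (inW s r st rt)).
exists s, r; split=> //.
have -> : f (x + t *: u + t *: v) - f (x + t *: u) - f (x + t *: v) + f x =
    h (x + t *: u) - h x.
  by rewrite /h; ring.
rewrite hs expr2 -mulrA -Dr; congr (_ * _).
rewrite [LHS](@deriveB _ _ _ (fun y => f (y + t *: v)) f); last 2 first.
- by apply/diff_derivable/dft/df/inW.
- by apply/diff_derivable/df/Wu.
congr (_ - _); rewrite deriveE; last by apply/dft/df/inW.
rewrite (@diff_comp _ _ _ _ (fun y => y + t *: v) f) //; last exact/df/inW.
rewrite /= deriveE; last exact/df/inW.
by rewrite (@diffD _ _ _ id (cst (t *: v))) //= diff_val diff_cst addr0.
Qed.

Lemma dist_le_split (a b c e : R) :
  `|a - c| < e / 2 -> `|b - c| < e / 2 -> `|a - b| <= e.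
Proof.
move=> h1 h2; rewrite (le_trans (ler_distD c _ _)) // [X in _ + X]distrC.
by rewrite [leRHS]splitr lerD // ltW.
Qed.

Lemma ball_near_values (U : set V) (a b : V -> R) x (e : R) : open U -> U x ->
  {for x, continuous a} -> {for x, continuous b} -> 0 < e ->
  exists2 d, 0 < d & forall y, ball x d y ->
    [/\ U y, `|a x - a y| < e & `|b x - b y| < e].
Proof.
move=> oU Ux ca cb e0.
have nU : nbhs x U by exact: open_nbhs_nbhs.
have na : \forall y \near x, `|a x - a y| < e by move/cvgrPdist_lt: ca; apply.
have nb : \forall y \near x, `|b x - b y| < e by move/cvgrPdist_lt: cb; apply.
have nn : nbhs x (U `&` ([set y | `|a x - a y| < e] `&` [set y | `|b x - b y| < e])).
  by apply: filterI => //; apply: filterI.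
have [d /= d0 sd] := (nbhs_ballP _ _).1 nn.
by exists d => // y /sd[Uy [h1 h2]]; split.
Qed.

Lemma derive_comm f (U : set V) x u v : open U -> Ck 2 U f -> U x ->
  'D_v (fun y => 'D_u f y) x = 'D_u (fun y => 'D_v f y) x.
Proof.
move=> oU cf Ux; have [_ Df] := cf.
have [_ /(_ v) cuv] := Df u; have [_ /(_ u) cvu] := Df v.
apply/eqP; rewrite -subr_eq0 -normr_le0; apply/ler_addgt0Pr => e e0.
rewrite add0r.
have e20 : 0 < e / 2 by rewrite divr_gt0.
have [d d0 dball] := ball_near_values oU Ux (cuv x Ux) (cvu x Ux) e20.
(* With side [t = d / k] the whole parallelogram spanned by [u] and [v] stays in the ball of radius
   [d]; the added 1 keeps [k] positive when both vectors vanish. *)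
pose k := `|u| + `|v| + 1.
have k0 : 0 < k by rewrite ltr_wpDl // addr_ge0.
pose t := d / k; have t0 : 0 < t by rewrite divr_gt0.
have inb s r : 0 <= s <= t -> 0 <= r <= t -> ball x d (x + s *: u + r *: v).
  move=> /andP[s0 st] /andP[r0 rt]; rewrite -ball_normE /= -addrA opprD addrA.
  rewrite subrr sub0r normrN (le_lt_trans (ler_normD _ _)) // !normrZ.
  rewrite (ger0_norm s0) (ger0_norm r0).
  have -> : d = t * k by rewrite /t divfK // gt_eqF.
  rewrite (@le_lt_trans _ _ (t * (`|u| + `|v|))) //.
    by rewrite mulrDr lerD // ler_wpM2r.
  by rewrite ltr_pM2l // /k ltrDl.
have cW : Ck 2 (ball x d) f.
  by apply: Ck_subset cf => y /dball[].
have [s [r [st rt E1]]] := mixed_difference t0 cW inb.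
have inb' s' r' : 0 <= s' <= t -> 0 <= r' <= t -> ball x d (x + s' *: v + r' *: u).
  by move=> ? ?; rewrite addrAC; apply: inb.
have [s' [r' [st' rt' E2]]] := mixed_difference t0 cW inb'.
have : t ^+ 2 * 'D_v (fun y => 'D_u f y) (x + s *: u + r *: v) =
       t ^+ 2 * 'D_u (fun y => 'D_v f y) (x + s' *: v + r' *: u).
  apply: etrans (esym E1) (etrans _ E2).
  rewrite [x + t *: v + t *: u]addrAC; congr (_ + _); exact: addrAC.
move=> /(mulfI (lt0r_neq0 (exprn_gt0 2 t0))) E.
have [_ h1 _] := dball _ (inb s r st rt).
have [_ _ h2] := dball _ (inb' s' r' st' rt').
rewrite -E in h2.
exact: dist_le_split h1 h2.
Qed.

End Schwarz.

(** * Calculus of matrix-valued functions *)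

Section MatrixCalculus.
Context {R : realType} {V : normedModType R}.

Lemma differentiable_sumf {W : normedModType R} n (f : 'I_n -> V -> W) x :
  (forall i, differentiable (f i) x) -> differentiable (fun y => \sum_i f i y) x.
Proof.
move=> df; have -> : (fun y => \sum_i f i y) = \sum_i f i.
  by apply/funext => y; rewrite fct_sumE.
exact: differentiable_sum.
Qed.

Lemma derive_sumf {W : normedModType R} n (f : 'I_n -> V -> W) x v :
  (forall i, differentiable (f i) x) ->
  'D_v (fun y => \sum_i f i y) x = \sum_i 'D_v (f i) x.
Proof.
move=> df; have -> : (fun y => \sum_i f i y) = \sum_i f i.
  by apply/funext => y; rewrite fct_sumE.
by apply: derive_sum => i; apply: diff_derivable.
Qed.

Lemma differentiable_mulmx m n p (M : V -> 'M[R]_(m, n)) (N : V -> 'M[R]_(n, p)) x :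
  differentiable M x -> differentiable N x ->
  differentiable (fun y => M y *m N y) x.
Proof.
move=> dM dN; apply: entries_differentiable => i j.
have -> : (fun y => (M y *m N y) i j) = (fun y => \sum_k M y i k * N y k j).
  by apply/funext => y; rewrite mxE.
apply: differentiable_sumf => k.
exact: (differentiableM (differentiable_entry _ _ dM) (differentiable_entry _ _ dN)).
Qed.

Lemma derive_mulmx m n p (M : V -> 'M[R]_(m, n)) (N : V -> 'M[R]_(n, p)) x v :
  differentiable M x -> differentiable N x ->
  'D_v (fun y => M y *m N y) x = 'D_v M x *m N x + M x *m 'D_v N x.
Proof.
move=> dM dN; apply/matrixP => i j.
rewrite -derive_entry; last exact: differentiable_mulmx.
have -> : (fun y => (M y *m N y) i j) = (fun y => \sum_k M y i k * N y k j).
  by apply/funext => y; rewrite mxE.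
rewrite derive_sumf => [|k]; last first.
  exact: (differentiableM (differentiable_entry _ _ dM) (differentiable_entry _ _ dN)).
rewrite 3!mxE -big_split /=; apply: eq_bigr => k _.
have dMk := differentiable_entry i k dM; have dNk := differentiable_entry k j dN.
rewrite [LHS](@deriveM _ _ (fun y => M y i k) (fun y => N y k j)); last 2 first.
- exact: diff_derivable.
- exact: diff_derivable.
rewrite !derive_entry // addrC /GRing.scale /=.
by congr (_ + _); rewrite mulrC.
Qed.

Lemma differentiable_trmx m n (M : V -> 'M[R]_(m, n)) x :
  differentiable M x -> differentiable (fun y => (M y)^T) x.
Proof.
move=> dM; apply: entries_differentiable => i j.
have -> : (fun y => (M y)^T i j) = (fun y => M y j i).
  by apply/funext => y; rewrite mxE.
exact: differentiable_entry.
Qed.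

Lemma derive_trmx m n (M : V -> 'M[R]_(m, n)) x v : differentiable M x ->
  'D_v (fun y => (M y)^T) x = ('D_v M x)^T.
Proof.
move=> dM; apply/matrixP => i j.
rewrite -derive_entry; last exact: differentiable_trmx.
have -> : (fun y => (M y)^T i j) = (fun y => M y j i).
  by apply/funext => y; rewrite mxE.
by rewrite mxE derive_entry.
Qed.

Lemma differentiable_scalef m n (k : V -> R) (M : V -> 'M[R]_(m, n)) x :
  differentiable k x -> differentiable M x ->
  differentiable (fun y => k y *: M y) x.
Proof.
move=> dk dM; apply: entries_differentiable => i j.
have -> : (fun y => (k y *: M y) i j) = (fun y => k y * M y i j).
  by apply/funext => y; rewrite mxE.
exact: (differentiableM dk (differentiable_entry _ _ dM)).
Qed.

Lemma derive_scalef m n (k : V -> R) (M : V -> 'M[R]_(m, n)) x v :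
  differentiable k x -> differentiable M x ->
  'D_v (fun y => k y *: M y) x = 'D_v k x *: M x + k x *: 'D_v M x.
Proof.
move=> dk dM; apply/matrixP => i j.
rewrite -derive_entry; last exact: differentiable_scalef.
have -> : (fun y => (k y *: M y) i j) = (fun y => k y * M y i j).
  by apply/funext => y; rewrite mxE.
have dMk := differentiable_entry i j dM.
rewrite [LHS](@deriveM _ _ k (fun y => M y i j)); last 2 first.
- exact: diff_derivable.
- exact: diff_derivable.
rewrite !derive_entry // addrC /GRing.scale /= 3!mxE.
by congr (_ + _); rewrite mulrC.
Qed.

End MatrixCalculus.

Section Segment.
Context {R : realType} {V : normedModType R}.

Lemma eq_of_derive_line0 (f : V -> R) x v :
  (forall t, 0 <= t <= 1 -> differentiable f (x + t *: v) /\ 'D_v f (x + t *: v) = 0) ->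
  f (x + v) = f x.
Proof.
move=> H; have [|t tb] := @mean_value_line R V f x v 1 ltr01.
  by move=> t /H[].
rewrite scale1r; have [_ ->] := H t tb.
by rewrite mulr0 => /eqP; rewrite subr_eq0 => /eqP.
Qed.

End Segment.

(** * Naturality of the Ricci tensor *)

Fact coordinate_derivative_key : unit. Proof. exact: tt. Qed.

(* Locked, because unification otherwise unfolds the limit defining ['D]. *)
Definition coordinate_derivative (R : realType) (n : nat) (W : normedModType R) :
    'I_n -> ('rV[R]_n -> W) -> 'rV[R]_n -> W :=
  locked_with coordinate_derivative_key (fun i f x => 'D_(delta_mx 0 i) f x).

Lemma coordinate_derivativeE (R : realType) (n : nat) (W : normedModType R) i
    (f : 'rV[R]_n -> W) x :
  coordinate_derivative i f x = 'D_(delta_mx 0 i) f x.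
Proof. by rewrite /coordinate_derivative unlock. Qed.

Section CoordinateDerivative.
Context {R : realType} {n : nat}.
Implicit Types (x : 'rV[R]_n) (i j : 'I_n).

Local Notation D := coordinate_derivative.

Local Notation DE := coordinate_derivativeE.

Lemma near_eq_D {W : normedModType R} i (f g : 'rV[R]_n -> W) x :
  (\near x, f x = g x) -> D i f x = D i g x.
Proof. by move=> fg; rewrite !DE; exact: near_eq_derive. Qed.

Lemma D_entry m p i (f : 'rV[R]_n -> 'M[R]_(m, p)) x a b : differentiable f x ->
  D i (fun y => f y a b) x = D i f x a b.
Proof. by move=> df; rewrite !DE; exact: derive_entry. Qed.

Lemma D_mulmx m p q i (M : 'rV[R]_n -> 'M[R]_(m, p)) (N : 'rV[R]_n -> 'M[R]_(p, q)) x :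
  differentiable M x -> differentiable N x ->
  D i (fun y => M y *m N y) x = D i M x *m N x + M x *m D i N x.
Proof. by move=> dM dN; rewrite !DE; exact: derive_mulmx. Qed.

Lemma D_trmx m p i (M : 'rV[R]_n -> 'M[R]_(m, p)) x : differentiable M x ->
  D i (fun y => (M y)^T) x = (D i M x)^T.
Proof. by move=> dM; rewrite !DE; exact: derive_trmx. Qed.

Lemma D_scalef m p i (k : 'rV[R]_n -> R) (M : 'rV[R]_n -> 'M[R]_(m, p)) x :
  differentiable k x -> differentiable M x ->
  D i (fun y => k y *: M y) x = D i k x *: M x + k x *: D i M x.
Proof. by move=> dk dM; rewrite !DE; exact: derive_scalef. Qed.

Lemma D_sumf {W : normedModType R} p i (f : 'I_p -> 'rV[R]_n -> W) x :
  (forall k, differentiable (f k) x) ->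
  D i (fun y => \sum_k f k y) x = \sum_k D i (f k) x.
Proof.
move=> df; rewrite DE derive_sumf //.
by apply: eq_bigr => k _; rewrite DE.
Qed.

Lemma DB {W : normedModType R} i (f g : 'rV[R]_n -> W) x :
  differentiable f x -> differentiable g x ->
  D i (fun y => f y - g y) x = D i f x - D i g x.
Proof.
by move=> df dg; rewrite !DE; apply: deriveB; exact: diff_derivable.
Qed.

Lemma D_comm i j (f : 'rV[R]_n -> R) (U : set 'rV[R]_n) x :
  open U -> Ck 2 U f -> U x ->
  D i (fun y => D j f y) x = D j (fun y => D i f y) x.
Proof.
move=> oU cf Ux; rewrite !DE.
have E k : (fun y => D k f y) = (fun y => 'D_(delta_mx 0 k) f y).
  by apply/funext => y; exact: DE.
rewrite !E; exact: derive_comm oU cf Ux.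
Qed.

Lemma Ck_D {W : normedModType R} k i (f : 'rV[R]_n -> W) (U : set 'rV[R]_n) :
  Ck k.+1 U f -> Ck k U (fun y => D i f y).
Proof.
move=> cf; have -> : (fun y => D i f y) = (fun y => 'D_(delta_mx 0 i) f y).
  by apply/funext => y; exact: DE.
exact: Ck_derive.
Qed.

Lemma D_comp p {W : normedModType R} i (f : 'rV[R]_n -> 'rV[R]_p)
    (g : 'rV[R]_p -> W) x :
  differentiable f x -> differentiable g (f x) ->
  D i (fun y => g (f y)) x = \sum_j 'J f x i j *: D j g (f x).
Proof.
move=> df dg; rewrite DE [LHS](derive_comp_row _ df dg).
apply: eq_bigr => j _; rewrite DE; congr (_ *: _).
by rewrite deriveEjacobian // -rowE mxE.
Qed.

Lemma jacobian_D p (f : 'rV[R]_n -> 'rV[R]_p) x i (j : 'I_p) : differentiable f x ->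
  'J f x i j = D i (fun y => f y 0 j) x.
Proof. by move=> df; rewrite D_entry // DE deriveEjacobian // -rowE [RHS]mxE. Qed.

Lemma Ck_jacobian k p (f : 'rV[R]_n -> 'rV[R]_p) (U : set 'rV[R]_n) :
  open U -> Ck k.+1 U f -> Ck k U (fun x => 'J f x).
Proof.
move=> oU cf; apply: Ck_mx => // i c.
apply: Ck_ext (Ck_D i (Ck_entry 0 c oU cf)) => // x Ux.
by apply/esym/jacobian_D; exact: Ck_differentiable cf Ux.
Qed.

End CoordinateDerivative.

(** * Levi-Civita connections, curvature and their behaviour under isometries *)

Section Connection.
Context {R : realType} {n : nat}.
Implicit Types (g h : 'rV[R]_n -> 'M[R]_n) (A B : 'I_n -> 'rV[R]_n -> 'M[R]_n).
Implicit Types (U : set 'rV[R]_n) (x : 'rV[R]_n).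

Local Notation D := coordinate_derivative.

(* [A i] is the matrix of the covariant derivative along the [i]-th coordinate
   field: [A i x j k] is Gamma^k_ij.  The last two conditions say that the
   connection is torsion free and metric. *)
Record levi_civita U g A : Prop := LeviCivita {
  lc_open : open U;
  lc_metric_diff : forall x, U x -> differentiable g x;
  lc_metric_sym : forall x, U x -> (g x)^T = g x;
  lc_metric_unit : forall x, U x -> g x \in unitmx;
  lc_diff : forall i x, U x -> differentiable (A i) x;
  lc_torsion_free : forall x, U x -> forall i j k, A i x j k = A j x i k;
  lc_compat : forall x, U x -> forall i,
    D i g x = A i x *m g x + (A i x *m g x)^T }.

(** Koszul's argument: torsion freeness ([S]) makes four of the six terms cancel and the other two
    coincide. A connection guessed in closed form thus only has to be verified, without computing
    with the inverse metric. *)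
Lemma levi_civita_christoffel U g A x k i j : levi_civita U g A -> U x ->
  christoffel g k i j x = A i x j k.
Proof.
case=> oU dg sg ug dA tA cA Ux.
have E a b c : partial a (fun y => g y b c) x = (A a x *m g x) b c + (A a x *m g x) c b.
  rewrite /partial derive_entry; last exact: dg.
  by rewrite -coordinate_derivativeE cA // [LHS]mxE [in X in _ + X]mxE.
have S a b c : (A a x *m g x) b c = (A b x *m g x) a c.
  by rewrite !mxE; apply: eq_bigr => d _; rewrite tA.
have gV : (invmx (g x))^T = invmx (g x) by rewrite trmx_inv sg.
have -> : A i x j k = (A i x *m g x *m invmx (g x)) j k.
  by rewrite mulmxK //; exact: ug.
rewrite /christoffel mxE mulr_sumr; apply: eq_bigr => l _.
rewrite !E (S i l j) (S j l i) (S j i l) -{1}gV mxE.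
by field.
Qed.

(** Row [j] holds the components of R(d_l, d_i) d_j. The products appear in the opposite of the
    usual order because the matrices act on row vectors from the right. *)
Definition curvature A (l i : 'I_n) x : 'M[R]_n :=
  D l (A i) x - D i (A l) x + A i x *m A l x - A l x *m A i x.

Lemma levi_civita_ricci U g A x i j : levi_civita U g A -> U x ->
  ricci g x i j = \sum_k curvature A k j x i k.
Proof.
move=> LC Ux; have [oU dg sg ug dA tA cA] := LC.
have E k a b c : partial k (christoffel g a b c) x = D k (A b) x c a.
  rewrite -D_entry; last exact: dA.
  rewrite /partial -coordinate_derivativeE; apply: near_eq_D; near=> y.
  apply: levi_civita_christoffel; first exact: LC.
  by near: y; exact: open_nbhs_nbhs.
have sw a b c d : D d (A a) x b c = D d (A b) x a c.
  rewrite -(D_entry d b c (dA a x Ux)) -(D_entry d a c (dA b x Ux)).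
  apply: near_eq_D; near=> y.
  by apply: tA; near: y; exact: open_nbhs_nbhs.
rewrite mxE -big_split /=; apply: eq_bigr => k _.
rewrite !E !mxE (sw i j) (sw i k) -addrA; congr (_ + _).
rewrite -sumrB; apply: eq_bigr => l _.
rewrite !(levi_civita_christoffel _ _ _ LC Ux) (tA x Ux i j) (tA x Ux i k).
by rewrite mulrC [X in _ - X]mulrC.
Unshelve. all: by end_near. Qed.

Section Isometry.
Context (U U' : set 'rV[R]_n) (g h : 'rV[R]_n -> 'M[R]_n).
Context (A A' : 'I_n -> 'rV[R]_n -> 'M[R]_n) (phi : 'rV[R]_n -> 'rV[R]_n).
Hypotheses (gA : levi_civita U g A) (hA : levi_civita U' h A').
Hypotheses (phiU : forall x, U x -> U' (phi x)) (phi_smooth : Ck 3 U phi).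
Hypothesis phi_isometry : forall x, U x ->
  'J phi x *m h (phi x) *m ('J phi x)^T = g x.

Let J x : 'M[R]_n := 'J phi x.

Let oU : open U. Proof. exact: lc_open gA. Qed.

Let dphi x : U x -> differentiable phi x.
Proof. exact: Ck_differentiable phi_smooth. Qed.

Let JE x i c : U x -> J x i c = D i (fun y => phi y 0 c) x.
Proof. by move=> Ux; apply: jacobian_D; exact: dphi. Qed.

Let Jsmooth : Ck 2 U J.
Proof. exact: Ck_jacobian. Qed.

Let dJ x : U x -> differentiable J x.
Proof. exact: Ck_differentiable Jsmooth. Qed.

Let DJ_sym x i j c : U x -> D i J x j c = D j J x i c.
Proof.
move=> Ux.
have e a b : D a J x b c = D a (fun y => D b (fun z => phi z 0 c) y) x.
  rewrite -D_entry; last exact: dJ.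
  by apply: near_eq_D; near=> y; rewrite JE //; near: y; exact: open_nbhs_nbhs.
rewrite !e; exact: (D_comm _ _ oU (CkW (Ck_entry 0 c oU phi_smooth)) Ux).
Unshelve. all: by end_near. Qed.

Let derive_pullback m p (F : 'rV[R]_n -> 'M[R]_(m, p)) x i :
  U x -> differentiable F (phi x) ->
  D i (fun y => F (phi y)) x = \sum_a J x i a *: D a F (phi x).
Proof. by move=> Ux dF; rewrite D_comp //; exact: dphi. Qed.

(** The connection of [h] pulled back to a connection along [phi]: the derivative in direction [i]
    uses [A'] at [phi x] in the direction of row [i] of the Jacobian. *)
Let B i x : 'M[R]_n := \sum_a J x i a *: A' a (phi x).

Let dcomp m p (F : 'rV[R]_n -> 'M[R]_(m, p)) x :
  U x -> differentiable F (phi x) -> differentiable (fun y => F (phi y)) x.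
Proof. by move=> Ux dF; exact: differentiable_comp (dphi Ux) dF. Qed.

(** Each of the three terms is symmetric on its own: by torsion freeness of [A], by symmetry of the
    second derivatives of [phi], and by torsion freeness of [A']. *)
Let E_sym x i j l : U x ->
  (A i x *m g x - D i J x *m h (phi x) *m (J x)^T
   - J x *m B i x *m h (phi x) *m (J x)^T) j l =
  (A j x *m g x - D j J x *m h (phi x) *m (J x)^T
   - J x *m B j x *m h (phi x) *m (J x)^T) i l.
Proof.
move=> Ux; have [_ _ _ _ _ tA _] := gA; have [_ _ _ _ _ tA' _] := hA.
rewrite !mxE; congr (_ - _ - _).
- by apply: eq_bigr => k _; rewrite tA.
- apply: eq_bigr => k _; congr (_ * _).
  by rewrite !mxE; apply: eq_bigr => c _; rewrite DJ_sym.
- apply: eq_bigr => k _; congr (_ * _).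
  rewrite !mxE; apply: eq_bigr => c _; congr (_ * _).
  rewrite !mxE.
  under eq_bigr => b _ do rewrite summxE mulr_sumr.
  rewrite exchange_big /=; apply: eq_bigr => a _.
  rewrite summxE mulr_sumr; apply: eq_bigr => b _.
  by rewrite !mxE (tA' _ (phiU Ux)) mulrCA.
Qed.

Let T i x := D i J x *m h (phi x) *m (J x)^T.
Let Q i x := J x *m B i x *m h (phi x) *m (J x)^T.

Let Dg x i : U x -> D i g x = T i x + Q i x + (Q i x)^T + (T i x)^T.
Proof.
move=> Ux; have Ux' := phiU Ux.
have [_ dg sg ug _ _ cA] := gA; have [_ dh sh uh _ _ cA'] := hA.
have -> : D i g x = D i (fun y => J y *m h (phi y) *m (J y)^T) x.
  apply: near_eq_D; near=> y; rewrite -phi_isometry //.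
  by near: y; exact: open_nbhs_nbhs.
have dhp := dcomp Ux (dh _ Ux').
rewrite D_mulmx; last 2 first.
- by apply: differentiable_mulmx => //; exact: dJ.
- by apply: differentiable_trmx; exact: dJ.
rewrite D_mulmx //; last exact: dJ.
rewrite D_trmx; last exact: dJ.
rewrite mulmxDl -!addrA; congr (_ + _).
rewrite [X in _ = _ + (_ + X)](_ : _ = J x *m h (phi x) *m (D i J x)^T); last first.
  by rewrite /T !trmx_mul trmxK sh // mulmxA.
rewrite addrA; congr (_ + _).
rewrite [D i _ x](derive_pullback i Ux (dh _ Ux')).
have -> : \sum_a J x i a *: D a h (phi x) =
    B i x *m h (phi x) + (B i x *m h (phi x))^T.
  rewrite /B mulmx_suml linear_sum -big_split /=; apply: eq_bigr => a _.
  by rewrite cA' // scalerDr -scalemxAl linearZ.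
by rewrite mulmxDr mulmxDl /Q !mulmxA !trmx_mul trmxK !mulmxA.
Unshelve. all: by end_near. Qed.

Lemma jacobian_unit x : U x -> J x \in unitmx.
Proof.
move=> Ux; have := lc_metric_unit gA Ux.
by rewrite -phi_isometry // -mulmxA unitmx_mul => /andP[].
Qed.

(* The difference [E] of the two sides is symmetric in its first two indices
   and, both connections being metric, antisymmetric in the last two. *)
Lemma connection_pullback x i : U x -> D i J x = A i x *m J x - J x *m B i x.
Proof.
move=> Ux; have Ux' := phiU Ux.
pose E k := A k x *m g x - T k x - Q k x.
have Esym k j l : E k j l = E j k l by exact: E_sym.
have Eanti k j l : E k j l = - E k l j.
  have mD (M N : 'M[R]_n) a b : (M + N) a b = M a b + N a b by rewrite mxE.
  have mN (M : 'M[R]_n) a b : (- M) a b = - M a b by rewrite mxE.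
  have mT (M : 'M[R]_n) a b : M^T a b = M b a by rewrite mxE.
  have := Dg k Ux; rewrite (lc_compat gA Ux) => /matrixP/(_ j l).
  rewrite /E !(mD, mN, mT) => H; lra.
(* Alternating the two symmetries, three times each, brings the indices back to their places with an
   odd number of sign changes. *)
have E0 : E i = 0.
  apply/matrixP => j l; rewrite [RHS]mxE.
  have : E i j l = - E i j l.
    by rewrite {1}Esym Eanti Esym Eanti opprK Esym Eanti.
  by move=> /eqP; rewrite -addr_eq0 -mulr2n mulrn_eq0 => /eqP.
have uJ := jacobian_unit Ux.
have uhJ : h (phi x) *m (J x)^T \in unitmx.
  by rewrite unitmx_mul unitmx_tr uJ (lc_metric_unit hA).
apply: (can_inj (mulmxK uhJ)).
rewrite mulmxBl -!mulmxA.
move/eqP: E0; rewrite /E -addrA -opprD subr_eq0 => /eqP E0.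
have -> : J x *m (h (phi x) *m (J x)^T) = g x by rewrite mulmxA phi_isometry.
by rewrite E0 /T /Q -!mulmxA addrK.
Qed.

Let dB x i : U x -> differentiable (B i) x.
Proof.
move=> Ux; apply: differentiable_sumf => a; apply: differentiable_scalef.
  exact: differentiable_entry (dJ Ux).
by apply: dcomp => //; apply: (lc_diff hA); exact: phiU.
Qed.

Let DDJ x i l : U x ->
  D l (fun y => D i J y) x = D l (A i) x *m J x + A i x *m D l J x
     - (D l J x *m B i x + J x *m D l (B i) x).
Proof.
move=> Ux; have dA k := lc_diff gA k Ux.
have -> : D l (fun y => D i J y) x = D l (fun y => A i y *m J y - J y *m B i y) x.
  apply: near_eq_D; near=> y; rewrite -connection_pullback //.
  by near: y; exact: open_nbhs_nbhs.
have dAJ : differentiable (fun y => A i y *m J y) x.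
  by apply: differentiable_mulmx => //; exact: dJ.
have dJB : differentiable (fun y => J y *m B i y) x.
  by apply: differentiable_mulmx; [exact: dJ|exact: dB].
rewrite DB //.
by rewrite !D_mulmx //; [exact: dJ|exact: dB|exact: dJ].
Unshelve. all: by end_near. Qed.

(** This is the integrability condition of the linear system [D i J = A i J - J B i]: substituting
    it into the equality of the mixed second derivatives of [J] leaves only the curvatures. Here the
    third derivatives of [phi] are used. *)
Let curvature_pullbackB x l i : U x ->
  curvature A l i x *m J x = J x *m curvature B l i x.
Proof.
move=> Ux.
have DDsym : D l (fun y => D i J y) x = D i (fun y => D l J y) x.
  apply/matrixP => j c.
  have dD k : differentiable (fun y => D k J y) x.
    exact: Ck_differentiable (Ck_D k Jsmooth) Ux.
  rewrite -!D_entry //.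
  have nE k : \near x, D k (fun y => J y j c) x = D k J x j c.
    by near=> y; rewrite D_entry //; apply: dJ; near: y; exact: open_nbhs_nbhs.
  rewrite -(near_eq_D l (nE i)) -(near_eq_D i (nE l)).
  exact: (D_comm _ _ oU (Ck_entry j c oU Jsmooth)).
move: DDsym; rewrite !DDJ // !connection_pullback //.
rewrite /curvature !(mulmxBl, mulmxDl, mulmxBr, mulmxDr, mulmxN) !mulmxA => H.
apply/matrixP => a b; move/matrixP/(_ a b): H.
have mD (M N : 'M[R]_n) : (M + N) a b = M a b + N a b by rewrite mxE.
have mN (M : 'M[R]_n) : (- M) a b = - M a b by rewrite mxE.
rewrite !(mD, mN) => H; lra.
Unshelve. all: by end_near. Qed.

(** The second derivatives of [phi] occurring in [D l (B i)] and [D i (B l)] are symmetric in [l]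
    and [i], so they cancel and the curvature is tensorial. *)
Let curvature_B x l i : U x ->
  curvature B l i x = \sum_a \sum_b (J x l a * J x i b) *: curvature A' a b (phi x).
Proof.
move=> Ux; have Ux' := phiU Ux; have dA' k := lc_diff hA k Ux'.
have DBE k r : D k (B r) x = \sum_a D k J x r a *: A' a (phi x)
    + \sum_a \sum_b (J x k b * J x r a) *: D b (A' a) (phi x).
  rewrite D_sumf => [|a]; last first.
    apply: differentiable_scalef; first exact: differentiable_entry (dJ Ux).
    exact: dcomp.
  rewrite -big_split /=; apply: eq_bigr => a _.
  rewrite D_scalef; last 2 first.
  - exact: differentiable_entry (dJ Ux).
  - exact: dcomp.
  rewrite D_entry; last exact: dJ.
  rewrite (derive_pullback k Ux (dA' a)) scaler_sumr.
  by congr (_ + _); apply: eq_bigr => b _; rewrite scalerA mulrC.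
have BB k r : B k x *m B r x =
    \sum_a \sum_b (J x k a * J x r b) *: (A' a (phi x) *m A' b (phi x)).
  rewrite mulmx_suml; apply: eq_bigr => a _; rewrite mulmx_sumr.
  by apply: eq_bigr => b _; rewrite -scalemxAl -scalemxAr scalerA.
have D1 : D l (B i) x = \sum_a D l J x i a *: A' a (phi x)
    + \sum_a \sum_b (J x l a * J x i b) *: D a (A' b) (phi x).
  by rewrite DBE exchange_big.
have D2 : D i (B l) x = \sum_a D l J x i a *: A' a (phi x)
    + \sum_a \sum_b (J x l a * J x i b) *: D b (A' a) (phi x).
  rewrite DBE; congr (_ + _); first by apply: eq_bigr => a _; rewrite DJ_sym.
  by apply: eq_bigr => a _; apply: eq_bigr => b _; rewrite mulrC.
have B1 : B i x *m B l x =
    \sum_a \sum_b (J x l a * J x i b) *: (A' b (phi x) *m A' a (phi x)).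
  rewrite BB exchange_big; apply: eq_bigr => a _; apply: eq_bigr => b _.
  by rewrite mulrC.
rewrite [LHS]/curvature D1 D2 B1 BB opprD addrACA subrr add0r -!sumrB -big_split -sumrB.
apply: eq_bigr => a _; rewrite /= -!sumrB -big_split -sumrB; apply: eq_bigr => b _.
by rewrite /= -!scalerBr -scalerDr -scalerBr.
Qed.

Theorem ricci_pullback x : U x ->
  'J phi x *m ricci h (phi x) *m ('J phi x)^T = ricci g x.
Proof.
move=> Ux; have Ux' := phiU Ux; rewrite -/(J x).
have uJ := jacobian_unit Ux.
apply/matrixP => i j; rewrite (levi_civita_ricci _ _ gA Ux).
have cE k : curvature A k j x = \sum_a \sum_b (J x k a * J x j b) *:
    (J x *m curvature A' a b (phi x) *m invmx (J x)).
  rewrite -[LHS](mulmxK uJ) curvature_pullbackB // curvature_B // mulmx_sumr mulmx_suml.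
  apply: eq_bigr => a _; rewrite mulmx_sumr mulmx_suml; apply: eq_bigr => b _.
  by rewrite -scalemxAr -scalemxAl.
under eq_bigr => k _ do rewrite cE summxE.
rewrite exchange_big /= mxE.
under [LHS]eq_bigr => b _ do rewrite mxE mulr_suml.
rewrite exchange_big /=.
have mZ c (M : 'M[R]_n) a b : (c *: M) a b = c * M a b by rewrite mxE.
(* Summing over [k] cancels the factor [J x k a] against [invmx (J x)]: the trace does not depend on
   the frame. *)
have E a b : \sum_k ((J x k a * J x j b) *:
      (J x *m curvature A' a b (phi x) *m invmx (J x))) i k =
    J x j b * (J x *m curvature A' a b (phi x)) i a.
  rewrite -{2}[J x *m curvature A' a b (phi x)](mulmxKV uJ) [X in _ = _ * X]mxE mulr_sumr.
  apply: eq_bigr => k _; rewrite (mZ (J x k a * J x j b)); ring.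
transitivity (\sum_a \sum_b J x j b * (J x *m curvature A' a b (phi x)) i a);
  last first.
  apply: eq_bigr => a _; under [RHS]eq_bigr => k _ do rewrite summxE.
  by rewrite exchange_big; apply: eq_bigr => b _; rewrite E.
rewrite [RHS]exchange_big /= exchange_big /=; apply: eq_bigr => b _.
rewrite -mulr_sumr [X in X = _](_ : _ = J x j b * \sum_c J x i c * ricci h (phi x) c b).
  congr (_ * _); under [RHS]eq_bigr => a _ do rewrite mxE.
  rewrite exchange_big; apply: eq_bigr => c _.
  by rewrite (levi_civita_ricci _ _ hA Ux') mulr_sumr.
by rewrite mulr_sumr; apply: eq_bigr => c _; rewrite [_^T _ _]mxE mulrC.
Qed.

(* The gradient of [f \o phi], as a column, is [J *m F \o phi] where [F] is
   the gradient of [f]; so this is the naturality of the Hessian. *)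
Lemma hessian_pullback (F : 'rV[R]_n -> 'cV[R]_n) (S : 'I_n -> 'cV[R]_n) x i :
  U x -> differentiable F (phi x) ->
  (forall a, D a F (phi x) - A' a (phi x) *m F (phi x) = S a) ->
  D i (fun y => J y *m F (phi y)) x - A i x *m (J x *m F (phi x)) =
  J x *m \sum_a J x i a *: S a.
Proof.
move=> Ux dF ES; have dFp := dcomp Ux dF.
rewrite D_mulmx //; last exact: dJ.
rewrite (derive_pullback i Ux dF) connection_pullback //.
rewrite mulmxBl !mulmxA [in LHS]addrAC [_ - _ - _]addrAC subrr add0r addrC.
rewrite -mulmxA -mulmxBr; congr (_ *m _).
rewrite /B mulmx_suml -sumrB; apply: eq_bigr => a _.
by rewrite -ES scalerBr scalemxAl.
Qed.

End Isometry.
End Connection.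

(** * Open subsets of coordinate space as manifolds *)

Section OpenSubset.
Context {R : realType} {n : nat} (U : set 'rV[R]_n).
Hypothesis oU : open U.
Local Notation T := (set_type U).

Lemma set_valU (p : T) : U (\val p).
Proof. exact: set_valP. Qed.

Lemma set_val_continuous : continuous (\val : T -> 'rV[R]_n).
Proof. exact: (@initial_continuous _ _ (set_val : T -> 'rV[R]_n)). Qed.

Lemma set_type_hausdorff : hausdorff_space T.
Proof.
move=> p q pq; apply: val_inj.
apply: (@norm_hausdorff _ 'rV[R]_n) => A B nA nB.
have [r [rA rB]] := pq _ _ (set_val_continuous nA) (set_val_continuous nB).
by exists (\val r).
Qed.

Lemma set_type_second_countable : @second_countable T.
Proof.
pose b (ck : 'rV[rat]_n * nat) : set T :=
  \val @^-1` (ball (map_mx ratr ck.1 : 'rV[R]_n) (ck.2.+1%:R^-1)).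
exists (b @` setT); first exact: (card_le_trans (card_image_le _ _) (countableP _)).
split=> [_ [ck _ <-]|p V].
  by exists (ball (map_mx ratr ck.1 : 'rV[R]_n) (ck.2.+1%:R^-1)) => //; exact: ball_open.
move=> [_ [[W oW <-] /= Wp WV]].
have /nbhs_ballP[e /= e0 eW] : nbhs (\val p) W by exact: open_nbhs_nbhs.
have e20 : 0 < e / 2 by rewrite divr_gt0.
have [k ke] := ltr_add_invr e20; rewrite add0r in ke.
have k0 : (0 : R) < k.+1%:R^-1 by rewrite invr_gt0.
have hc i j : exists c : rat, ball (ratr c : R) (k.+1%:R^-1) ((\val p : 'rV[R]_n) i j).
  have [|c] := @rat_in_itvoo R ((\val p : 'rV[R]_n) i j - k.+1%:R^-1)
    ((\val p : 'rV[R]_n) i j + k.+1%:R^-1).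
    by rewrite ltrD2l gt0_cp.
  by rewrite in_itv /= => cb; exists c; rewrite -ball_normE /= ltr_distl.
pose c : 'rV[rat]_n := \matrix_(i, j) projT1 (cid (hc i j)).
have cp : ball (map_mx ratr c : 'rV[R]_n) (k.+1%:R^-1) (\val p).
  by split=> // i j; rewrite !mxE; case: (cid (hc i j)).
exists (b (c, k)); first by split=> //; exists (c, k).
move=> q /= cq; apply: WV; apply: eW; rewrite (splitr e).
by apply: (@ball_triangle _ _ (map_mx ratr c : 'rV[R]_n));
  [apply/ball_sym|]; exact: le_ball (ltW ke) _ _.
Qed.

Section Chart.
Context (p0 : T).

(** A chart needs a total inverse, so vectors outside [U] go to [p0]; this is why the manifold
    structures below carry a base point. *)
Definition set_point (x : 'rV[R]_n) : T := insubd p0 x.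

Lemma set_pointK (x : 'rV[R]_n) : U x -> \val (set_point x) = x.
Proof. by move=> Ux; rewrite /set_point insubdK //; apply/mem_set. Qed.

Lemma set_valK : cancel \val set_point.
Proof. by move=> p; rewrite /set_point valKd. Qed.

Lemma set_codom : (\val : T -> 'rV[R]_n) @` setT = U.
Proof.
apply/seteqP; split=> [_ [p _ <-]|x Ux]; first exact: set_valU.
by exists (set_point x) => //; rewrite set_pointK.
Qed.

Let dom_open : open [set: T]. Proof. exact: openT. Qed.
Let codom_open : open ((\val : T -> 'rV[R]_n) @` setT).
Proof. by rewrite set_codom. Qed.
Let coordK p : [set: T] p -> set_point (\val p) = p.
Proof. by rewrite set_valK. Qed.
Let coord_cont : {within [set: T], continuous (\val : T -> 'rV[R]_n)}.
Proof. exact/continuous_subspaceT/set_val_continuous. Qed.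

Lemma set_point_continuous : {within U, continuous set_point}.
Proof.
apply/subspace_sigL_continuousP => p; rewrite /sigL.
have -> : set_point \o set_val = id :> (T -> T).
  by apply/funext => q /=; exact: set_valK.
exact: cvg_id.
Qed.

Lemma set_point_continuous_at x : U x -> {for x, continuous set_point}.
Proof.
move=> Ux; have := set_point_continuous.
by rewrite continuous_open_subspace // => /(_ x); apply; exact/mem_set.
Qed.

Let point_cont : {within (\val : T -> 'rV[R]_n) @` setT, continuous set_point}.
Proof. by rewrite set_codom; exact: set_point_continuous. Qed.

Definition set_chart : chart R n T :=
  Chart dom_open codom_open coordK coord_cont point_cont.

Lemma codom_set_chart : Defs.codom set_chart = U.
Proof. exact: set_codom. Qed.

Lemma smooth_val_point (W : set 'rV[R]_n) : W `<=` U -> open W ->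
  smooth_on W (fun x => \val (set_point x)).
Proof.
move=> WU oW k; apply: (@Ck_ext _ _ _ k W id) => //.
  by move=> x /WU Ux; rewrite set_pointK.
exact: Ck_id.
Qed.

Let chart_cover (p : T) : exists i : unit, dom ((fun=> set_chart) i) p.
Proof. by exists tt. Qed.
Let chart_compatible (i j : unit) : compatible set_chart set_chart.
Proof.
have E : local_dom set_chart set_chart idfun = U.
  rewrite /local_dom codom_set_chart; apply/seteqP.
  by split=> [x []|x Ux] //; split.
by split; rewrite E; apply: smooth_val_point.
Qed.

Definition open_manifold : manifold R n T :=
  Manifold set_type_hausdorff set_type_second_countable chart_cover chart_compatible.

End Chart.
End OpenSubset.

Lemma near_eq_jacobian (R : realType) n m (f g : 'rV[R]_n -> 'rV[R]_m) x :
  (\near x, f x = g x) -> differentiable f x -> 'J f x = 'J g x.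
Proof.
move=> fg df; have dg := near_eq_differentiable fg df.
apply/matrixP => i j.
apply: etrans (jacobian_D i j df) (etrans _ (esym (jacobian_D i j dg))).
apply: near_eq_D; by apply: filterS fg => y ->.
Qed.

Lemma jacobian_id (R : realType) n (x : 'rV[R]_n) : 'J (fun y : 'rV[R]_n => y) x = 1%:M.
Proof.
apply/row_matrixP => i; rewrite -[RHS]mulmx1 !rowE.
rewrite -deriveEjacobian; last exact: ex_diff.
by rewrite [LHS]derive_id mulmx1 mulmx1.
Qed.

(** * Maps and tensors given by formulas on open subsets *)

Section OpenManifoldMaps.
Context {R : realType} {n m : nat} (U : set 'rV[R]_n) (V : set 'rV[R]_m).
Hypotheses (oU : open U) (oV : open V).
Context (p0 : set_type U) (q0 : set_type V).
Context (f : set_type U -> set_type V) (F : 'rV[R]_n -> 'rV[R]_m).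
Hypothesis fF : forall p, \val (f p) = F (\val p).
Hypothesis smF : smooth_on U F.

Local Notation cU := (set_chart oU p0).
Local Notation cV := (set_chart oV q0).
Local Notation MU := (open_manifold oU p0).
Local Notation MV := (open_manifold oV q0).

Lemma local_dom_open : local_dom cU cV f = U.
Proof.
rewrite /local_dom codom_set_chart; apply/seteqP.
by split=> [x []|x Ux] //; split.
Qed.

Lemma local_map_open x : U x -> local_map cU cV f x = F x.
Proof. by move=> Ux; rewrite /local_map /= fF set_pointK. Qed.

Lemma near_local_map_open x : U x -> \near x, F x = local_map cU cV f x.
Proof.
move=> Ux; near=> y; rewrite local_map_open //.
by near: y; exact: open_nbhs_nbhs.
Unshelve. all: by end_near. Qed.

Lemma jacobian_local_map_open x : U x -> 'J (local_map cU cV f) x = 'J F x.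
Proof.
move=> Ux; rewrite (@near_eq_jacobian _ _ _ F (local_map cU cV f)) //.
  exact: near_local_map_open.
exact: Ck_differentiable (smF 1%N) Ux.
Qed.

Lemma continuous_open : continuous f.
Proof.
apply: continuous_comp_initial => p.
have -> : set_val \o f = F \o \val by apply/funext => q; exact: fF.
apply: continuous_comp; first exact: set_val_continuous.
exact: (smF 0%N _ (set_valU p)).
Qed.

Lemma smooth_open : smooth MU MV f.
Proof.
split=> [|[] []]; first exact: continuous_open.
rewrite /= local_dom_open => k; apply: Ck_ext (smF k) => // x Ux.
by rewrite local_map_open.
Qed.

Lemma pulls_back_open (h : Defs.index MV -> 'rV[R]_m -> 'M[R]_m)
    (g : Defs.index MU -> 'rV[R]_n -> 'M[R]_n) :
  (forall x, U x -> 'J F x *m h tt (F x) *m ('J F x)^T = g tt x) ->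
  pulls_back (A := MU) (B := MV) f h g.
Proof.
move=> H [] [] x; rewrite local_dom_open => Ux; pose L := local_map cU cV f.
change ('J L x *m h tt (L x) *m ('J L x)^T = g tt x).
by rewrite jacobian_local_map_open // /L local_map_open // H.
Qed.

Lemma related_open (X : Defs.index MU -> 'rV[R]_n -> 'rV[R]_n)
    (Y : Defs.index MV -> 'rV[R]_m -> 'rV[R]_m) :
  (forall x, U x -> X tt x *m 'J F x = Y tt (F x)) ->
  related (A := MU) (B := MV) f X Y.
Proof.
move=> H [] [] x; rewrite local_dom_open => Ux; pose L := local_map cU cV f.
change (X tt x *m 'J L x = Y tt (L x)).
by rewrite jacobian_local_map_open // /L local_map_open // H.
Qed.

Lemma submersion_open : (forall x, U x -> row_full ('J F x)) -> submersion MU MV f.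
Proof.
move=> H; split=> [|[] [] x]; first exact: smooth_open.
by rewrite local_dom_open => Ux; rewrite jacobian_local_map_open //; exact: H.
Qed.

End OpenManifoldMaps.

Lemma row_mx_continuous (R : realType) (T : topologicalType) n m
    (f : T -> 'rV[R]_n) (g : T -> 'rV[R]_m) x :
  {for x, continuous f} -> {for x, continuous g} ->
  {for x, continuous (fun y => row_mx (f y) (g y))}.
Proof.
move=> cf cg; apply: entries_continuous => i j.
rewrite /prop_for /continuous_at.
case: (split_ordP j) => k ->.
  have -> : (fun y => row_mx (f y) (g y) i (lshift m k)) = (fun y => f y i k).
    by apply/funext => y; rewrite row_mxEl.
  rewrite row_mxEl.
  exact: (@continuous_comp _ _ _ f (fun N : 'rV[R]_n => N i k) _ cf (@coord_continuous _ _ _ _ _ _)).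
have -> : (fun y => row_mx (f y) (g y) i (rshift n k)) = (fun y => g y i k).
  by apply/funext => y; rewrite row_mxEr.
rewrite row_mxEr.
exact: (@continuous_comp _ _ _ g (fun N : 'rV[R]_m => N i k) _ cg (@coord_continuous _ _ _ _ _ _)).
Qed.

Section OpenManifoldProduct.
Context {R : realType} {n m l : nat}.
Context (U : set 'rV[R]_n) (V : set 'rV[R]_m) (W : set 'rV[R]_l).
Hypotheses (oU : open U) (oV : open V) (oW : open W).
Context (p0 : set_type U) (q0 : set_type V) (r0 : set_type W).

Lemma smooth2_open (f : set_type U -> set_type V -> set_type W)
    (F : 'rV[R]_(n + m) -> 'rV[R]_l) :
  (forall p q, \val (f p q) = F (row_mx (\val p) (\val q))) ->
  smooth_on [set z | U (lsubmx z) /\ V (rsubmx z)] F ->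
  smooth2 (open_manifold oU p0) (open_manifold oV q0) (open_manifold oW r0) f.
Proof.
move=> fF smF; split.
  apply: continuous_comp_initial => p.
  pose rm (z : set_type U * set_type V) : 'rV[R]_(n + m) := row_mx (\val z.1) (\val z.2).
  have -> : set_val \o (fun z => f z.1 z.2) = F \o rm by apply/funext => q; exact: fF.
  apply: continuous_comp; last first.
    by apply: (smF 0%N); split; rewrite ?row_mxKl ?row_mxKr; exact: set_valU.
  have c1 : continuous (fun z : set_type U * set_type V => \val z.1 : 'rV[R]_n).
    by move=> z; apply: continuous_comp; [exact: cvg_fst|exact: set_val_continuous].
  have c2 : continuous (fun z : set_type U * set_type V => \val z.2 : 'rV[R]_m).
    by move=> z; apply: continuous_comp; [exact: cvg_snd|exact: set_val_continuous].
  by apply: row_mx_continuous; [exact: c1|exact: c2].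
move=> [] [] [] /=.
have -> : [set z | [/\ Defs.codom (set_chart oU p0) (lsubmx z),
     Defs.codom (set_chart oV q0) (rsubmx z) &
     [set: set_type W] (f (set_point p0 (lsubmx z)) (set_point q0 (rsubmx z)))]] =
    [set z : 'rV[R]_(n + m) | U (lsubmx z) /\ V (rsubmx z)].
  rewrite !codom_set_chart; apply/seteqP.
  by split=> [z []|z [? ?]] //; split.
move=> k; apply: Ck_ext (smF k) => [|z [Uz Vz]].
  apply: openI.
    by apply: open_comp oU => z _; exact: continuous_lsubmx.
  by apply: open_comp oV => z _; exact: continuous_rsubmx.
by rewrite fF !set_pointK // hsubmxK.
Qed.

End OpenManifoldProduct.

Section OpenManifoldTensors.
Context {R : realType} {n : nat} (U : set 'rV[R]_n) (oU : open U) (p0 : set_type U).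
Local Notation M := (open_manifold oU p0).

Let idE (p : set_type U) : \val (@idfun (set_type U) p) = (fun x : 'rV[R]_n => x) (\val p).
Proof. by []. Qed.
Let smooth_idU : smooth_on U (fun x : 'rV[R]_n => x).
Proof. by move=> k; exact: Ck_id. Qed.

Definition open_metric (g : 'rV[R]_n -> 'M[R]_n) (smg : smooth_on U g)
    (sg : forall x, U x -> (g x)^T = g x)
    (ug : forall x, U x -> g x \in unitmx) : pseudo_metric M.
Proof.
apply: (@Defs.PseudoMetric _ _ _ M (fun _ => g)).
- by move=> [] /=; rewrite codom_set_chart.
- by move=> [] /= x; rewrite codom_set_chart; exact: sg.
- by move=> [] /= x; rewrite codom_set_chart; exact: ug.
- apply: (@pulls_back_open _ _ _ _ _ oU oU p0 p0 idfun id idE smooth_idU) => x Ux.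
  by rewrite jacobian_id mul1mx trmx1 mulmx1.
Defined.

Definition open_field (X : 'rV[R]_n -> 'rV[R]_n) (smX : smooth_on U X) : vector_field M.
Proof.
apply: (@VectorField _ _ _ M (fun _ => X)).
- by move=> [] /=; rewrite codom_set_chart.
- apply: (@related_open _ _ _ _ _ oU oU p0 p0 idfun id idE smooth_idU) => x Ux.
  by rewrite jacobian_id mulmx1.
Defined.

End OpenManifoldTensors.

(** * The metric *)

Section Coordinates.
Context {R : realType} {n : nat}.
Implicit Types (x : 'rV[R]_n.+1) (f g : 'rV[R]_n.+1 -> R).

(** Indexing by natural numbers gives the same atoms [co 0], [co 1], ... after case analysis on
    ordinals, as [ring] and [field] need. *)
Definition coordinate (k : nat) x : R := x 0 (inord k).

Lemma coordinate_ord (i : 'I_n.+1) x : coordinate i x = x 0 i.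
Proof. by rewrite /coordinate inord_val. Qed.

Lemma Ck_coordinate k m (U : set 'rV[R]_n.+1) : open U -> Ck k U (coordinate m).
Proof. by move=> oU; apply: Ck_entry => //; exact: Ck_id. Qed.

Lemma continuous_coordinate m : continuous (coordinate m).
Proof. by move=> x; apply: (@Ck_coordinate 0%N m setT) => //; exact: openT. Qed.

(** Differentiability and value travel together because each rule for values also needs the
    differentiability of its arguments. *)
Definition has_D (i : 'I_n.+1) f x (d : R) :=
  differentiable f x /\ coordinate_derivative i f x = d.

Lemma has_D_eq i f x d d' : has_D i f x d -> d = d' -> has_D i f x d'.
Proof. by move=> ? <-. Qed.

Lemma has_D_cst i (c : R) x : has_D i (fun _ => c) x 0.
Proof.
split; first exact: differentiable_cst.
rewrite coordinate_derivativeE; exact: derive_cst.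
Qed.

Lemma has_D_coordinate (i : 'I_n.+1) m x : (m <= n)%N ->
  has_D i (coordinate m) x (val i == m)%:R.
Proof.
move=> mn; split; first exact: differentiable_coord.
rewrite D_entry; last exact: ex_diff.
rewrite coordinate_derivativeE derive_id mxE eqxx /= -val_eqE /= inordK //.
by rewrite eq_sym.
Qed.

Lemma has_DD i f g x df dg : has_D i f x df -> has_D i g x dg ->
  has_D i (fun y => f y + g y) x (df + dg).
Proof.
move=> [cf <-] [cg <-]; split; first exact: differentiableD.
rewrite !coordinate_derivativeE.
by apply: (@deriveD _ _ _ f g); exact: diff_derivable.
Qed.

Lemma has_DB i f g x df dg : has_D i f x df -> has_D i g x dg ->
  has_D i (fun y => f y - g y) x (df - dg).
Proof.
move=> [cf <-] [cg <-]; split; first exact: differentiableB.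
exact: DB.
Qed.

Lemma has_DM i f g x df dg : has_D i f x df -> has_D i g x dg ->
  has_D i (fun y => f y * g y) x (df * g x + f x * dg).
Proof.
move=> [cf <-] [cg <-]; split; first exact: differentiableM.
rewrite !coordinate_derivativeE addrC [X in _ + X]mulrC.
by apply: (@deriveM _ _ f g); exact: diff_derivable.
Qed.

Lemma has_DX2 i f x df : has_D i f x df ->
  has_D i (fun y => f y ^+ 2) x (2 * f x * df).
Proof.
move=> hf; have -> : (fun y => f y ^+ 2) = (fun y => f y * f y).
  by apply/funext => y; rewrite expr2.
by apply: has_D_eq (has_DM hf hf) _; ring.
Qed.

Lemma has_DV i f x df : f x != 0 -> has_D i f x df ->
  has_D i (fun y => (f y)^-1) x (- (f x)^-1 ^+ 2 * df).
Proof.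
move=> f0 [cf <-]; split; first exact: differentiableV.
rewrite !coordinate_derivativeE exprVn.
by apply: deriveV => //; exact: diff_derivable.
Qed.

Lemma has_D_comp i (h : R -> R) f x df dh : is_derive (f x) 1 h dh ->
  has_D i f x df -> has_D i (fun y => h (f y)) x (dh * df).
Proof.
move=> [ch <-] [cf <-].
have dh' : differentiable h (f x) by exact/derivable1_diffP.
have dhf : differentiable (fun y => h (f y)) x by exact: (differentiable_comp cf dh').
split=> //; rewrite !coordinate_derivativeE.
apply: etrans (deriveE _ dhf) _.
have e : 'd (h \o f) x = 'd h (f x) \o 'd f x :> (_ -> _) := diff_comp cf dh'.
apply: etrans (congr1 (fun F => F _) e) _.
apply: etrans (congr1 (fun F => F _) (deriv1E ch)) _.
by rewrite /= -(deriveE _ cf) derive1E; apply: mulrC.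
Qed.

Lemma has_D_if i (b : bool) f x df : has_D i f x df ->
  has_D i (fun y => if b then f y else 0) x (if b then df else 0).
Proof. by case: b => // _; exact: has_D_cst. Qed.

Lemma has_D_mx p q (f : 'I_p -> 'I_q -> 'rV[R]_n.+1 -> R) (df : 'I_p -> 'I_q -> R)
    (l : 'I_n.+1) x :
  (forall i j, has_D l (f i j) x (df i j)) ->
  differentiable (fun y => \matrix_(i, j) f i j y) x /\
  coordinate_derivative l (fun y => \matrix_(i, j) f i j y) x = \matrix_(i, j) df i j.
Proof.
move=> H.
have E i j : (fun y => (\matrix_(i, j) f i j y) i j) = f i j.
  by apply/funext => y; rewrite mxE.
have dm : differentiable (fun y => \matrix_(i, j) f i j y) x.
  by apply: entries_differentiable => i j; rewrite E; have [] := H i j.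
split=> //; apply/matrixP => i j.
by rewrite -(D_entry l i j dm) E mxE; have [] := H i j.
Qed.

End Coordinates.

(** * The metric, its connection, its Ricci tensor and the soliton equation *)

Section Metric.
Context {R : realType}.
Implicit Types (x : 'rV[R]_4) (i j k l m : nat).

Local Notation co := (@coordinate R 3).

Definition rsq x : R := co 0 x ^+ 2 + co 1 x ^+ 2 + co 2 x ^+ 2.

(* The radial coordinate of Minkowski space is [rsq / 2], so that the half
   space is the complement of the axis [rsq = 0]. *)
Definition off_axis : set 'rV[R]_4 := [set x | rsq x != 0].

Let w x := (rsq x)^-1.

Definition sphere_entry i j x : R :=
  if (i < 3)%N && (j < 3)%N
  then (i == j)%:R * w x - co i x * co j x * w x ^+ 2 else 0.

Definition minkowski_entry i j x : R :=
  (if (i < 3)%N && (j == 3) then co i x else 0)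
  + (if (i == 3) && (j < 3)%N then co j x else 0).

Definition soliton_mx x : 'M[R]_4 :=
  \matrix_(i, j) (sphere_entry i j x + minkowski_entry i j x).

Definition sphere_mx x : 'M[R]_4 := \matrix_(i, j) sphere_entry i j x.

(** The index of v never occurs: both dv and x . dx = du are parallel, since (u, v) are affine
    coordinates of the flat factor. What remains is the connection of the sphere factor in Cartesian
    coordinates, corrected so that du is parallel. *)
Definition connection_entry i j k x : R :=
  if [&& (i < 3)%N, (j < 3)%N & (k < 3)%N]
  then w x * ((i == j)%:R * co k x - (j == k)%:R * co i x - (i == k)%:R * co j x)
       + 2 * (w x ^+ 2 * (co i x * (co j x * co k x)))
  else 0.

Definition soliton_connection (i : 'I_4) x : 'M[R]_4 :=
  \matrix_(j, k) connection_entry i j k x.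

Let dw l x : R := - w x ^+ 2 * (2 * (if (l < 3)%N then co l x else 0)).

Let d l k : R := (l == k)%:R.

Let dsphere l i j x : R :=
  if (i < 3)%N && (j < 3)%N
  then d i j * dw l x
       - ((d l i * co j x + co i x * d l j) * w x ^+ 2
          + co i x * co j x * (2 * w x * dw l x))
  else 0.

Let dminkowski l i j : R :=
  (if (i < 3)%N && (j == 3) then d l i else 0)
  + (if (i == 3) && (j < 3)%N then d l j else 0).

Let dconnection l i j k x : R :=
  if [&& (i < 3)%N, (j < 3)%N & (k < 3)%N]
  then dw l x * (d i j * co k x - d j k * co i x - d i k * co j x)
       + w x * (d i j * d l k - d j k * d l i - d i k * d l j)
       + 2 * (2 * w x * dw l x * (co i x * (co j x * co k x))
              + w x ^+ 2 * (d l i * (co j x * co k x)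
                 + co i x * (d l j * co k x + co j x * d l k)))
  else 0.

Lemma has_D_rsq (l : 'I_4) x : has_D l rsq x (2 * (if (l < 3)%N then co l x else 0)).
Proof.
apply: has_D_eq.
  apply: has_DD; first apply: has_DD; apply: has_DX2; exact: has_D_coordinate.
by case: l => [[|[|[|[|//]]]] Hl] /=; ring.
Qed.

Let has_D_w (l : 'I_4) x : off_axis x -> has_D l w x (dw l x).
Proof. by move=> x0; apply: has_DV => //; exact: has_D_rsq. Qed.

Let has_D_co (l : 'I_4) k x : (k < 4)%N -> has_D l (co k) x (d l k).
Proof. by move=> k4; apply: has_D_coordinate; rewrite -ltnS. Qed.

Let has_D_sphere (l i j : 'I_4) x : off_axis x ->
  has_D l (sphere_entry i j) x (dsphere l i j x).
Proof.
move=> x0; apply: has_D_if.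
have Hw := has_D_w l x0; have Hi := has_D_co l x (ltn_ord i).
have Hj := has_D_co l x (ltn_ord j).
apply: has_D_eq.
  exact: has_DB (has_DM (has_D_cst _ _ _) Hw) (has_DM (has_DM Hi Hj) (has_DX2 Hw)).
rewrite -/(d i j) /=; ring.
Qed.

Let has_D_minkowski (l i j : 'I_4) x :
  has_D l (minkowski_entry i j) x (dminkowski l i j).
Proof. by apply: has_DD; apply: has_D_if; exact: has_D_co. Qed.

Let has_D_connection (l i j k : 'I_4) x : off_axis x ->
  has_D l (connection_entry i j k) x (dconnection l i j k x).
Proof.
move=> x0; apply: has_D_if.
have Hw := has_D_w l x0; have Hi := has_D_co l x (ltn_ord i).
have Hj := has_D_co l x (ltn_ord j); have Hk := has_D_co l x (ltn_ord k).
apply: has_D_eq.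
  apply: has_DD.
    apply: (has_DM Hw); apply: has_DB; first apply: has_DB.
    - exact: has_DM (has_D_cst _ _ _) Hk.
    - exact: has_DM (has_D_cst _ _ _) Hi.
    - exact: has_DM (has_D_cst _ _ _) Hj.
  apply: has_DM (has_D_cst _ _ _) _.
  exact: has_DM (has_DX2 Hw) (has_DM Hi (has_DM Hj Hk)).
by rewrite /= -/(d i j) -/(d j k) -/(d i k); ring.
Qed.

Lemma off_axis_open : open off_axis.
Proof.
have c : continuous rsq.
  by move=> x; apply: differentiable_continuous; have [] := has_D_rsq ord0 x.
have -> : off_axis = rsq @^-1` [set y | y != 0] by [].
apply: open_comp => [x _|]; first exact: c.
exact: open_neq.
Qed.

Lemma smooth_sphere_entry i j : smooth_on off_axis (sphere_entry i j).
Proof.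
move=> k; have oU := off_axis_open.
have cw : Ck k off_axis w.
  apply: CkV => //; apply: CkD => //; first apply: CkD => //;
    by apply: CkX => //; exact: Ck_coordinate.
rewrite /sphere_entry; case: (_ && _); last exact: (Ck_cst k off_axis (0 : R)).
apply: CkB => //.
  by apply: CkM => //; exact: (Ck_cst k off_axis ((i == j)%:R : R)).
apply: CkM => //; last exact: CkX.
by apply: CkM => //; exact: Ck_coordinate.
Qed.

Lemma smooth_soliton_mx : smooth_on off_axis soliton_mx.
Proof.
move=> k; have oU := off_axis_open; apply: Ck_mx => // i j.
apply: (@Ck_ext _ _ _ k off_axis (fun x => sphere_entry i j x + minkowski_entry i j x)) => //.
  by move=> x _; rewrite mxE.
apply: CkD => //; first exact: smooth_sphere_entry.
rewrite /minkowski_entry.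
by case: (_ && _); case: (_ && _); apply: CkD => //;
  (exact: Ck_coordinate || exact: (Ck_cst k off_axis (0 : R))).
Qed.

Lemma soliton_mx_sym x : (soliton_mx x)^T = soliton_mx x.
Proof.
apply/matrixP => i j; rewrite !mxE.
by case: i j => [[|[|[|[|//]]]] Hi] [[|[|[|[|//]]]] Hj];
  rewrite /sphere_entry /minkowski_entry /=; ring.
Qed.

Lemma soliton_mx_unit x : off_axis x -> soliton_mx x \in unitmx.
Proof.
move=> x0.
(* The inverse metric: r^2 - x x^T inverts the sphere block on the orthogonal complement of x, and x
   / r^2 is dual to the covector x that pairs with dv. *)
pose N : 'M[R]_4 := \matrix_(i, j)
  (if (i < 3)%N && (j < 3)%N then (i == j)%:R * rsq x - co i x * co j x
   else (if (i < 3)%N && (j == 3 :> nat) then co i x * w x else 0)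
     + (if (i == 3 :> nat) && (j < 3)%N then co j x * w x else 0)).
suff : soliton_mx x *m N = 1%:M by move/mulmx1_unit => [].
have x0' : co 0 x ^+ 2 + co 1 x ^+ 2 + co 2 x ^+ 2 != 0 by [].
apply/matrixP => i j; rewrite !mxE !big_ord_recl big_ord0 !mxE.
by case: i j => [[|[|[|[|//]]]] Hi] [[|[|[|[|//]]]] Hj];
  rewrite /sphere_entry /minkowski_entry /w /rsq /= /bump /=; field.
Qed.

Lemma soliton_levi_civita : levi_civita off_axis soliton_mx soliton_connection.
Proof.
have Hg (l : 'I_4) x (x0 : off_axis x) := has_D_mx
  (fun i j : 'I_4 => has_DD (has_D_sphere l i j x0) (has_D_minkowski l i j x)).
have HA (i l : 'I_4) x (x0 : off_axis x) := has_D_mx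
  (fun j k : 'I_4 => has_D_connection l i j k x0).
split.
- exact: off_axis_open.
- by move=> x x0; have [] := Hg ord0 x x0.
- by move=> x _; exact: soliton_mx_sym.
- exact: soliton_mx_unit.
- by move=> i x x0; have [] := HA i ord0 x x0.
- move=> x x0 i j k; rewrite !mxE.
  rewrite /connection_entry andbCA; case: (_ && _) => //.
  rewrite [in RHS](eq_sym (j : nat)) addrAC [in RHS]addrAC.
  by congr (_ + _); ring.
- move=> x x0 l; have [_ ->] := Hg l x x0.
  have x0' : co 0 x ^+ 2 + co 1 x ^+ 2 + co 2 x ^+ 2 != 0 by [].
  apply/matrixP => i j; rewrite !mxE !big_ord_recl !big_ord0 !mxE.
  by case: l i j => [[|[|[|[|//]]]] Hl] [[|[|[|[|//]]]] Hi] [[|[|[|[|//]]]] Hj];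
    rewrite /sphere_entry /minkowski_entry /connection_entry /dsphere /dminkowski /dw /w /d /rsq /= /bump /=; field.
Qed.

Lemma ricci_soliton_mx x : off_axis x -> ricci soliton_mx x = sphere_mx x.
Proof.
move=> x0.
have HA (i l : 'I_4) := has_D_mx (fun j k : 'I_4 => has_D_connection l i j k x0).
have x0' : co 0 x ^+ 2 + co 1 x ^+ 2 + co 2 x ^+ 2 != 0 by [].
apply/matrixP => i j; rewrite (levi_civita_ricci _ _ soliton_levi_civita x0) [RHS]mxE.
have E (k : 'I_4) : curvature soliton_connection k j x i k =
    dconnection k j i k x - dconnection j k i k x
    + \sum_(l < 4) connection_entry j i l x * connection_entry k l k x
    - \sum_(l < 4) connection_entry k i l x * connection_entry j l k x.
  have mD (M N : 'M[R]_4) (a b : 'I_4) : (M + N) a b = M a b + N a b by rewrite mxE.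
  have mN (M : 'M[R]_4) (a b : 'I_4) : (- M) a b = - M a b by rewrite mxE.
  have HD (a b : 'I_4) : coordinate_derivative b (soliton_connection a) x =
      \matrix_(i, j) dconnection b a i j x by have [] := HA a b.
  rewrite /curvature !(mD, mN) !HD.
  congr (_ - _ + _ - _); rewrite ?mxE //; by apply: eq_bigr => l _; rewrite !mxE.
under eq_bigr do rewrite E.
rewrite !big_ord_recl !big_ord0 /=.
by case: i j E => [[|[|[|[|//]]]] Hi] [[|[|[|[|//]]]] Hj] _;
  rewrite /sphere_entry /connection_entry /dconnection /dw /w /d /rsq /= /bump /=; field.
Qed.

Definition radial_field x : 'rV[R]_4 :=
  \row_k (if (k < 3)%N then 2^-1 * co k x else 0).

Lemma smooth_radial_field : smooth_on off_axis radial_field.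
Proof.
move=> k; have oU := off_axis_open; apply: Ck_mx => // i j.
apply: (@Ck_ext _ _ _ k off_axis
  (fun x => if (j < 3)%N then 2^-1 * co j x else 0)) => //.
  by move=> x _; rewrite mxE.
case: (j < 3)%N; last exact: (Ck_cst k off_axis (0 : R)).
by apply: CkM => //; [exact: (Ck_cst k off_axis (2^-1 : R))|exact: Ck_coordinate].
Qed.

Lemma soliton_equation_mx x : off_axis x ->
  lie_derivative radial_field soliton_mx x + ricci soliton_mx x = 1 *: soliton_mx x.
Proof.
move=> x0; rewrite ricci_soliton_mx // scale1r.
have x0' : co 0 x ^+ 2 + co 1 x ^+ 2 + co 2 x ^+ 2 != 0 by [].
have Dg (l i j : 'I_4) : partial l (fun y => soliton_mx y i j) x =
    dsphere l i j x + dminkowski l i j.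
  rewrite /partial -coordinate_derivativeE.
  have -> : (fun y => soliton_mx y i j) =
      (fun y => sphere_entry i j y + minkowski_entry i j y).
    by apply/funext => y; rewrite mxE.
  by have [_] := has_DD (has_D_sphere l i j x0) (has_D_minkowski l i j x).
have DX (l k : 'I_4) : partial l (fun y => radial_field y 0 k) x =
    if (k < 3)%N then 2^-1 * d l k else 0.
  rewrite /partial -coordinate_derivativeE.
  have -> : (fun y => radial_field y 0 k) =
      (fun y => if (k < 3)%N then 2^-1 * co k y else 0).
    by apply/funext => y; rewrite mxE.
  have [_ ->] := has_D_if (k < 3)%N
    (has_DM (has_D_cst l 2^-1 x) (has_D_co l x (ltn_ord k))).
  by rewrite mul0r add0r.
apply/matrixP => i j; rewrite !mxE.
under eq_bigr do rewrite Dg !DX !mxE.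
rewrite !big_ord_recl !big_ord0.
by case: i j => [[|[|[|[|//]]]] Hi] [[|[|[|[|//]]]] Hj];
  rewrite /sphere_entry /minkowski_entry /dsphere /dminkowski /dw /w /d /rsq /= /bump /=; field.
Qed.

(* The restrictions of the linear functions to the sphere, extended to the whole
   space by homogeneity of degree 0 in the first three coordinates. *)
Definition inv_radius x : R := (Num.sqrt (rsq x))^-1.

Definition sphere_coordinate (k : nat) x : R := inv_radius x * co k x.

(** The column of partial derivatives of [sphere_coordinate k], that is, its differential; no index
    is raised with the metric. *)
Definition sphere_gradient (k : nat) x : 'cV[R]_4 :=
  \col_j (if (j < 3)%N then inv_radius x * ((j == k :> nat)%:R - w x * (co j x * co k x)) else 0).

Lemma rsq_gt0 x : off_axis x -> 0 < rsq x.
Proof. by move=> x0; rewrite lt0r [_ != 0]x0 !addr_ge0 // sqr_ge0. Qed.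

Lemma has_D_inv_radius (l : 'I_4) x : off_axis x ->
  has_D l inv_radius x (- (inv_radius x * (w x * (if (l < 3)%N then co l x else 0)))).
Proof.
move=> x0; have r0 := rsq_gt0 x0; 
have sr0 : Num.sqrt (rsq x) != 0 by rewrite gt_eqF // sqrtr_gt0.
have Hs := has_D_comp (is_derive1_sqrt r0) (has_D_rsq l x).
apply: has_D_eq (has_DV sr0 Hs) _.
(* Writing [rsq x] as the square of its root leaves an identity that is rational in the root. *)
have := sqr_sqrtr (ltW r0); rewrite /inv_radius /w; move: (Num.sqrt (rsq x)) sr0.
by move=> q q0 <-; field.
Qed.

End Metric.

(** * Isometries act linearly on the sphere factor *)

Section SphereCoordinates.
Context {R : realType}.
Implicit Types (x : 'rV[R]_4) (i j k l m : nat).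

Local Notation co := (@coordinate R 3).
Local Notation F := sphere_gradient.
Local Notation D := coordinate_derivative.

Lemma inv_radius_sqr x : off_axis x -> inv_radius x ^+ 2 = (rsq x)^-1.
Proof. by move=> x0; rewrite /inv_radius exprVn sqr_sqrtr // ltW // rsq_gt0. Qed.

Lemma has_D_inv_rsq (l : 'I_4) x : off_axis x -> has_D l (fun y => (rsq y)^-1) x
  (- (rsq x)^-1 ^+ 2 * (2 * (if (l < 3)%N then co l x else 0))).
Proof. by move=> x0; apply: has_DV => //; exact: has_D_rsq. Qed.

Lemma has_D_co (l : 'I_4) k x : (k < 4)%N -> has_D l (co k) x (val l == k)%:R.
Proof. by move=> k4; apply: has_D_coordinate; rewrite -ltnS. Qed.

Lemma has_D_sphere_coordinate (l : 'I_4) k x : off_axis x -> (k < 3)%N ->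
  has_D l (sphere_coordinate k) x (F k x l 0).
Proof.
move=> x0 k3.
apply: has_D_eq (has_DM (has_D_inv_radius l x0) (has_D_co l x (ltnW k3))) _.
rewrite mxE; case: l => [[|[|[|[|//]]]] Hl] /=; try ring.
by case: k k3 => [|[|[|//]]] _ /=; ring.
Qed.

Lemma sphere_hessian k x : off_axis x -> (k < 3)%N ->
  differentiable (F k) x /\
  forall a : 'I_4, D a (F k) x - soliton_connection a x *m F k x =
    - sphere_coordinate k x *: col a (sphere_mx x).
Proof.
move=> x0 k3.
have H (a : 'I_4) := has_D_mx (fun (j : 'I_4) (_ : 'I_1) =>
  has_D_if (j < 3)%N (has_DM (has_D_inv_radius a x0)
   (has_DB (has_D_cst a ((j == k :> nat)%:R : R) x)
     (has_DM (has_D_inv_rsq a x0)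
        (has_DM (has_D_co a x (ltn_ord j)) (has_D_co a x (ltnW k3))))))).
split=> [|a]; first by have [] := H ord0.
have [_ ->] := H a.
have x0' : co 0 x ^+ 2 + co 1 x ^+ 2 + co 2 x ^+ 2 != 0 by [].
apply/matrixP => j z; rewrite !mxE !big_ord_recl !big_ord0 !mxE.
by case: k k3 {H} => [|[|[|//]]] _;
  case: a j => [[|[|[|[|//]]]] Ha] [[|[|[|[|//]]]] Hj];
  rewrite /sphere_entry /connection_entry /sphere_coordinate /rsq /= /bump /=; field.
Qed.

(** The functions n_k are the coordinates of the isometric embedding of the unit sphere in R^3, so
    the squares of their differentials add up to the induced metric. *)
Lemma sphere_mx_gradients x : off_axis x ->
  \sum_(k < 3) F k x *m (F k x)^T = sphere_mx x.
Proof.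
move=> x0; have x0' : co 0 x ^+ 2 + co 1 x ^+ 2 + co 2 x ^+ 2 != 0 by [].
have s2 := inv_radius_sqr x0.
apply/matrixP => i j; rewrite summxE.
under eq_bigr do rewrite mxE big_ord_recl big_ord0 addr0 !mxE.
rewrite mxE !big_ord_recl !big_ord0 /= /bump /=.
have E (a b c a' b' c' : R) : inv_radius x * a * (inv_radius x * a') +
   (inv_radius x * b * (inv_radius x * b') +
   (inv_radius x * c * (inv_radius x * c') + 0)) =
   (rsq x)^-1 * (a * a' + b * b' + c * c') by rewrite -s2; ring.
by case: i j => [[|[|[|[|//]]]] Hi] [[|[|[|[|//]]]] Hj];
  rewrite /sphere_entry /= ?E /rsq; field.
Qed.

Lemma sphere_coordinate_sqr x : off_axis x ->
  \sum_(k < 3) sphere_coordinate k x ^+ 2 = 1.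
Proof.
move=> x0; rewrite !big_ord_recl big_ord0 /sphere_coordinate !exprMn inv_radius_sqr //.
have x0' : co 0 x ^+ 2 + co 1 x ^+ 2 + co 2 x ^+ 2 != 0 by [].
by rewrite /rsq /= /bump /=; field.
Qed.

(** A propagation principle along segments avoiding the axis, serving both for functions with zero
    gradient and for connectedness. The segment from [e] works unless the endpoint projects to the
    opposite ray; that ray is reached through the point [f] on the second axis. *)
Lemma off_axis_segments (Q : 'rV[R]_4 -> Prop) (e : 'rV[R]_4) :
  co 0 e = 1 -> co 1 e = 0 -> co 2 e = 0 -> Q e ->
  (forall p q, (forall t, 0 <= t <= 1 -> off_axis (p + t *: (q - p))) -> Q p -> Q q) ->
  forall p, off_axis p -> Q p.
Proof.
move=> e0 e1 e2 Qe Qseg.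
have cseg k t (p q : 'rV[R]_4) : co k (p + t *: (q - p)) = co k p + t * (co k q - co k p).
  by rewrite /coordinate !mxE.
have oE (p : 'rV[R]_4) : co 0 p != 0 \/ co 1 p != 0 \/ co 2 p != 0 -> off_axis p.
  rewrite /off_axis /= /rsq => H.
  rewrite !paddr_eq0 ?addr_ge0 ?sqr_ge0 // !sqrf_eq0.
  by case: H => [|[]] /negbTE ->; rewrite ?andbF.
have dir p : co 0 p > 0 \/ co 1 p != 0 \/ co 2 p != 0 -> Q p.
  move=> H; apply: (Qseg e) => // t /andP[t0 t1]; apply: oE.
  rewrite !cseg e0 e1 e2 !subr0 !add0r.
  have [->|t00] := eqVneq t 0; first by left; rewrite mul0r addr0 oner_eq0.
  case: H => [p0|[p1|p2]]; [left|right; left|right; right]; last 2 first.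
  - exact: mulf_neq0.
  - exact: mulf_neq0.
  have -> : 1 + t * (co 0 p - 1) = (1 - t) + t * co 0 p by ring.
  rewrite gt_eqF // ltr_wpDl ?subr_ge0 // mulr_gt0 //.
  by rewrite lt0r t00.
pose f : 'rV[R]_4 := \row_j (j == 1 :> nat)%:R.
have cf k : (k < 4)%N -> co k f = (k == 1)%:R.
  by move=> k4; rewrite /coordinate mxE inordK.
have Qf : Q f by apply: dir; right; left; rewrite cf // oner_eq0.
move=> p po.
have [/dir//|p0] := pselect (co 0 p > 0 \/ co 1 p != 0 \/ co 2 p != 0).
have p1 : co 1 p = 0 by apply/eqP/negPn/negP => H; apply: p0; right; left.
have p2 : co 2 p = 0 by apply/eqP/negPn/negP => H; apply: p0; right; right.
apply: (Qseg f) => // t _; apply: oE; rewrite !cseg !cf //= p1 p2.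
have [->|t1] := eqVneq t 1; last first.
  by right; left; rewrite sub0r mulrN1 subr_eq0 eq_sym.
left; rewrite subr0 add0r mul1r; apply/negP => /eqP c0; move: po.
by rewrite /off_axis /= /rsq c0 p1 p2 !expr0n /= !addr0 eqxx.
Qed.

Lemma eq_of_zero_gradient (h : 'rV[R]_4 -> R) (x y : 'rV[R]_4) :
  (forall x, off_axis x -> differentiable h x) ->
  (forall (i : 'I_4) x, off_axis x -> D i h x = 0) ->
  off_axis x -> off_axis y -> h x = h y.
Proof.
move=> dh Dh.
pose e : 'rV[R]_4 := \row_j (j == 0 :> nat)%:R.
have ce k : (k < 4)%N -> co k e = (k == 0)%:R.
  by move=> k4; rewrite /coordinate mxE inordK.
suff H p : off_axis p -> h p = h e by move=> /H -> /H ->.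
move: p; apply: (@off_axis_segments _ e); rewrite ?ce // => p q pq <-.
have E : h (p + (q - p)) = h p.
  apply: eq_of_derive_line0 => t /pq Ut; have dht := dh _ Ut; split=> //.
  have dz (j : 'I_4) : 'd h (p + t *: (q - p)) (delta_mx 0 j) = 0.
    by rewrite -(Dh j _ Ut) coordinate_derivativeE (deriveE _ dht).
  rewrite (deriveE _ dht) [X in 'd h _ X]row_sum_delta linear_sum big1 // => j _.
  by rewrite linearZ /= dz; exact: scaler0.
by rewrite -E addrC subrK.
Qed.

(** The contraction of [g] with x is kept as a separate sum because it vanishes for the
    differentials to which this is applied. *)
Lemma connection_apply (i j : 'I_4) x (g : 'cV[R]_4) : (i < 3)%N -> (j < 3)%N ->
  (soliton_connection i x *m g) j 0 =
  (rsq x)^-1 * ((i == j :> nat)%:R * (\sum_(l < 4 | (l < 3)%N) co l x * g l 0)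
                - co i x * g j 0 - co j x * g i 0)
  + 2 * (rsq x)^-1 ^+ 2 * co i x * co j x * \sum_(l < 4 | (l < 3)%N) co l x * g l 0.
Proof.
pose gn k := g (inord k) 0.
have gE (k : 'I_4) : g k 0 = gn k by rewrite /gn inord_val.
rewrite mxE (eq_bigr (fun k : 'I_4 => connection_entry i j k x * gn k)); last first.
  by move=> k _; rewrite mxE gE.
have -> : \sum_(l < 4 | (l < 3)%N) co l x * g l 0 =
    co 0 x * gn 0 + co 1 x * gn 1 + co 2 x * gn 2.
  by rewrite big_mkcond !big_ord_recl big_ord0 !gE /= /bump /=; ring.
rewrite !gE !big_ord_recl !big_ord0 /connection_entry.
move: (rsq x)^-1 => w.
by case: i j => [[|[|[|[|//]]]] Hi] [[|[|[|[|//]]]] Hj] // _ _;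
  rewrite /= /bump /=; ring.
Qed.

Lemma connection_last (i j : 'I_4) x (g : 'cV[R]_4) : (3 <= i)%N || (3 <= j)%N ->
  (soliton_connection i x *m g) j 0 = 0.
Proof.
move=> H; rewrite mxE big1 // => k _; rewrite mxE /connection_entry.
by case/orP: H; rewrite leqNgt => /negbTE ->; rewrite /= ?andbF mul0r.
Qed.

End SphereCoordinates.

(** * An isometry transforms the n_k linearly *)

Section Rigidity.
Context {R : realType} (phi : 'rV[R]_4 -> 'rV[R]_4).
Hypothesis phiU : forall x, off_axis x -> off_axis (phi x).
Hypothesis phi_smooth : Ck 3 off_axis phi.
Hypothesis phi_isometry : forall x, off_axis x ->
  'J phi x *m soliton_mx (phi x) *m ('J phi x)^T = soliton_mx x.
Implicit Types (x : 'rV[R]_4) (k : nat).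

Local Notation co := (@coordinate R 3).
Local Notation F := sphere_gradient.
Local Notation D := coordinate_derivative.
Let J x : 'M[R]_4 := 'J phi x.
Let LC := @soliton_levi_civita R.
Let oU := @off_axis_open R.

Let dphi x : off_axis x -> differentiable phi x.
Proof. exact: Ck_differentiable phi_smooth. Qed.

Let dJ x : off_axis x -> differentiable J x.
Proof. exact: (Ck_differentiable (Ck_jacobian oU phi_smooth)). Qed.

Let sphere_pullback x : off_axis x -> J x *m sphere_mx (phi x) *m (J x)^T = sphere_mx x.
Proof.
move=> x0; rewrite -!ricci_soliton_mx //; last exact: phiU.
exact: (ricci_pullback LC LC phiU phi_smooth phi_isometry x0).
Qed.

Let G k x : 'cV[R]_4 := J x *m F k (phi x).
Let N k x : R := sphere_coordinate k (phi x).

Let dG k x : off_axis x -> (k < 3)%N -> differentiable (G k) x.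
Proof.
move=> x0 k3; apply: differentiable_mulmx; first exact: dJ.
have [dF _] := sphere_hessian (phiU x0) k3.
exact: (differentiable_comp (dphi x0) dF).
Qed.

Let has_D_N (l : 'I_4) k x : off_axis x -> (k < 3)%N -> has_D l (N k) x (G k x l 0).
Proof.
move=> x0 k3; have H (j : 'I_4) := has_D_sphere_coordinate j (phiU x0) k3.
have [d0 _] := H ord0.
split; first exact: (differentiable_comp (dphi x0) d0).
apply: etrans (D_comp l (dphi x0) d0) _; rewrite [RHS]mxE.
by apply: eq_bigr => j _; have [_ ->] := H j.
Qed.

Let DG (i : 'I_4) k x : off_axis x -> (k < 3)%N ->
  D i (G k) x = soliton_connection i x *m G k x - N k x *: col i (sphere_mx x).
Proof.
move=> x0 k3; have [dF hF] := sphere_hessian (phiU x0) k3.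
have := hessian_pullback LC LC phiU phi_smooth phi_isometry i x0 dF hF.
move=> /(canRL (subrK _)) ->; rewrite addrC; congr (_ + _).
rewrite -(sphere_pullback x0) colE -mulmxA -colE -mulmxA scalemxAr -mulmxN.
congr (_ *m _); apply/matrixP => b z; rewrite summxE !mxE mulr_sumr -sumrN.
apply: eq_bigr => a _; rewrite !mxE.
have mE (M : 'M[R]_4) u v : M u v = M u v by [].
by rewrite -/(N k x); ring.
Qed.

Let sum_GG x : off_axis x -> \sum_(k < 3) G k x *m (G k x)^T = sphere_mx x.
Proof.
move=> x0; rewrite -(sphere_pullback x0) -(sphere_mx_gradients (phiU x0)).
rewrite mulmx_sumr mulmx_suml; apply: eq_bigr => k _.
by rewrite /G trmx_mul !mulmxA.
Qed.

(* The gradients are annihilated by the kernel of the sphere metric, which is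
   spanned by [d/dv] and the radial field. *)
Let G_orthogonal (y : 'rV[R]_4) k x : off_axis x -> (k < 3)%N ->
  y *m sphere_mx x *m y^T = 0 -> (y *m G k x) 0 0 = 0.
Proof.
move=> x0 k3; rewrite -sum_GG // mulmx_sumr mulmx_suml => /matrixP/(_ 0 0).
rewrite summxE [RHS]mxE => H.
have E (l : 'I_3) : (y *m (G l x *m (G l x)^T) *m y^T) 0 0 = (y *m G l x) 0 0 ^+ 2.
  have -> : y *m (G l x *m (G l x)^T) *m y^T = (y *m G l x) *m (y *m G l x)^T.
    by rewrite (trmx_mul y (G l x)) !mulmxA.
  rewrite [LHS]mxE big_ord1 expr2; congr (_ * _).
  by rewrite [LHS]mxE.
have : \sum_(l < 3) (y *m G l x) 0 0 ^+ 2 = 0.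
  by rewrite -[RHS]H; apply: eq_bigr => l _; rewrite E.
move=> /eqP; rewrite psumr_eq0; last by move=> l _; exact: sqr_ge0.
move=> /allP/(_ (Ordinal k3)); rewrite mem_index_enum => /(_ isT).
by rewrite sqrf_eq0 => /eqP.
Qed.

Let G_last k x : off_axis x -> (k < 3)%N -> G k x ord_max 0 = 0.
Proof.
move=> x0 k3; transitivity (((delta_mx 0 ord_max : 'rV[R]_4) *m G k x) 0 0).
  by rewrite -rowE [RHS]mxE.
apply: G_orthogonal => //; rewrite -rowE.
apply/matrixP => a b; rewrite !mxE big1 // => j _.
by rewrite !mxE /sphere_entry ltnn mul0r.
Qed.

Let G_radial k x : off_axis x -> (k < 3)%N ->
  \sum_(l < 4 | (l < 3)%N) co l x * G k x l 0 = 0.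
Proof.
move=> x0 k3.
pose y : 'rV[R]_4 := \row_l (if (l < 3)%N then co l x else 0).
have yE : (y *m G k x) 0 0 = \sum_(l < 4 | (l < 3)%N) co l x * G k x l 0.
  rewrite [LHS]mxE [RHS]big_mkcond; apply: eq_bigr => l _; rewrite [y _ _]mxE.
  by case: ifP => _ //; rewrite mul0r.
rewrite -yE; apply: G_orthogonal => //.
have x0' : co 0 x ^+ 2 + co 1 x ^+ 2 + co 2 x ^+ 2 != 0 by [].
have y0 : y *m sphere_mx x = 0.
  apply/matrixP => a b; rewrite !mxE !big_ord_recl big_ord0 !mxE.
  by case: b => [[|[|[|[|//]]]] Hb]; rewrite /sphere_entry /rsq /= /bump /=; field.
by rewrite y0 mul0mx.
Qed.

(** If [N k] is the sum of c_j n_j, then r d_j N = c_j - n_j N with r = [rsq x * inv_radius x]. So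
    this expression is the only candidate for the coefficient c_j, and the Hessian equation makes it
    constant. *)
Let H k (j : 'I_4) x : R :=
  inv_radius x * co j x * N k x + rsq x * inv_radius x * G k x j 0.

Let H_const (i j : 'I_4) k x : off_axis x -> (k < 3)%N -> (j < 3)%N ->
  has_D i (H k j) x 0.
Proof.
move=> x0 k3 j3.
have HG : has_D i (fun y => G k y j 0) x
    ((soliton_connection i x *m G k x) j 0 - N k x * sphere_entry j i x).
  split; first exact: (differentiable_entry _ _ (dG x0 k3)).
  have mB (M1 M2 : 'cV[R]_4) : (M1 - M2) j 0 = M1 j 0 - M2 j 0 by rewrite !mxE.
  by rewrite (D_entry i j 0 (dG x0 k3)) DG // mB; congr (_ - _); rewrite !mxE.
have Hs := has_D_inv_radius i x0; have Hr := has_D_rsq i x.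
have Hc := has_D_co i x (ltn_ord j); have HN := has_D_N i x0 k3.
apply: has_D_eq (has_DD (has_DM (has_DM Hs Hc) HN) (has_DM (has_DM Hr Hs) HG)) _.
have x0' : co 0 x ^+ 2 + co 1 x ^+ 2 + co 2 x ^+ 2 != 0 by [].
have [i3|i3] := ltnP i 3; last first.
  have -> : i = ord_max by apply/val_inj/eqP; rewrite /= eqn_leq i3 -ltnS ltn_ord.
  rewrite connection_last // G_last //= /sphere_entry ltnn andbF.
  by case: (j) j3 => [[|[|[|[|//]]]] Hj] // _ /=; ring.
rewrite connection_apply // G_radial // /sphere_entry i3 j3 /=.
rewrite [(j == i :> nat)]eq_sym.
have rw : (rsq x)^-1 * rsq x = 1 by rewrite mulVf.
have r0 : rsq x != 0 by [].
by field.
Qed.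

Lemma sphere_isometry_linear : exists C : 'M[R]_3, forall x, off_axis x ->
  \row_(k < 3) sphere_coordinate k (phi x) = (\row_(k < 3) sphere_coordinate k x) *m C.
Proof.
pose e : 'rV[R]_4 := \row_j (j == 0 :> nat)%:R.
have e0 : off_axis e.
  by rewrite /off_axis /= /rsq /coordinate !mxE !inordK //= !expr0n /= !addr0 expr1n oner_eq0.
exists (\matrix_(j, k) H k (widen_ord (leqnSn 3) j) e) => x x0.
apply/rowP => k; rewrite !mxE.
have Hx (j : 'I_3) : H k (widen_ord (leqnSn 3) j) e = H k (widen_ord (leqnSn 3) j) x.
  apply: eq_of_zero_gradient => // [y y0|i y y0].
    by have [] := @H_const ord0 (widen_ord (leqnSn 3) j) k y y0 (ltn_ord k) (ltn_ord j).
  by have [] := @H_const i (widen_ord (leqnSn 3) j) k y y0 (ltn_ord k) (ltn_ord j).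
(* Contracting [H] with the n_j gives back [N k], because the n_j have squares of sum 1 and the
   radial derivative of [N k] vanishes. *)
transitivity (\sum_(j < 3) sphere_coordinate j x * H k (widen_ord (leqnSn 3) j) x);
  last by apply: eq_bigr => j _; rewrite !mxE Hx.
have Gr := G_radial x0 (ltn_ord k); rewrite big_mkcond big_ord_recr /= addr0 in Gr.
have x0' : rsq x != 0 by [].
have s2 := inv_radius_sqr x0.
have E (j : 'I_3) : sphere_coordinate j x * H k (widen_ord (leqnSn 3) j) x =
    (rsq x)^-1 * N k x * co j x ^+ 2 + co j x * G k x (widen_ord (leqnSn 3) j) 0.
  rewrite /H /sphere_coordinate /= -[G _ _ _ _ in RHS]mul1r -(mulVf x0') -s2; ring.
under eq_bigr do rewrite E.
rewrite big_split /= -mulr_sumr.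
rewrite [X in _ = _ + X](_ : _ = 0); last first.
  by rewrite -[RHS]Gr; apply: eq_bigr => j _; rewrite /= ltn_ord.
rewrite addr0 !big_ord_recl big_ord0 /= /bump /= addr0 addrA -/(rsq x).
by rewrite mulrAC mulVf // mul1r.
Qed.

End Rigidity.

(** * Solvable groups are not transitive on the sphere *)

Section DerivedSeries.
Context (S : groupType).

(** A derived term is an intersection of subgroups [B]. The elements conjugated into [B] form a
    subgroup [B'], which contains the same commutators because the previous term is normal. *)
Lemma derived_series_conj k (a c : S) :
  derived_series k a -> derived_series k (a ^ c)%g.
Proof.
elim: k a c => [|k IH] a c //= Da B [sB gB].
pose B' : set S := [set x | B (x ^ c)%g].
apply: (Da B'); split.
  split; first by rewrite /B' /= conj1g; have [] := sB.
  by move=> x y Bx By; rewrite /B' /= conjMg conjVg; apply: (proj2 sB).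
move=> _ [u Du [v Dv <-]]; rewrite /B' /= conjRg.
by apply: gB; exists (u ^ c)%g; [exact: IH|exists (v ^ c)%g => //; exact: IH].
Qed.

Lemma derived_series_commg k (a b : S) :
  derived_series k a -> derived_series k b -> derived_series k.+1 [~ a, b]%g.
Proof. by move=> Da Db B [_]; apply; exists a => //; exists b. Qed.

End DerivedSeries.

Section OrthogonalAction.
Context {R : realType} (S : groupType) (C : S -> 'M[R]_3).
Hypothesis CM : forall a b, C (a * b)%g = C b *m C a.
Hypothesis C_orthogonal : forall a, C a *m (C a)^T = 1%:M.
Hypothesis C_transitive : forall y z : 'rV[R]_3,
  y *m y^T = 1%:M -> z *m z^T = 1%:M -> exists a, y *m C a = z.

Let C_unit a : C a \in unitmx.
Proof. by have [] := mulmx1_unit (C_orthogonal a). Qed.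

Let C1 : C 1%g = 1%:M.
Proof.
have := CM 1%g 1%g; rewrite mulg1 => E.
by apply: (can_inj (mulmxK (C_unit 1%g))); rewrite -E mul1mx.
Qed.

(** In odd dimension the determinant e, which is 1 or -1, is an eigenvalue: M - e equals -e M times
    the transpose of M - e, and on determinants in dimension 3 the factor is (-e)^3 e = -1. *)
Lemma det_orthogonal_sub_det (M : 'M[R]_3) : M *m M^T = 1%:M ->
  \det (M - (\det M)%:M) = 0.
Proof.
move=> MM; have d2 : \det M * \det M = 1.
  by rewrite -[X in _ * X]det_tr -det_mulmx MM det1.
move: d2; set e := \det M => d2.
have E : M - e%:M = - e *: (M *m (M - e%:M)^T).
  rewrite linearB /= tr_scalar_mx mulmxBr MM mul_mx_scalar scalerBr scalerA mulNr d2.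
  by rewrite !scaleNr scale1r opprK scalemx1 addrC.
have := congr1 determinant E.
rewrite detZ det_mulmx det_tr -/e => D.
have e4 : (- e) ^+ 3 * (e * \det (M - e%:M)) = - \det (M - e%:M).
  have -> : (- e) ^+ 3 * (e * \det (M - e%:M)) = - (e * e) * (e * e) * \det (M - e%:M) by ring.
  by rewrite d2 mulr1 mulN1r.
move: D; rewrite e4 => /eqP; rewrite -addr_eq0 -mulr2n mulrn_eq0 => /eqP.
by [].
Qed.

(* A proper invariant subspace of dimension 1, or the orthogonal complement of
   one of dimension 2. *)
Lemma commuting_eigenvector (M : 'M[R]_3) : M *m M^T = 1%:M ->
  (forall c, M != c%:M) ->
  exists2 w : 'rV[R]_3, w != 0 & forall B : 'M[R]_3, B *m B^T = 1%:M ->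
    B *m M = M *m B -> exists c, w *m B = c *: w.
Proof.
move=> MM Mns; pose e := \det M; pose K := kermx (M - e%:M).
have MM' : M^T *m M = 1%:M by rewrite mulmx1C.
have stable (B : 'M[R]_3) : B *m M = M *m B -> (K *m B <= K)%MS.
  move=> BM; rewrite sub_kermx -mulmxA.
  have -> : B *m (M - e%:M) = (M - e%:M) *m B.
    by rewrite mulmxBr mulmxBl BM mul_scalar_mx mul_mx_scalar.
  by rewrite mulmxA mulmx_ker mul0mx.
have rK0 : (0 < \rank K)%N.
  rewrite mxrank_ker subn_gt0 ltnNge row_leq_rank.
  by rewrite row_free_unit unitmxE det_orthogonal_sub_det // unitr0.
have rK3 : (\rank K < 3)%N.
  rewrite mxrank_ker ltn_subrL /= andbT lt0n mxrank_eq0 subr_eq0.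
  exact: Mns.
have [L rL Lst] : exists2 L : 'M[R]_3, \rank L = 1 & forall B : 'M[R]_3,
    B *m B^T = 1%:M -> B *m M = M *m B -> (L *m B <= L)%MS.
  have [rK1|rK1] := eqVneq (\rank K) 1%N; first by exists K => // B _; exact: stable.
  have rK2 : \rank K = 2%N by apply/eqP; rewrite eqn_leq -ltnS rK3 ltn_neqAle eq_sym rK1 rK0.
  exists (kermx K^T); first by rewrite mxrank_ker mxrank_tr rK2.
  move=> B BB BM; rewrite sub_kermx -mulmxA.
  have BB' : B^T *m B = 1%:M by rewrite mulmx1C.
  (* The transpose of [B] is its inverse, hence also commutes with [M]. Stability of [K] under the
     transpose is stability of its orthogonal complement under [B]. *)
  have BTM : B^T *m M = M *m B^T.
    by rewrite -[LHS]mulmx1 -BB mulmxA -[B^T *m M *m B]mulmxA -BM mulmxA BB' mul1mx.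
  have /submxP[X KX] := stable _ BTM.
  have -> : B *m K^T = (K *m B^T)^T by rewrite (trmx_mul K) trmxK.
  by rewrite KX (trmx_mul X) mulmxA mulmx_ker mul0mx.
pose w := nz_row L.
have w0 : w != 0 by rewrite nz_row_eq0 -mxrank_eq0 rL.
have wL : (w <= L)%MS := nz_row_sub L.
have Lw : (L <= w)%MS.
  have := mxrank_leqif_sup wL; rewrite rL => -[_ <-].
  by rewrite rank_rV w0.
exists w => // B BB BM; apply/sub_rVP.
by apply: submx_trans (submxMr B wL) (submx_trans (Lst B BB BM) Lw).
Qed.

Lemma commuting_normal_set_scalar (A : set S) :
  (forall a c, A a -> A (a ^ c)%g) ->
  (forall a b, A a -> A b -> C a *m C b = C b *m C a) ->
  forall a, A a -> exists c, C a = c%:M.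
Proof.
move=> nA cA a Aa; apply: contrapT => ns.
have [w0 w00 wE] : exists2 w : 'rV[R]_3, w != 0 &
    forall B : 'M[R]_3, B *m B^T = 1%:M -> B *m C a = C a *m B ->
    exists c, w *m B = c *: w.
  apply: commuting_eigenvector => // c; apply/eqP => E; apply: ns.
  by exists c.
pose q := (w0 *m w0^T) 0 0.
have q0 : 0 < q.
  rewrite /q mxE lt0r; under eq_bigr do rewrite mxE -expr2.
  rewrite sumr_ge0 ?andbT; last by move=> i _; exact: sqr_ge0.
  apply: contra w00; rewrite psumr_eq0; last by move=> i _; exact: sqr_ge0.
  move=> /allP H; apply/eqP/rowP => j; rewrite mxE.
  by have := H j (mem_index_enum _); rewrite sqrf_eq0 => /eqP.
pose w := (Num.sqrt q)^-1 *: w0.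
have wB (B : 'M[R]_3) : B *m B^T = 1%:M -> B *m C a = C a *m B ->
    exists c, w *m B = c *: w.
  move=> BB BC; have [c cE] := wE B BB BC; exists c.
  by rewrite -scalemxAl cE !scalerA mulrC.
have ww : w *m w^T = 1%:M.
  rewrite /w linearZ /= -scalemxAl -scalemxAr scalerA [w0 *m w0^T]mx11_scalar -/q.
  rewrite scale_scalar_mx -{3}[q]sqr_sqrtr; last exact: ltW.
  rewrite expr2 mulrACA mulVf ?mulr1 // gt_eqF // sqrtr_gt0 //.
(* Write [z] as the image of [w] under [C u]. That [C b] fixes the line of [z] then means that
   [C (b ^ u)] fixes the line of [w], and [b ^ u] is still in [A]. *)
have eig (z : 'rV[R]_3) b : A b -> z *m z^T = 1%:M -> exists c, z *m C b = c *: z.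
  move=> Ab zz; have [u <-] := C_transitive ww zz.
  have [c cE] := wB (C (b ^ u)%g) (C_orthogonal _) (cA _ _ (nA b u Ab) Aa).
  exists c; rewrite scalemxAl -cE -!mulmxA -!CM.
  by rewrite conjgE !mulgA mulgV mul1g.
have un (i : 'I_3) : (delta_mx 0 i : 'rV[R]_3) *m (delta_mx 0 i)^T = 1%:M.
  by rewrite trmx_delta mul_delta_mx; apply/matrixP => u v; rewrite !mxE !ord1.
have [cc cE] := choice (fun i => eig _ a Aa (un i)).
have cc0 (i : 'I_3) : i != ord0 -> cc i = cc ord0.
  (* The 3-4-5 triangle gives a unit vector with rational, non-zero entries; being an eigenvector
     too, it forces the two eigenvalues to agree. *)
  move=> i0; pose z : 'rV[R]_3 := 3/5 *: delta_mx 0 ord0 + 4/5 *: delta_mx 0 i.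
  have orth (u v : 'I_3) : u != v ->
      (delta_mx 0 u : 'rV[R]_3) *m (delta_mx 0 v)^T = 0.
    by move=> uv; rewrite trmx_delta mul_delta_mx_0.
  have zz : z *m z^T = 1%:M.
    rewrite /z linearD !linearZ /= mulmxDl !mulmxDr -!scalemxAl -!scalemxAr !un.
    rewrite orth 1?eq_sym // orth // !scaler0 addr0 add0r.
    rewrite !scalerA -scalerDl -[RHS]scale1r; by congr (_ *: _); lra.
  have [c zE] := eig z a Aa zz.
  have : (z *m C a) 0 ord0 = c * z 0 ord0 by rewrite zE mxE.
  have : (z *m C a) 0 i = c * z 0 i by rewrite zE mxE.
  rewrite /z mulmxDl -!scalemxAl !cE !mxE !eqxx /= (negbTE i0) [ord0 == i]eq_sym (negbTE i0) /=.
  lra.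
apply: ns; exists (cc ord0); apply/row_matrixP => i.
rewrite !rowE cE mul_mx_scalar; have [->//|i0] := eqVneq i ord0.
by rewrite cc0.
Qed.

(** By induction every derived term contains an element acting by a non-scalar matrix, while the
    last one is trivial. If all commutators of a term acted by scalars c, determinants in dimension
    3 would give c^3 = 1, so c = 1 over the reals; the term would act by commuting matrices, hence
    by scalars. *)
Lemma no_transitive_solvable : solvable_group S -> False.
Proof.
move=> [n Dn].
have ns k : exists2 a, derived_series k a & ~ exists c, C a = c%:M.
  elim: k => [|k [a Da ans]].
    apply: contrapT => H.
    have un (i : 'I_3) : (delta_mx 0 i : 'rV[R]_3) *m (delta_mx 0 i)^T = 1%:M.
      by rewrite trmx_delta mul_delta_mx; apply/matrixP => u v; rewrite !mxE !ord1.
    have [a aE] := C_transitive (un ord0) (un ord_max).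
    apply: H; exists a => // -[c cE]; move: aE; rewrite cE mul_mx_scalar.
    by move=> /matrixP/(_ 0 ord_max)/eqP; rewrite !mxE /= mulr0 eq_sym oner_eq0.
  apply: contrapT => H; apply: ans.
  apply: (@commuting_normal_set_scalar (derived_series k)) => //.
    exact: derived_series_conj.
  move=> u v Du Dv.
  have [[c cE]|cns] := pselect (exists c, C [~ u, v]%g = c%:M); last first.
    by case: H; exists [~ u, v]%g => //; exact: derived_series_commg.
  have uv : C v *m C u = c *: (C u *m C v).
    by rewrite -CM commgC CM cE CM mul_scalar_mx.
  have c1 : c = 1.
    have := congr1 determinant uv; rewrite detZ !det_mulmx mulrC => D.
    have d0 : \det (C u) * \det (C v) != 0.
      by rewrite mulf_neq0 // -unitfE -unitmxE.
    have c3 : c ^+ 3 = 1.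
      by apply: (mulIf d0); rewrite mul1r.
    have p : c ^+ 2 + c + 1 != 0 by rewrite gt_eqF //; nra.
    apply/eqP; rewrite -subr_eq0; apply/eqP/(mulIf p).
    have -> : (c - 1) * (c ^+ 2 + c + 1) = c ^+ 3 - 1 by ring.
    by rewrite c3 subrr mul0r.
  by rewrite uv c1 scale1r.
have [a] := ns n; rewrite Dn => -> []; exists 1; exact: C1.
Qed.

End OrthogonalAction.

(** * The group and its action *)

Section RowOfSeq.
Context {R : realType} {n : nat}.

Definition row_of (s : seq R) : 'rV[R]_n.+1 := \row_j s`_j.

Lemma coordinate_row_of k s : (k < n.+1)%N -> coordinate k (row_of s) = s`_k.
Proof. by move=> kn; rewrite /coordinate mxE inordK. Qed.

Lemma eq_coordinate (x y : 'rV[R]_n.+1) :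
  (forall k, (k < n.+1)%N -> coordinate k x = coordinate k y) -> x = y.
Proof. by move=> H; apply/rowP => j; rewrite -!coordinate_ord H. Qed.

Lemma Ck_row_of (V : normedModType R) k (U : set V) (s : V -> seq R) : open U ->
  (forall j, (j < n.+1)%N -> Ck k U (fun x => (s x)`_j)) ->
  Ck k U (fun x => row_of (s x)).
Proof.
move=> oU H; apply: Ck_mx => // i j.
by apply: Ck_ext (H j (ltn_ord j)) => // x _; rewrite mxE.
Qed.

Lemma jacobian_row_of m (s : 'rV[R]_m.+1 -> seq R) (d : 'I_m.+1 -> nat -> R) x :
  (forall i j, (j < n.+1)%N -> has_D i (fun y => (s y)`_j) x (d i j)) ->
  'J (fun y => row_of (s y)) x = \matrix_(i, j) d i j.
Proof.
move=> H.
have E (j : 'I_n.+1) : (fun y => row_of (s y) 0 j) = (fun y => (s y)`_j).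
  by apply/funext => y; rewrite mxE.
have df : differentiable (fun y => row_of (s y)) x.
  apply: entries_differentiable => i j; rewrite (ord1 i) E.
  by have [] := H ord0 j (ltn_ord j).
apply/matrixP => i j; apply: etrans (jacobian_D i j df) _.
by rewrite E mxE; have [] := H i j (ltn_ord j).
Qed.

End RowOfSeq.

Section QuaternionGroup.
Context {R : realType}.
Implicit Types (q p r : 'rV[R]_5) (x : 'rV[R]_4).

Local Notation cq := (@coordinate R 4).
Local Notation co := (@coordinate R 3).

Definition qnorm q : R := cq 0 q ^+ 2 + cq 1 q ^+ 2 + cq 2 q ^+ 2 + cq 3 q ^+ 2.

Definition quaternions : set 'rV[R]_5 := [set q | qnorm q != 0].

(* The product of the pairs (q, b) and (q', b') of a quaternion and a real number
   is (q q', b + b' / N(q)^2). *)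
Definition qmul q p : 'rV[R]_5 := row_of
  [:: cq 0 q * cq 0 p - cq 1 q * cq 1 p - cq 2 q * cq 2 p - cq 3 q * cq 3 p;
      cq 0 q * cq 1 p + cq 1 q * cq 0 p + cq 2 q * cq 3 p - cq 3 q * cq 2 p;
      cq 0 q * cq 2 p - cq 1 q * cq 3 p + cq 2 q * cq 0 p + cq 3 q * cq 1 p;
      cq 0 q * cq 3 p + cq 1 q * cq 2 p - cq 2 q * cq 1 p + cq 3 q * cq 0 p;
      cq 4 q + cq 4 p * (qnorm q)^-1 ^+ 2].

Definition qone : 'rV[R]_5 := row_of [:: 1; 0; 0; 0; 0].

Definition qinv q : 'rV[R]_5 := row_of
  [:: cq 0 q * (qnorm q)^-1; - cq 1 q * (qnorm q)^-1;
      - cq 2 q * (qnorm q)^-1; - cq 3 q * (qnorm q)^-1;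
      - cq 4 q * qnorm q ^+ 2].

Lemma qnorm_mul q p : qnorm (qmul q p) = qnorm q * qnorm p.
Proof. by rewrite {1}/qnorm !coordinate_row_of //= /qnorm; ring. Qed.

Lemma qnorm_one : qnorm qone = 1.
Proof. by rewrite /qnorm !coordinate_row_of //=; ring. Qed.

Lemma qnorm_inv q : quaternions q -> qnorm (qinv q) = (qnorm q)^-1.
Proof.
move=> q0; have q0' : cq 0 q ^+ 2 + cq 1 q ^+ 2 + cq 2 q ^+ 2 + cq 3 q ^+ 2 != 0 by [].
by rewrite {1}/qnorm !coordinate_row_of //= /qnorm; field.
Qed.

Lemma quaternions_mul q p : quaternions q -> quaternions p -> quaternions (qmul q p).
Proof. by move=> q0 p0; rewrite /quaternions /= qnorm_mul mulf_neq0. Qed.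

Lemma quaternions_one : quaternions qone.
Proof. by rewrite /quaternions /= qnorm_one oner_eq0. Qed.

Lemma quaternions_inv q : quaternions q -> quaternions (qinv q).
Proof. by move=> q0; rewrite /quaternions /= qnorm_inv // invr_eq0. Qed.

Lemma qmulA q p r : qmul q (qmul p r) = qmul (qmul q p) r.
Proof.
apply: eq_coordinate => -[|[|[|[|[|//]]]]] _;
  rewrite coordinate_row_of // [RHS]coordinate_row_of //= ?qnorm_mul !coordinate_row_of //=;
  rewrite ?invfM; ring.
Qed.

Lemma qmul1 q : qmul q qone = q.
Proof.
by apply: eq_coordinate => -[|[|[|[|[|//]]]]] _;
  rewrite !coordinate_row_of //=; ring.
Qed.

Lemma q1mul q : qmul qone q = q.
Proof.
by apply: eq_coordinate => -[|[|[|[|[|//]]]]] _;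
  rewrite !coordinate_row_of //= ?qnorm_one ?invr1; ring.
Qed.

Lemma qmulV q : quaternions q -> qmul q (qinv q) = qone.
Proof.
move=> q0; have q0' : cq 0 q ^+ 2 + cq 1 q ^+ 2 + cq 2 q ^+ 2 + cq 3 q ^+ 2 != 0 by [].
by apply: eq_coordinate => -[|[|[|[|[|//]]]]] _;
  rewrite !coordinate_row_of //= /qnorm; field.
Qed.

Lemma qVmul q : quaternions q -> qmul (qinv q) q = qone.
Proof.
move=> q0; have q0' : cq 0 q ^+ 2 + cq 1 q ^+ 2 + cq 2 q ^+ 2 + cq 3 q ^+ 2 != 0 by [].
by apply: eq_coordinate => -[|[|[|[|[|//]]]]] _;
  rewrite !coordinate_row_of //= ?qnorm_inv // /qnorm; field.
Qed.

(* The matrix of x |-> q x q^* on imaginary quaternions *)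
Definition rotation q (i j : nat) : R :=
  let a := cq 0 q in let b := cq 1 q in let c := cq 2 q in let d := cq 3 q in
  (nth [::]
    [:: [:: a ^+ 2 + b ^+ 2 - c ^+ 2 - d ^+ 2; 2 * (b * c - a * d); 2 * (b * d + a * c)];
        [:: 2 * (b * c + a * d); a ^+ 2 - b ^+ 2 + c ^+ 2 - d ^+ 2; 2 * (c * d - a * b)];
        [:: 2 * (b * d - a * c); 2 * (c * d + a * b); a ^+ 2 - b ^+ 2 - c ^+ 2 + d ^+ 2]]
    i)`_j.

Definition rotate q (i : nat) x : R :=
  rotation q i 0 * co 0 x + rotation q i 1 * co 1 x + rotation q i 2 * co 2 x.

(** The rotation part multiplies |x|^2 by N(q)^2, hence du as well; dividing v by N(q)^2 restores du
    dv. Translations in v are what makes the action transitive. *)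
Definition qact q x : 'rV[R]_4 := row_of
  [:: rotate q 0 x; rotate q 1 x; rotate q 2 x; co 3 x * (qnorm q)^-1 ^+ 2 + cq 4 q].

Lemma rsq_qact q x : rsq (qact q x) = qnorm q ^+ 2 * rsq x.
Proof.
by rewrite {1}/rsq !coordinate_row_of //= /rotate /rotation /rsq /qnorm /=; ring.
Qed.

Lemma off_axis_qact q x : quaternions q -> off_axis x -> off_axis (qact q x).
Proof. by move=> q0 x0; rewrite /off_axis /= rsq_qact mulf_neq0 // expf_neq0. Qed.

Lemma qact_mul q p x : qact (qmul q p) x = qact q (qact p x).
Proof.
apply: eq_coordinate => -[|[|[|[|//]]]] _;
  rewrite coordinate_row_of // [RHS]coordinate_row_of //= ?qnorm_mul ?invfM
    ?coordinate_row_of //= /rotate /rotation ?coordinate_row_of //= /rotate /rotation /=; ring.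
Qed.

Lemma qact_one x : qact qone x = x.
Proof.
by apply: eq_coordinate => -[|[|[|[|//]]]] _;
  rewrite !coordinate_row_of //= /rotate /rotation ?qnorm_one ?coordinate_row_of //= ?invr1; ring.
Qed.

Lemma qnorm_ge0 q : 0 <= qnorm q.
Proof. by rewrite !addr_ge0 // sqr_ge0. Qed.

Definition qbase : 'rV[R]_4 := row_of [:: 1; 0; 0; 0].

Lemma off_axis_qbase : off_axis qbase.
Proof.
by rewrite /off_axis /= /rsq !coordinate_row_of //= expr0n /= !addr0 expr1n oner_neq0.
Qed.

Lemma qact_transitive x : off_axis x -> exists2 q, quaternions q & qact q qbase = x.
Proof.
move=> x0; pose t := Num.sqrt (rsq x).
have t0 : 0 < t by rewrite sqrtr_gt0 rsq_gt0.
have t2 : t ^+ 2 = co 0 x ^+ 2 + co 1 x ^+ 2 + co 2 x ^+ 2.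
  by rewrite sqr_sqrtr // ltW // rsq_gt0.
have act0 (a b c d e : R) : let q := row_of [:: a; b; c; d; e] in
    qact q qbase = row_of [:: a ^+ 2 + b ^+ 2 - c ^+ 2 - d ^+ 2;
       2 * (b * c + a * d); 2 * (b * d - a * c); e].
  apply: eq_coordinate => -[|[|[|[|//]]]] _;
  rewrite !coordinate_row_of //= /rotate /rotation ?coordinate_row_of //=; ring.
have [tx|tx] := ltP 0 (t + co 0 x).
  (* Half-angle formula: a quaternion of norm t, with no component along the first axis and squared
     real part (t + x_0) / 2, takes the first basis vector to x. *)
  pose a := Num.sqrt ((t + co 0 x) / 2).
  have a0 : 0 < a by rewrite sqrtr_gt0 divr_gt0.
  have a2 : a ^+ 2 = (t + co 0 x) / 2 by rewrite sqr_sqrtr // ltW // divr_gt0.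
  have an0 : a != 0 by rewrite gt_eqF.
  have cd : (co 2 x ^+ 2 + co 1 x ^+ 2) / (4 * a ^+ 2) = (t - co 0 x) / 2.
    have tx0 : t + co 0 x != 0 by rewrite gt_eqF.
    have -> : co 2 x ^+ 2 + co 1 x ^+ 2 = (t - co 0 x) * (t + co 0 x).
      by rewrite -subr_sqr t2; ring.
    by rewrite a2; field.
  exists (row_of [:: a; 0; - co 2 x / (2 * a); co 1 x / (2 * a); co 3 x]).
    rewrite /quaternions /= gt_eqF // /qnorm !coordinate_row_of //=.
    by rewrite ltr_pwDl // ?sqr_ge0 // ltr_pwDl // ?sqr_ge0 // expr0n addr0 exprn_gt0.
  rewrite act0; apply: eq_coordinate => -[|[|[|[|//]]]] _;
    rewrite coordinate_row_of //=; try by field.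
  have -> : a ^+ 2 + 0 ^+ 2 - (- co 2 x / (2 * a)) ^+ 2 - (co 1 x / (2 * a)) ^+ 2 =
      a ^+ 2 - (co 2 x ^+ 2 + co 1 x ^+ 2) / (4 * a ^+ 2) by field.
  by rewrite cd a2; field.
have x12 : co 1 x ^+ 2 + co 2 x ^+ 2 = 0.
  apply/eqP; rewrite eq_le addr_ge0 ?sqr_ge0 // andbT.
  have -> : co 1 x ^+ 2 + co 2 x ^+ 2 = (t - co 0 x) * (t + co 0 x).
    by rewrite -subr_sqr t2; ring.
  by rewrite mulr_ge0_le0 //; lra.
move/eqP: (x12); rewrite paddr_eq0 ?sqr_ge0 // !sqrf_eq0 => /andP[/eqP x1 /eqP x2].
have x00 : co 0 x = - t.
  apply/eqP; rewrite -addr_eq0 addrC; apply/eqP.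
  have : (t - co 0 x) * (t + co 0 x) = 0.
    by rewrite -subr_sqr t2 x1 x2; ring.
  move=> /eqP; rewrite mulf_eq0 => /orP[|/eqP//].
  by rewrite gt_eqF //; lra.
(* Here x is on the negative first axis, and j conjugates i to -i; the root of t provides the
   scale. *)
exists (row_of [:: 0; 0; Num.sqrt t; 0; co 3 x]).
  rewrite /quaternions /= /qnorm !coordinate_row_of //= sqr_sqrtr ?ltW //.
  by rewrite !expr0n /= !add0r addr0 gt_eqF.
rewrite act0; apply: eq_coordinate => -[|[|[|[|//]]]] _;
  rewrite coordinate_row_of //= ?x00 ?x1 ?x2; try ring.
by rewrite sqr_sqrtr ?ltW //; ring.
Qed.

(** Preserving [rsq] forces norm 1; compared with a^2 + b^2 - c^2 - d^2 = 1 this kills c and d. *)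
Lemma qact_base_fixed q : quaternions q ->
  qact q qbase = qbase <->
  [/\ cq 0 q ^+ 2 + cq 1 q ^+ 2 = 1, cq 2 q = 0, cq 3 q = 0 & cq 4 q = 0].
Proof.
move=> q0; split.
  move=> E; have c k : co k (qact q qbase) = co k qbase by rewrite E.
  have N2 : qnorm q ^+ 2 = 1.
    have := rsq_qact q qbase; rewrite E.
    have -> : rsq qbase = 1 by rewrite /rsq !coordinate_row_of //=; ring.
    by rewrite mulr1.
  have N1 : qnorm q = 1.
    by apply/eqP; rewrite -(@pexpr_eq1 _ _ 2) ?qnorm_ge0 // N2.
  have := c 0%N; rewrite !coordinate_row_of //= /rotate /rotation /= ?coordinate_row_of //= => c0.
  have := c 3%N; rewrite !coordinate_row_of //= mul0r add0r => c3.
  have s : cq 2 q ^+ 2 + cq 3 q ^+ 2 = 0 by move: N1; rewrite /qnorm; lra.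
  move/eqP: (s); rewrite paddr_eq0 ?sqr_ge0 // !sqrf_eq0 => /andP[/eqP x1 /eqP x2].
  by split=> //; move: N1; rewrite /qnorm x1 x2; lra.
move=> [n1 q2 q3 q4].
have N : qnorm q = 1 by rewrite /qnorm n1 q2 q3; ring.
apply: eq_coordinate => -[|[|[|[|//]]]] _;
  rewrite !coordinate_row_of //= /rotate /rotation /= ?coordinate_row_of //= ?N ?q2 ?q3 ?q4; try ring.
by move: n1 => /(canRL (addrK _)) ->; ring.
Qed.

(** Fixing the first axis leaves the circle a + b i, which turns the other two coordinates by twice
    its angle; fixing the second axis as well leaves only a = 1 or a = -1. *)
Lemma qact_trivial q : quaternions q -> (forall x, off_axis x -> qact q x = x) ->
  [/\ cq 0 q ^+ 2 = 1, cq 1 q = 0, cq 2 q = 0, cq 3 q = 0 & cq 4 q = 0].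
Proof.
move=> q0 H.
have [n1 q2 q3 q4] := (qact_base_fixed q0).1 (H _ off_axis_qbase).
pose y : 'rV[R]_4 := row_of [:: 0; 1; 0; 0].
have y0 : off_axis y.
  by rewrite /off_axis /= /rsq !coordinate_row_of //= expr0n /= !addr0 add0r expr1n oner_neq0.
have /(congr1 (co 1)) := H y y0.
rewrite !coordinate_row_of //= /rotate /rotation /= ?coordinate_row_of //= q2 q3 => c1.
have : cq 1 q ^+ 2 = 0 by lra.
by move/eqP; rewrite sqrf_eq0 => /eqP q1; split=> //; move: n1; rewrite q1; lra.
Qed.

End QuaternionGroup.

(** Inverses are left to [leaf], which is tried first, since they require a non-vanishing
    argument. *)
Ltac Ck_rational leaf :=
  first [ solve [leaf] |
  lazymatch goal with
  | |- Ck _ _ (fun x => @?f x + @?g x) => apply: CkD; [by []|Ck_rational leaf|Ck_rational leaf]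
  | |- Ck _ _ (fun x => - @?f x) => apply: CkN; [by []|Ck_rational leaf]
  | |- Ck _ _ (fun x => @?f x * @?g x) => apply: CkM; [by []|Ck_rational leaf|Ck_rational leaf]
  | |- Ck _ _ (fun x => @?f x ^+ ?m) => apply: CkX; [by []|Ck_rational leaf]
  | |- Ck ?k ?U (fun _ => ?c) => exact: (Ck_cst k U c)
  end ].

Section QuaternionSmooth.
Context {R : realType}.
Local Notation cq := (@coordinate R 4).
Local Notation co := (@coordinate R 3).

Lemma Ck_coordinate_comp (V : normedModType R) n k (U : set V) (f : V -> 'rV[R]_n.+1) m :
  open U -> Ck k U f -> Ck k U (fun x => coordinate m (f x)).
Proof. by move=> oU cf; exact: Ck_entry. Qed.

Section Composed.
Context (V : normedModType R) (U : set V) (f g : V -> 'rV[R]_5) (h : V -> 'rV[R]_4) (k : nat).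
Hypotheses (oU : open U) (cf : Ck k U f) (cg : Ck k U g) (ch : Ck k U h).
Hypothesis fU : forall x, U x -> quaternions (f x).

Let cfc m : Ck k U (fun x => cq m (f x)). Proof. exact: Ck_coordinate_comp. Qed.
Let cgc m : Ck k U (fun x => cq m (g x)). Proof. exact: Ck_coordinate_comp. Qed.
Let chc m : Ck k U (fun x => co m (h x)). Proof. exact: Ck_coordinate_comp. Qed.

Let cN : Ck k U (fun x => qnorm (f x)).
Proof. rewrite /qnorm; Ck_rational ltac:(exact: cfc). Qed.

Let cV : Ck k U (fun x => (qnorm (f x))^-1).
Proof. by apply: CkV => // x /fU. Qed.

Lemma Ck_qmul : Ck k U (fun x => qmul (f x) (g x)).
Proof.
apply: Ck_row_of => // -[|[|[|[|[|//]]]]] _ /=;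
  Ck_rational ltac:(first [exact: cfc|exact: cgc|exact: cV]).
Qed.

Lemma Ck_qinv : Ck k U (fun x => qinv (f x)).
Proof.
apply: Ck_row_of => // -[|[|[|[|[|//]]]]] _ /=;
  Ck_rational ltac:(first [exact: cfc|exact: cV|exact: cN]).
Qed.

Lemma Ck_qact : Ck k U (fun x => qact (f x) (h x)).
Proof.
apply: Ck_row_of => // -[|[|[|[|//]]]] _ /=; rewrite ?/rotate /rotation /=;
  Ck_rational ltac:(first [exact: cfc|exact: chc|exact: cV]).
Qed.

End Composed.

Lemma quaternions_open : open (@quaternions R).
Proof.
have c : continuous (@qnorm R).
  move=> x; suff : Ck 0 setT (@qnorm R) by apply.
  have oT : open [set: 'rV[R]_5] := openT.
  rewrite /qnorm; Ck_rational ltac:(exact: (@Ck_coordinate _ _ 0%N)).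
have -> : quaternions = (@qnorm R) @^-1` [set y | y != 0] by [].
by apply: open_comp => [x _|]; [exact: c|exact: open_neq].
Qed.

Lemma pair_open n m (U : set 'rV[R]_n) (W : set 'rV[R]_m) : open U -> open W ->
  open [set z : 'rV[R]_(n + m) | U (lsubmx z) /\ W (rsubmx z)].
Proof.
move=> oU oW; apply: openI.
  by apply: open_comp oU => z _; exact: continuous_lsubmx.
by apply: open_comp oW => z _; exact: continuous_rsubmx.
Qed.

Lemma Ck_lsubmx n m k (U : set 'rV[R]_(n + m)) : open U -> Ck k U (fun z => lsubmx z).
Proof.
move=> oU; apply: Ck_mx => // i j.
by apply: Ck_ext (Ck_entry i (lshift m j) oU (Ck_id k U)) => // z _; rewrite mxE.
Qed.

Lemma Ck_rsubmx n m k (U : set 'rV[R]_(n + m)) : open U -> Ck k U (fun z => rsubmx z).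
Proof.
move=> oU; apply: Ck_mx => // i j.
by apply: Ck_ext (Ck_entry i (rshift n j) oU (Ck_id k U)) => // z _; rewrite mxE.
Qed.

Lemma smooth_qmul : smooth_on
  [set z : 'rV[R]_(5 + 5) | quaternions (lsubmx z) /\ quaternions (rsubmx z)]
  (fun z => qmul (lsubmx z) (rsubmx z)).
Proof.
move=> k; have oU := pair_open quaternions_open quaternions_open.
apply: Ck_qmul => //; last by move=> z [].
  exact: Ck_lsubmx.
exact: Ck_rsubmx.
Qed.

Lemma smooth_qact : smooth_on
  [set z : 'rV[R]_(5 + 4) | quaternions (lsubmx z) /\ off_axis (rsubmx z)]
  (fun z => qact (lsubmx z) (rsubmx z)).
Proof.
move=> k; have oU := pair_open quaternions_open off_axis_open.
apply: Ck_qact => //; last by move=> z [].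
  exact: Ck_lsubmx.
exact: Ck_rsubmx.
Qed.

Lemma smooth_qinv : smooth_on quaternions (@qinv R).
Proof. by move=> k; apply: Ck_qinv => //; [exact: quaternions_open|exact: Ck_id]. Qed.

Lemma smooth_qact_left (q : 'rV[R]_5) : quaternions q -> smooth_on off_axis (qact q).
Proof.
move=> q0 k; apply: (@Ck_qact _ off_axis (fun _ => q) id) => //.
- exact: off_axis_open.
- exact: Ck_cst.
- exact: Ck_id.
Qed.

Lemma smooth_orbit : smooth_on quaternions (fun q : 'rV[R]_5 => qact q qbase).
Proof.
move=> k; apply: (@Ck_qact _ quaternions id (fun _ => qbase)) => //.
- exact: quaternions_open.
- exact: Ck_id.
- exact: Ck_cst.
Qed.

Definition qact_jacobian (q : 'rV[R]_5) (i : 'I_4) (j : nat) : R :=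
  if (j < 3)%N then (if (i < 3)%N then rotation q j i else 0)
  else if (3 <= i)%N then (qnorm q)^-1 ^+ 2 else 0.

Lemma jacobian_qact (q : 'rV[R]_5) x :
  'J (qact q) x = \matrix_(i, j) qact_jacobian q i j.
Proof.
apply: jacobian_row_of => i j j4.
have rD m : has_D i (fun y => rotate q m y) x
    (rotation q m 0 * (val i == 0%N)%:R + rotation q m 1 * (val i == 1%N)%:R
     + rotation q m 2 * (val i == 2%N)%:R).
  apply: has_D_eq.
    apply: has_DD; first apply: has_DD;
      exact: (has_DM (has_D_cst _ _ _) (has_D_coordinate _ _ _)).
  by rewrite !mul0r !add0r.
have lD := has_DD (has_DM (has_D_coordinate i x (leqnn 3))
  (has_D_cst i ((qnorm q)^-1 ^+ 2) x)) (has_D_cst i (cq 4 q) x).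
case: j j4 => [|[|[|[|//]]]] _ /=; first [apply: has_D_eq (rD _) _|apply: has_D_eq lD _];
  by case: (i) => [[|[|[|[|//]]]] Hi]; rewrite /qact_jacobian /=; ring.
Qed.

(** All rests on [orth]: the rotation matrix is N(q) times an orthogonal matrix. [SS] and [MM]
    rewrite the entries at [x] through it so that they match the pulled-back ones. *)
Lemma qact_isometry (q : 'rV[R]_5) x : quaternions q -> off_axis x ->
  'J (qact q) x *m soliton_mx (qact q x) *m ('J (qact q) x)^T = soliton_mx x.
Proof.
move=> q0 x0; rewrite jacobian_qact.
have cy k : (k < 3)%N -> co k (qact q x) = rotate q k x.
  by move=> k3; rewrite coordinate_row_of ?(ltnW k3) //; case: k k3 => [|[|[|//]]].
have rq : rsq (qact q x) = qnorm q ^+ 2 * rsq x := rsq_qact q x.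
pose N := qnorm q; have N0 : N != 0 by [].
have r0 : rsq x != 0 by [].
have orth i j : (i < 3)%N -> (j < 3)%N ->
    rotation q 0 i * rotation q 0 j + rotation q 1 i * rotation q 1 j
      + rotation q 2 i * rotation q 2 j = N ^+ 2 * (i == j)%:R.
  case: i j => [|[|[|//]]] [|[|[|//]]] _ _; rewrite /rotation /N /qnorm /=; ring.
have tr i : (i < 3)%N -> rotation q 0 i * rotate q 0 x + rotation q 1 i * rotate q 1 x
    + rotation q 2 i * rotate q 2 x = N ^+ 2 * co i x.
  move=> i3; rewrite /rotate.
  have -> : rotation q 0 i * (rotation q 0 0 * co 0 x + rotation q 0 1 * co 1 x + rotation q 0 2 * co 2 x) +
    rotation q 1 i * (rotation q 1 0 * co 0 x + rotation q 1 1 * co 1 x + rotation q 1 2 * co 2 x) +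
    rotation q 2 i * (rotation q 2 0 * co 0 x + rotation q 2 1 * co 1 x + rotation q 2 2 * co 2 x) =
    (rotation q 0 i * rotation q 0 0 + rotation q 1 i * rotation q 1 0 + rotation q 2 i * rotation q 2 0) * co 0 x
    + (rotation q 0 i * rotation q 0 1 + rotation q 1 i * rotation q 1 1 + rotation q 2 i * rotation q 2 1) * co 1 x
    + (rotation q 0 i * rotation q 0 2 + rotation q 1 i * rotation q 1 2 + rotation q 2 i * rotation q 2 2) * co 2 x
    by ring.
  by rewrite !orth //; case: i i3 => [|[|[|//]]] _ /=; ring.
have SS i j : sphere_entry i j x = if (i < 3)%N && (j < 3)%N then
    (rotation q 0 i * rotation q 0 j + rotation q 1 i * rotation q 1 j
      + rotation q 2 i * rotation q 2 j) * (rsq (qact q x))^-1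
    - (rotation q 0 i * rotate q 0 x + rotation q 1 i * rotate q 1 x
        + rotation q 2 i * rotate q 2 x)
      * (rotation q 0 j * rotate q 0 x + rotation q 1 j * rotate q 1 x
        + rotation q 2 j * rotate q 2 x) * (rsq (qact q x))^-1 ^+ 2
    else 0.
  rewrite /sphere_entry; case: ifP => // /andP[i3 j3].
  rewrite orth // !tr // rq -/N.
  by field; rewrite r0 N0.
have MM i : (i < 3)%N -> (rotation q 0 i * rotate q 0 x + rotation q 1 i * rotate q 1 x
    + rotation q 2 i * rotate q 2 x) * N^-1 ^+ 2 = co i x.
  by move=> i3; rewrite tr //; field.
apply/matrixP => i j; rewrite [RHS]mxE SS.
rewrite mxE !big_ord_recl big_ord0 !mxE !big_ord_recl !big_ord0 !mxE.
have b0 k : bump 0 k = k.+1 by [].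
case: i j => [[|[|[|[|//]]]] Hi] [[|[|[|[|//]]]] Hj];
  rewrite /minkowski_entry /= -?MM //= /qact_jacobian /sphere_entry /= ?b0 ?cy // -/N; ring.
Qed.

Lemma qact_radial (q : 'rV[R]_5) x :
  radial_field x *m 'J (qact q) x = radial_field (qact q x).
Proof.
rewrite jacobian_qact; apply/rowP => j.
rewrite [RHS]mxE mxE !big_ord_recl big_ord0 !mxE.
by case: j => [[|[|[|[|//]]]] Hj];
  rewrite ?coordinate_row_of //= /qact_jacobian /rotate /= /bump /=; ring.
Qed.

Lemma orbit_submersion (q : 'rV[R]_5) : quaternions q ->
  row_full ('J (fun q : 'rV[R]_5 => qact q qbase) q).
Proof.
move=> q0; have q0' : cq 0 q ^+ 2 + cq 1 q ^+ 2 + cq 2 q ^+ 2 + cq 3 q ^+ 2 != 0 by [].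
pose c k := cq k q.
pose d (i : 'I_5) (j : nat) : R := (nth [::]
  [:: [:: 2 * c 0; 2 * c 3; - (2 * c 2); 0];
      [:: 2 * c 1; 2 * c 2; 2 * c 3; 0];
      [:: - (2 * c 2); 2 * c 1; - (2 * c 0); 0];
      [:: - (2 * c 3); 2 * c 0; 2 * c 1; 0];
      [:: 0; 0; 0; 1]] i)`_j.
have E : (fun q : 'rV[R]_5 => qact q qbase) = (fun q => row_of
   [:: cq 0 q ^+ 2 + cq 1 q ^+ 2 - cq 2 q ^+ 2 - cq 3 q ^+ 2;
       2 * (cq 1 q * cq 2 q + cq 0 q * cq 3 q); 2 * (cq 1 q * cq 3 q - cq 0 q * cq 2 q); cq 4 q]).
  apply/funext => p; apply: eq_coordinate => -[|[|[|[|//]]]] _;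
  rewrite !coordinate_row_of //= /rotate /rotation /= ?coordinate_row_of //=; ring.
have JE : 'J (fun q : 'rV[R]_5 => qact q qbase) q = \matrix_(i, j) d i j.
  rewrite E; apply: jacobian_row_of => i j j4.
  have hc k : (k <= 4)%N -> has_D i (cq k) q (val i == k)%:R := @has_D_coordinate R 4 i k q.
  case: j j4 => [|[|[|[|//]]]] _ /=.
  - apply: has_D_eq (has_DB (has_DB (has_DD (has_DX2 (hc 0%N isT)) (has_DX2 (hc 1%N isT)))
      (has_DX2 (hc 2%N isT))) (has_DX2 (hc 3%N isT))) _.
    by case: (i) => [[|[|[|[|[|//]]]]] Hi]; rewrite /d /c /=; ring.
  - apply: has_D_eq (has_DM (has_D_cst i 2 q) (has_DD (has_DM (hc 1%N isT) (hc 2%N isT))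
      (has_DM (hc 0%N isT) (hc 3%N isT)))) _.
    by case: (i) => [[|[|[|[|[|//]]]]] Hi]; rewrite /d /c /=; ring.
  - apply: has_D_eq (has_DM (has_D_cst i 2 q) (has_DB (has_DM (hc 1%N isT) (hc 3%N isT))
      (has_DM (hc 0%N isT) (hc 2%N isT)))) _.
    by case: (i) => [[|[|[|[|[|//]]]]] Hi]; rewrite /d /c /=; ring.
  - apply: has_D_eq (hc 4%N isT) _.
    by case: (i) => [[|[|[|[|[|//]]]]] Hi]; rewrite /d /c /=; ring.
rewrite JE; apply/row_fullP.
(* The first three columns of the Jacobian are orthogonal with squared norm 4 N(q), so the rescaled
   transpose is a left inverse. *)
exists (\matrix_(i < 4, j < 5) (if (i < 3)%N then d j i / (4 * qnorm q) else d j i)).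
apply/matrixP => i j; rewrite !mxE !big_ord_recl big_ord0 !mxE.
by case: i j => [[|[|[|[|//]]]] Hi] [[|[|[|[|//]]]] Hj];
  rewrite /d /c /qnorm /= /bump /=; field.
Qed.

End QuaternionSmooth.

(** * The homogeneous space *)

Definition quaternion_group (R : realType) : Type := set_type (@quaternions R).

HB.instance Definition _ (R : realType) :=
  Topological.copy (quaternion_group R) (set_type (@quaternions R)).

Section GroupStructure.
Context {R : realType}.
Local Notation G := (quaternion_group R).

Definition qgroup_of (q : 'rV[R]_5) (q0 : quaternions q) : G := exist _ q (mem_set q0).

Definition qgroup_mul (a b : G) : G :=
  qgroup_of (quaternions_mul (set_valU a) (set_valU b)).
Definition qgroup_one : G := qgroup_of quaternions_one.
Definition qgroup_inv (a : G) : G := qgroup_of (quaternions_inv (set_valU a)).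

Lemma qgroup_mulA : associative qgroup_mul.
Proof. by move=> a b c; apply: val_inj; exact: qmulA. Qed.
Lemma qgroup_mul1 : left_id qgroup_one qgroup_mul.
Proof. by move=> a; apply: val_inj; exact: q1mul. Qed.
Lemma qgroup_1mul : right_id qgroup_one qgroup_mul.
Proof. by move=> a; apply: val_inj; exact: qmul1. Qed.
Lemma qgroup_mulV : left_inverse qgroup_one qgroup_inv qgroup_mul.
Proof. by move=> a; apply: val_inj; exact: qVmul (set_valU a). Qed.
Lemma qgroup_Vmul : right_inverse qgroup_one qgroup_inv qgroup_mul.
Proof. by move=> a; apply: val_inj; exact: qmulV (set_valU a). Qed.

End GroupStructure.

HB.instance Definition _ (R : realType) := isGroup.Build (quaternion_group R)
  (@qgroup_mulA R) (@qgroup_mul1 R) (@qgroup_1mul R) (@qgroup_mulV R) (@qgroup_Vmul R).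

Section HomogeneousSpace.
Context {R : realType}.
Local Notation G := (quaternion_group R).
Local Notation M := (set_type (@off_axis R)).
Local Notation cq := (@coordinate R 4).
Local Notation co := (@coordinate R 3).

Definition quaternion_manifold : manifold R 5 G :=
  @open_manifold R 5 quaternions quaternions_open (qgroup_one : G).

Definition soliton_base : M := exist _ qbase (mem_set off_axis_qbase).

Definition soliton_manifold : manifold R 4 M :=
  @open_manifold R 4 off_axis off_axis_open soliton_base.

Local Notation AG := quaternion_manifold.
Local Notation AM := soliton_manifold.

Definition soliton_action (a : G) (x : M) : M :=
  exist _ (qact (\val a) (\val x)) (mem_set (off_axis_qact (set_valU a) (set_valU x))).

Definition isotropy : set G := [set a | soliton_action a soliton_base = soliton_base].

Definition soliton_metric : pseudo_metric AM :=
  open_metric off_axis_open soliton_base smooth_soliton_mx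
    (fun x _ => soliton_mx_sym x) (@soliton_mx_unit R).

Definition soliton_field : vector_field AM :=
  open_field off_axis_open soliton_base smooth_radial_field.

Lemma soliton_action1 x : soliton_action 1%g x = x.
Proof. by apply: val_inj; exact: qact_one. Qed.

Lemma soliton_actionM a b x :
  soliton_action (a * b)%g x = soliton_action a (soliton_action b x).
Proof. by apply: val_inj; exact: qact_mul. Qed.

Lemma quaternion_lie_group : lie_group AG.
Proof.
have oQ := @quaternions_open R; pose e : set_type (@quaternions R) := qgroup_one; split.
  apply: (@smooth2_open R 5 5 5 _ _ _ oQ oQ oQ e e e _ _ _ smooth_qmul) => p q.
  by rewrite row_mxKl row_mxKr.
by apply: (@smooth_open R 5 5 _ _ oQ oQ e e (fun a : G => a^-1)%g (@qinv R) _ smooth_qinv).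
Qed.

Lemma soliton_action_transitive x : exists a, soliton_action a soliton_base = x.
Proof.
have [q q0 qx] := qact_transitive (set_valU x).
by exists (qgroup_of q0); apply: val_inj.
Qed.

Lemma isotropy_subgroup : subgroup isotropy.
Proof.
split=> [|a b Ha Hb]; first exact: soliton_action1.
have E : soliton_action b^-1%g soliton_base = soliton_base.
  by rewrite -[X in soliton_action _ X]Hb -soliton_actionM mulVg soliton_action1.
by rewrite /isotropy /= soliton_actionM E.
Qed.

Lemma orbit_map_submersion : submersion AG AM (fun a => soliton_action a soliton_base).
Proof.
by apply: (@submersion_open R 5 4 _ _ quaternions_open off_axis_open qgroup_one soliton_base
  (fun a : G => soliton_action a soliton_base) (fun q => qact q qbase) _ smooth_orbit) => //;
  exact: orbit_submersion.
Qed.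

Lemma isotropy_closed : closed isotropy.
Proof.
have [[c _] _] := orbit_map_submersion.
have -> : isotropy = (fun a => soliton_action a soliton_base) @^-1` [set soliton_base].
  by [].
apply: (proj1 (continuous_closedP _) c).
exact/accessible_closed_set1/hausdorff_accessible/set_type_hausdorff.
Qed.

Lemma soliton_homogeneous_space :
  homogeneous_space AG AM isotropy soliton_action soliton_base.
Proof.
split.
- by split; [exact: isotropy_subgroup|exact: isotropy_closed].
- by split; [exact: soliton_action1|exact: soliton_actionM].
- apply: (@smooth2_open R 5 4 4 _ _ _ quaternions_open off_axis_open off_axis_open
    qgroup_one soliton_base soliton_base _ _ _ smooth_qact) => p q.
  by rewrite row_mxKl row_mxKr.
- exact: soliton_action_transitive.
- by split; [|exact: orbit_map_submersion].
Qed.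

Lemma soliton_metric_invariant : invariant_metric soliton_action soliton_metric.
Proof.
move=> a; apply: (@pulls_back_open _ _ _ _ _ off_axis_open off_axis_open
  soliton_base soliton_base (soliton_action a) (qact (\val a)) _
  (smooth_qact_left (set_valU a))) => //= x x0.
exact: (qact_isometry (set_valU a) x0).
Qed.

Lemma soliton_field_invariant : invariant_field soliton_action soliton_field.
Proof.
move=> a; apply: (@related_open _ _ _ _ _ off_axis_open off_axis_open
  soliton_base soliton_base (soliton_action a) (qact (\val a)) _
  (smooth_qact_left (set_valU a))) => //= x x0.
exact: qact_radial.
Qed.

Lemma soliton_metric_equation : soliton_equation soliton_metric soliton_field 1.
Proof.
move=> [] x; rewrite /= codom_set_chart => x0.
exact: soliton_equation_mx.
Qed.

(** At the base point the entry pairing the first axis with v gives mu = 0, while the Ricci tensor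
    is 1 on the second axis. *)
Lemma soliton_metric_not_einstein : ~ einstein soliton_metric.
Proof.
move=> [mu H]; have := H tt qbase; rewrite /= codom_set_chart => /(_ off_axis_qbase).
rewrite (ricci_soliton_mx off_axis_qbase) => /matrixP E.
have r1 : rsq (@qbase R) = 1.
  by rewrite /rsq !coordinate_row_of //= expr0n /= !addr0 expr1n.
have := E (inord 0) (inord 3); rewrite !mxE !inordK //= /sphere_entry /minkowski_entry /=.
rewrite coordinate_row_of //= add0r addr0 mulr1 => mu0.
have := E (inord 1) (inord 1); rewrite !mxE !inordK //= /sphere_entry /minkowski_entry /=.
rewrite !coordinate_row_of //= r1 -mu0 mul0r => /eqP.
by rewrite invr1 mulr1 !mul0r subr0 oner_eq0.
Qed.

Lemma soliton_not_compact : ~ compact [set: M].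
Proof.
move=> cM.
pose f (x : M) : R := co 3 (\val x).
have cf : continuous f.
  move=> x; apply: continuous_comp; first exact: set_val_continuous.
  exact: continuous_coordinate.
have /compact_bounded[N [_ HN]] : compact (f @` [set: M]).
  by apply: continuous_compact => //; exact: continuous_subspaceT.
pose y : 'rV[R]_4 := row_of [:: 1; 0; 0; `|N| + 2].
have y0 : off_axis y.
  by rewrite /off_axis /= /rsq !coordinate_row_of //= expr0n /= !addr0 expr1n oner_neq0.
have Nl : N < `|N| + 1 by rewrite (le_lt_trans (ler_norm N)) // ltrDl.
suff e : (f @` [set: M]) (`|N| + 2).
  have : `| `|N| + 2 | <= `|N| + 1 := HN _ Nl _ e.
  by rewrite ger0_norm ?addr_ge0 // => ?; lra.
exists (exist _ y (mem_set y0)) => //.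
by rewrite /f /= coordinate_row_of.
Qed.

(** Membership in the component of the base point is a property that passes along segments, as
    [off_axis_segments] requires. *)
Lemma soliton_connected : connected [set: M].
Proof.
pose C := connected_component [set: M] soliton_base.
suff -> : [set: M] = C by exact: component_connected.
apply/seteqP; split=> // x _.
rewrite -(set_valK soliton_base x).
apply: (@off_axis_segments R (fun p => C (set_point soliton_base p)) qbase);
  rewrite ?coordinate_row_of //; last exact: set_valU.
  have -> : set_point soliton_base qbase = soliton_base by exact: (set_valK soliton_base soliton_base).
  exact: connected_component_refl.
move=> p q pq Cp.
pose g (t : R) : M := set_point soliton_base (p + t *: (q - p)).
apply: connected_component_trans Cp _.
have cg : {within `[0, 1]%classic, continuous g}.
  apply: continuous_in_subspaceT => t /set_mem; rewrite /= in_itv /= => /pq tU.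
  apply: (@continuous_comp _ _ _ (fun t : R => p + t *: (q - p)) (set_point soliton_base)).
    by apply: cvgD; [exact: cvg_cst|exact: scalel_continuous].
  exact: (set_point_continuous_at off_axis_open).
exists (g @` `[0, 1]%classic).
  split=> //.
    by exists 0; rewrite /= ?in_itv /= ?lexx ?ler01 // /g scale0r addr0.
  by apply: connected_continuous_connected => //; exact: segment_connected.
by exists 1; rewrite /= ?in_itv /= ?lexx ?ler01 // /g scale1r addrC subrK.
Qed.

End HomogeneousSpace.

(** * Further charts, and the isotropy group as a submanifold *)

Section LocalCoordinates.
Context {R : realType} {n : nat} (U : set 'rV[R]_n).
Hypothesis oU : open U.
Context (p0 : set_type U) (O O' : set 'rV[R]_n) (psi chi : 'rV[R]_n -> 'rV[R]_n).
Hypotheses (oO : open O) (oO' : open O') (OU : O `<=` U).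
Hypotheses (psiO : forall x, O x -> O' (psi x)) (chiO : forall y, O' y -> O (chi y)).
Hypotheses (psiK : forall x, O x -> chi (psi x) = x).
Hypotheses (chiK : forall y, O' y -> psi (chi y) = y).
Hypotheses (psi_smooth : smooth_on O psi) (chi_smooth : smooth_on O' chi).

Local Notation T := (set_type U).
Let D : set T := \val @^-1` O.
Let crd (p : T) : 'rV[R]_n := psi (\val p).
Let pnt (y : 'rV[R]_n) : T := set_point p0 (chi y).

Let oD : open D.
Proof. by apply: open_comp oO => p _; exact: set_val_continuous. Qed.

Let crdD : crd @` D = O'.
Proof.
apply/seteqP; split=> [_ [p Dp <-]|y Oy]; first exact: psiO.
exists (set_point p0 (chi y)); rewrite /crd /D /= set_pointK ?chiK //;
  [exact: chiO|exact/OU/chiO|exact/OU/chiO].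
Qed.

Let ocrdD : open (crd @` D). Proof. by rewrite crdD. Qed.

Let crdK p : D p -> pnt (crd p) = p.
Proof. by move=> Dp; rewrite /pnt /crd psiK // set_valK. Qed.

Let crd_cont : {within D, continuous crd}.
Proof.
apply: continuous_in_subspaceT => p /set_mem Dp.
apply: (@continuous_comp _ _ _ (\val : T -> 'rV[R]_n) psi).
  exact: set_val_continuous.
exact: (psi_smooth 0%N _ Dp).
Qed.

Let pnt_cont : {within crd @` D, continuous pnt}.
Proof.
rewrite crdD; apply: continuous_in_subspaceT => y /set_mem Oy.
apply: (@continuous_comp _ _ _ chi (set_point p0)).
  exact: (chi_smooth 0%N _ Oy).
by apply: (set_point_continuous_at oU); exact/OU/chiO.
Qed.

Definition local_chart : chart R n T := Chart oD ocrdD crdK crd_cont pnt_cont.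

Lemma local_chart_compatible : compatible local_chart (set_chart oU p0).
Proof.
have cE : Defs.codom local_chart = O' := crdD.
split.
  have -> : local_dom local_chart (set_chart oU p0) idfun = O'.
    rewrite /local_dom cE; apply/seteqP.
    by split=> [y []|y Oy] //; split.
  move=> k; apply: Ck_ext (chi_smooth k) => // y Oy.
  by rewrite /local_map /= set_pointK //; exact/OU/chiO.
have -> : local_dom (set_chart oU p0) local_chart idfun = O.
  rewrite /local_dom codom_set_chart; apply/seteqP; split=> [x [Ux]|x Ox].
    by rewrite /= /D /= set_pointK.
  by split; [exact: OU|rewrite /= /D /= set_pointK //; exact: OU].
move=> k; apply: Ck_ext (psi_smooth k) => // x Ox.
by rewrite /local_map /= /crd set_pointK //; exact: OU.
Qed.

End LocalCoordinates.

Section Isotropy.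
Context {R : realType}.
Local Notation cq := (@coordinate R 4).
Local Notation G := (quaternion_group R).

(** The ineffective kernel is 1 and -1, whose first coordinates differ by 2; radius 1 separates
    them. *)
Lemma soliton_action_almost_effective : almost_effective (@soliton_action R).
Proof.
move=> a Na.
have triv (b : G) : (forall p, soliton_action b p = p) ->
    [/\ cq 0 (\val b) ^+ 2 = 1, cq 1 (\val b) = 0, cq 2 (\val b) = 0,
        cq 3 (\val b) = 0 & cq 4 (\val b) = 0].
  move=> H; apply: (qact_trivial (set_valU b)) => x x0.
  by have /(congr1 val) := H (exist _ x (mem_set x0)).
split; first exact/mem_set.
have [a2 a1 a22 a3 a4] := triv a Na.
exists [set b | `|cq 0 (\val a) - cq 0 (\val b)| < 1].
  have c : {for a, continuous (fun b : G => cq 0 (\val b))}.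
    apply: (@continuous_comp _ _ _ (\val : G -> 'rV[R]_5) (cq 0)).
      exact: (@set_val_continuous _ _ (@quaternions R)).
    exact: continuous_coordinate.
  by move/cvgrPdist_lt: c => /(_ 1 ltr01).
apply/seteqP; split=> [b [/= ab Nb]|_ ->]; last first.
  by split=> //=; rewrite subrr normr0 ltr01.
have [b2 b1 b22 b3 b4] := triv b Nb.
apply: val_inj; apply: eq_coordinate => -[|[|[|[|[|//]]]]] _; rewrite ?a1 ?a22 ?a3 ?a4 //.
move: ab; rewrite ltr_norml => /andP[].
by move: a2 b2 => /eqP + /eqP; rewrite !sqrf_eq1 => /orP[]/eqP -> /orP[]/eqP -> *; lra.
Qed.

(* The line of slope [t] through the point (-1, 0) meets the unit circle again at
   first coordinate [2 / (1 + t^2) - 1], which makes [t] and the difference [w]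
   of the first coordinates rational coordinates straightening the circle; the sign
   [e] allows for the base point (1, 0) as well. *)
Definition slice_coord (e : R) (q : 'rV[R]_5) : 'rV[R]_5 :=
  let s := 1 + e * cq 0 q in let t := cq 1 q * s^-1 in
  row_of [:: t; s - 2 * (1 + t ^+ 2)^-1; cq 2 q; cq 3 q; cq 4 q].

Definition slice_point (e : R) (z : 'rV[R]_5) : 'rV[R]_5 :=
  let s := cq 1 z + 2 * (1 + cq 0 z ^+ 2)^-1 in
  row_of [:: e * (s - 1); cq 0 z * s; cq 2 z; cq 3 z; cq 4 z].

Definition slice_dom (e : R) : set 'rV[R]_5 :=
  [set q | quaternions q /\ 1 + e * cq 0 q != 0].

Let p1 (t : R) : 1 + t ^+ 2 != 0.
Proof. by rewrite gt_eqF // ltr_pwDl // sqr_ge0. Qed.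

Lemma slice_coordK e q : e * e = 1 -> slice_dom e q ->
  slice_point e (slice_coord e q) = q.
Proof.
move=> e2 [_ s0].
apply: eq_coordinate => -[|[|[|[|[|//]]]]] _; rewrite !coordinate_row_of //= subrK.
  by rewrite addrAC subrr add0r mulrA e2 mul1r.
by rewrite divfK.
Qed.

Lemma slice_pointK e z : e * e = 1 -> slice_dom e (slice_point e z) ->
  slice_coord e (slice_point e z) = z.
Proof.
move=> e2 [_]; rewrite coordinate_row_of //= mulrA e2 mul1r addrC subrK => s0.
have E : 1 + e * cq 0 (slice_point e z) = cq 1 z + 2 * (1 + cq 0 z ^+ 2)^-1.
  by rewrite coordinate_row_of //= mulrA e2 mul1r addrC subrK.
apply: eq_coordinate => -[|[|[|[|[|//]]]]] _; rewrite coordinate_row_of //= ?E ?coordinate_row_of //=.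
  by rewrite mulfK.
by rewrite mulfK // addrK.
Qed.

Lemma slice_dom_open e : open (slice_dom e).
Proof.
have -> : slice_dom e = quaternions `&` (fun q => 1 + e * cq 0 q) @^-1` [set y | y != 0] by [].
apply: openI; first exact: quaternions_open.
apply: open_comp => [q _|]; last exact: open_neq.
have oT : open [set: 'rV[R]_5] := openT.
have c : Ck 0 setT (fun q => 1 + e * cq 0 q).
  Ck_rational ltac:(exact: Ck_coordinate).
exact: c.
Qed.

Lemma smooth_slice_point e : smooth_on setT (slice_point e).
Proof.
move=> k; have oT : open [set: 'rV[R]_5] := openT.
have c m : Ck k setT (cq m) by exact: Ck_coordinate.
have cV : Ck k setT (fun z : 'rV[R]_5 => (1 + cq 0 z ^+ 2)^-1).
  apply: CkV => [//|x _|]; first exact: p1.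
  Ck_rational ltac:(exact: c).
apply: Ck_row_of => // -[|[|[|[|[|//]]]]] _ /=;
  Ck_rational ltac:(first [exact: c|exact: cV]).
Qed.

Lemma smooth_slice_coord e : smooth_on (slice_dom e) (slice_coord e).
Proof.
move=> k; have oO := @slice_dom_open e.
have c m : Ck k (slice_dom e) (cq m) by exact: Ck_coordinate.
have cs : Ck k (slice_dom e) (fun q => (1 + e * cq 0 q)^-1).
  apply: CkV => [//|x []//|].
  Ck_rational ltac:(exact: c).
have cV : Ck k (slice_dom e) (fun q => (1 + (cq 1 q * (1 + e * cq 0 q)^-1) ^+ 2)^-1).
  apply: CkV => [//|x _|]; first exact: p1.
  Ck_rational ltac:(first [exact: c|exact: cs]).
apply: Ck_row_of => // -[|[|[|[|[|//]]]]] _ /=;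
  Ck_rational ltac:(first [exact: c|exact: cs|exact: cV]).
Qed.

Lemma slice_codom_open e : open (slice_point e @^-1` slice_dom e).
Proof.
apply: open_comp (@slice_dom_open e) => z _.
exact: (smooth_slice_point e 0%N _ I).
Qed.

Lemma isotropy_positive_dimensional :
  positive_dimensional (@quaternion_manifold R) (@isotropy R).
Proof.
exists 1%N; split=> //; split=> // p Hp.
have isoE (q : G) : isotropy q <->
    [/\ cq 0 (\val q) ^+ 2 + cq 1 (\val q) ^+ 2 = 1, cq 2 (\val q) = 0,
        cq 3 (\val q) = 0 & cq 4 (\val q) = 0].
  split=> [/(congr1 val)|H]; first by move/(qact_base_fixed (set_valU q)).
  by apply: val_inj; apply/(qact_base_fixed (set_valU q)).
(* The coordinates break down where 1 + e a = 0, so e = -1 is chosen exactly at a = -1. *)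
pose e : R := if cq 0 (\val p) == -1 then -1 else 1.
have e2 : e * e = 1 by rewrite /e; case: ifP; rewrite ?mulrNN mulr1.
have Op : slice_dom e (\val p).
  split; first exact: set_valU.
  rewrite /e; case: ifP => [/eqP ->|/negbT]; first by rewrite mulrNN mulr1.
  by rewrite mul1r addrC addr_eq0.
have OU : slice_dom e `<=` quaternions by move=> x [].
have psiO x : slice_dom e x -> (slice_point e @^-1` slice_dom e) (slice_coord e x).
  by move=> Ox; rewrite /= slice_coordK.
have smchi : smooth_on (slice_point e @^-1` slice_dom e) (slice_point e).
  by move=> k; apply: Ck_subset (smooth_slice_point e k).
exists (@local_chart R 5 quaternions quaternions_open qgroup_one _ _ _ _
  (@slice_dom_open e) (@slice_codom_open e) OU psiO (fun _ => id)
  (fun x Ox => slice_coordK e2 Ox) (fun y Oy => slice_pointK e2 Oy)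
  (@smooth_slice_coord e) smchi); split=> //.
  by move=> []; exact: local_chart_compatible.
move=> q [_ s0]; rewrite isoE.
(* With s = 1 + e a this coordinate equals s (a^2 + b^2 - 1) / (s^2 + b^2), and s is non-zero on the
   chart, so its zero set is the circle. *)
have wE : cq 1 (slice_coord e (\val q)) = 0 <-> cq 0 (\val q) ^+ 2 + cq 1 (\val q) ^+ 2 = 1.
  rewrite coordinate_row_of //=.
  set a := cq 0 _; set b := cq 1 _; set s := 1 + e * a.
  have n0 : s ^+ 2 + b ^+ 2 != 0.
    by rewrite paddr_eq0 ?sqr_ge0 // negb_and sqrf_eq0 s0.
  have -> : s - 2 * (1 + (b / s) ^+ 2)^-1 = s * (a ^+ 2 + b ^+ 2 - 1) / (s ^+ 2 + b ^+ 2).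
    have -> : a ^+ 2 + b ^+ 2 - 1 = s ^+ 2 + b ^+ 2 - 2 * s.
      have : a ^+ 2 = (e * e) * a ^+ 2 by rewrite e2 mul1r.
      rewrite /s; lra.
    by field; rewrite n0 s0.
  split=> [/eqP|->]; last by rewrite subrr mulr0 mul0r.
  rewrite !mulf_eq0 invr_eq0 (negbTE n0) (negbTE s0) orbF /= subr_eq0.
  by move/eqP.
have cE k : (2 <= k < 5)%N -> cq k (slice_coord e (\val q)) = cq k (\val q).
  by move: k => [|[|[|[|[|k]]]]] // _; rewrite coordinate_row_of.
split=> [[/wE w0 q2 q3 q4] j|H].
  rewrite /= -coordinate_ord.
  by case: j => [[|[|[|[|[|//]]]]] Hj] //= _; rewrite ?w0 // cE.
have H' k : (0 < k < 5)%N -> cq k (slice_coord e (\val q)) = 0.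
  move=> /andP[k0 k5]; rewrite /coordinate; apply: H.
  by rewrite inordK.
by split; [apply/wE; exact: H'|rewrite -cE // H'|rewrite -cE // H'|rewrite -cE // H'].
Qed.

End Isotropy.

(** * Composition of smooth maps *)

Lemma jacobian_comp (R : realType) n m p (f : 'rV[R]_n -> 'rV[R]_m)
    (g : 'rV[R]_m -> 'rV[R]_p) x :
  differentiable f x -> differentiable g (f x) ->
  'J (fun y => g (f y)) x = 'J f x *m 'J g (f x).
Proof.
move=> df dg; have dgf : differentiable (fun y => g (f y)) x by exact: differentiable_comp.
apply/row_matrixP => i; rewrite row_mul !rowE.
apply: etrans (esym (deriveEjacobian _ dgf)) _.
rewrite -(deriveEjacobian _ df) -(deriveEjacobian _ dg) !deriveE //.
by rewrite diff_comp.
Qed.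

Section ChartMaps.
Context {R : realType} {n : nat} {T : topologicalType} (c : chart R n T).

Lemma point_continuous_at x : Defs.codom c x -> {for x, continuous (Defs.point c)}.
Proof.
move=> cx; have := @point_continuous _ _ _ c.
rewrite continuous_open_subspace; last exact: codom_open.
by apply; exact/mem_set.
Qed.

Lemma dom_point x : Defs.codom c x -> dom c (Defs.point c x).
Proof. by move=> [p dp <-]; rewrite coordK. Qed.

Lemma coord_point x : Defs.codom c x -> Defs.coord c (Defs.point c x) = x.
Proof. by move=> [p dp <-]; rewrite coordK. Qed.

Lemma codom_coord p : dom c p -> Defs.codom c (Defs.coord c p).
Proof. by move=> dp; exists p. Qed.

End ChartMaps.

Section LocalMaps.
Context {R : realType} {n m l : nat} {T U V : topologicalType}.
Context (c : chart R n T) (d : chart R m U) (e : chart R l V).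

Lemma open_local_dom (f : T -> U) : continuous f -> open (local_dom c d f).
Proof.
move=> cf; rewrite openE => x [cx dx]; apply: filterI.
  by apply: open_nbhs_nbhs; split=> //; exact: codom_open.
have cfp : {for x, continuous (f \o Defs.point c)}.
  by apply: continuous_comp; [exact: point_continuous_at|exact: cf].
by apply: cfp; apply: open_nbhs_nbhs; split=> //; exact: dom_open.
Qed.

Lemma local_map_comp (f : T -> U) (f' : U -> V) x : dom d (f (Defs.point c x)) ->
  local_map c e (fun p => f' (f p)) x = local_map d e f' (local_map c d f x).
Proof. by move=> dx; rewrite /local_map coordK. Qed.

Lemma local_dom_comp (f : T -> U) (f' : U -> V) x : dom d (f (Defs.point c x)) ->
  dom e (f' (f (Defs.point c x))) -> local_dom d e f' (local_map c d f x).
Proof. by move=> dx ex; split; [exact: codom_coord|rewrite /local_map coordK]. Qed.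

End LocalMaps.

Lemma smooth_differentiable {R : realType} {n m : nat} {T U : topologicalType}
    (A : manifold R n T) (B : manifold R m U) (f : T -> U) i j x : smooth A B f ->
  local_dom (charts A i) (charts B j) f x ->
  differentiable (local_map (charts A i) (charts B j) f) x.
Proof. by move=> [_ sf]; exact: Ck_differentiable (sf i j 1%N). Qed.

Section ManifoldMaps.
Context {R : realType} {n m l : nat} {T U V : topologicalType}.
Context (A : manifold R n T) (B : manifold R m U) (C : manifold R l V).

(** The chart of the middle manifold has to vary with the point, hence the appeal to [Ck_local]. *)
Lemma smooth_comp (f : T -> U) (f' : U -> V) :
  smooth A B f -> smooth B C f' -> smooth A C (fun p => f' (f p)).
Proof.
move=> [cf sf] [cf' sf'].
have cff : continuous (fun p => f' (f p)).
  by move=> p; apply: continuous_comp; [exact: cf|exact: cf'].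
split=> // i k r; apply: Ck_local => x [cx kx].
have [j jx] := charts_cover B (f (Defs.point (charts A i) x)).
pose W := local_dom (charts A i) (charts B j) f `&`
          local_dom (charts A i) (charts C k) (fun p => f' (f p)).
have oW : open W by apply: openI; exact: open_local_dom.
exists W; split=> //.
apply: (@Ck_ext _ _ _ r W (fun y => local_map (charts B j) (charts C k) f'
  (local_map (charts A i) (charts B j) f y))) => //.
  by move=> y [[_ jy] _]; rewrite -local_map_comp.
refine (@Ck_comp R 'rV[R]_n 1%N m l r W _ (local_map (charts A i) (charts B j) f)
  (local_map (charts B j) (charts C k) f') oW
  (@open_local_dom _ _ _ _ _ _ _ _ cf') _ _ _).
- by move=> y [[_ jy] [_ ky]]; exact: (local_dom_comp (f := f) (f' := f') jy ky).
- by apply: Ck_subset (sf i j r) => y [].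
- exact: sf'.
Qed.

Lemma jacobian_local_map_comp (f : T -> U) (f' : U -> V) i j k x :
  smooth A B f -> smooth B C f' ->
  local_dom (charts A i) (charts B j) f x ->
  local_dom (charts A i) (charts C k) (fun p => f' (f p)) x ->
  'J (local_map (charts A i) (charts C k) (fun p => f' (f p))) x =
  'J (local_map (charts A i) (charts B j) f) x *m
  'J (local_map (charts B j) (charts C k) f') (local_map (charts A i) (charts B j) f x).
Proof.
move=> sf sf' jx kx; have cf := proj1 sf.
have dx := smooth_differentiable (smooth_comp sf sf') kx.
have df := smooth_differentiable sf jx.
have df' := smooth_differentiable sf' (local_dom_comp (f := f) (f' := f') (proj2 jx) (proj2 kx)).
apply: etrans (jacobian_comp df df').
apply: near_eq_jacobian dx.
have := open_nbhs_nbhs (conj (@open_local_dom _ _ _ _ _ (charts A i) (charts B j) _ cf) jx).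
by apply: filterS => y [_ jy]; exact: local_map_comp.
Qed.

End ManifoldMaps.

Section PullBack.
Context {R : realType} {n m l : nat} {T U V : topologicalType}.
Context (A : manifold R n T) (B : manifold R m U) (C : manifold R l V).

Lemma pulls_back_comp (f : T -> U) (f' : U -> V)
    (k : Defs.index C -> 'rV[R]_l -> 'M[R]_l)
    (h : Defs.index B -> 'rV[R]_m -> 'M[R]_m)
    (g : Defs.index A -> 'rV[R]_n -> 'M[R]_n) :
  smooth A B f -> smooth B C f' ->
  pulls_back (A := A) (B := B) f h g -> pulls_back (A := B) (B := C) f' k h ->
  pulls_back (A := A) (B := C) (fun p => f' (f p)) k g.
Proof.
move=> sf sf' fh fk i c x cx.
have [j jx] := charts_cover B (f (Defs.point (charts A i) x)).
have jdx : local_dom (charts A i) (charts B j) f x by split=> //; case: cx.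
rewrite /= (jacobian_local_map_comp sf sf' jdx cx) (@local_map_comp _ _ _ _ _ _ _ _ _ (charts C c) f f' x jx).
have E := fk j c _ (local_dom_comp (f := f) (f' := f') jx (proj2 cx)).
have E' := fh i j x jdx.
by rewrite -E' -E /= trmx_mul !mulmxA.
Qed.

(** The one identity [J1] cancels the Jacobians on both sides, so the two dimensions may be
    unrelated, as in the theorem. *)
Lemma pulls_back_inverse (f : T -> U) (f' : U -> T)
    (h : Defs.index B -> 'rV[R]_m -> 'M[R]_m)
    (g : Defs.index A -> 'rV[R]_n -> 'M[R]_n) :
  cancel f' f -> smooth A B f -> smooth B A f' ->
  pulls_back (A := A) (B := B) f h g -> pulls_back (A := B) (B := A) f' g h.
Proof.
move=> f'K sf sf' fh j i y [jy iy] /=; set x := local_map _ _ f' y.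
have xE : Defs.point (charts A i) x = f' (Defs.point (charts B j) y).
  by rewrite /x /local_map coordK.
have dx : local_dom (charts A i) (charts B j) f x.
  split; first exact: codom_coord.
  by rewrite xE f'K; exact: dom_point.
have yE : local_map (charts A i) (charts B j) f x = y.
  by rewrite /local_map xE f'K coord_point.
have dy : local_dom (charts B j) (charts B j) (fun p => f (f' p)) y.
  by split=> //; rewrite f'K; exact: dom_point.
have J1 : 'J (local_map (charts B j) (charts A i) f') y *m
          'J (local_map (charts A i) (charts B j) f) x = 1%:M.
  apply: etrans (esym (jacobian_local_map_comp sf' sf (conj jy iy) dy)) _.
  apply: etrans (jacobian_id y).
  apply: near_eq_jacobian; last exact: (smooth_differentiable (smooth_comp sf' sf) dy).
  have := open_nbhs_nbhs (conj (@codom_open _ _ _ (charts B j)) jy).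
  by apply: filterS => z jz; rewrite /local_map f'K coord_point.
have := fh i j x dx; rewrite /= yE => <-.
by rewrite !mulmxA J1 mul1mx -mulmxA -trmx_mul J1 trmx1 mulmx1.
Qed.

End PullBack.

(** Smoothness of the product is stated on pairs of charts; it is restricted along [I], which
    freezes the first component at the coordinates of [a]. *)
Lemma smooth_left_translation (R : realType) (m : nat) (G : preTopologicalGroupType)
    (AG : manifold R m G) (a : G) : lie_group AG ->
  smooth AG AG (fun b => a * b)%g.
Proof.
move=> [[cM sM] _].
have cL : continuous (fun b => a * b)%g.
  move=> b; apply: (@continuous_comp _ _ _ (fun b => (a, b)) (fun z => z.1 * z.2)%g).
    by apply: cvg_pair; [exact: cvg_cst|exact: cvg_id].
  exact: cM.
split=> // j k r; have [i ia] := charts_cover AG a.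
pose I (y : 'rV[R]_m) : 'rV[R]_(m + m) := row_mx (Defs.coord (charts AG i) a) y.
pose F (z : 'rV[R]_(m + m)) := (Defs.point (charts AG i) (lsubmx z) *
  Defs.point (charts AG j) (rsubmx z))%g.
pose W : set 'rV[R]_(m + m) := [set z | [/\ Defs.codom (charts AG i) (lsubmx z),
  Defs.codom (charts AG j) (rsubmx z) & dom (charts AG k) (F z)]].
have FI y : F (I y) = (a * Defs.point (charts AG j) y)%g.
  by rewrite /F /I row_mxKl row_mxKr coordK.
have oL := @open_local_dom _ _ _ _ _ (charts AG j) (charts AG k) _ cL.
have oW : open W.
  rewrite openE => z [iz jz kz].
  have ni : nbhs z [set z | Defs.codom (charts AG i) (lsubmx z)].
    have /(_ z) := @continuous_lsubmx R 1 m m; apply.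
    by apply: open_nbhs_nbhs; split=> //; exact: codom_open.
  have nj : nbhs z [set z | Defs.codom (charts AG j) (rsubmx z)].
    have /(_ z) := @continuous_rsubmx R 1 m m; apply.
    by apply: open_nbhs_nbhs; split=> //; exact: codom_open.
  have pl : {for z, continuous (fun y : 'rV[R]_(m + m) => Defs.point (charts AG i) (lsubmx y))}.
    apply: (@continuous_comp 'rV[R]_(m + m) 'rV[R]_m _ lsubmx (Defs.point (charts AG i)) z).
      exact: continuous_lsubmx.
    exact: point_continuous_at.
  have pr : {for z, continuous (fun y : 'rV[R]_(m + m) => Defs.point (charts AG j) (rsubmx y))}.
    apply: (@continuous_comp 'rV[R]_(m + m) 'rV[R]_m _ rsubmx (Defs.point (charts AG j)) z).
      exact: continuous_rsubmx.
    exact: point_continuous_at.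
  have cF : {for z, continuous F}.
    apply: (@continuous_comp _ _ _ (fun z : 'rV[R]_(m + m) =>
      (Defs.point (charts AG i) (lsubmx z), Defs.point (charts AG j) (rsubmx z)))
      (fun z => z.1 * z.2)%g); last exact: cM.
    exact: (@cvg_pair _ _ _ (nbhs (z : 'rV[R]_(m + m))) (nbhs _) (nbhs _)
      (nbhs_filter _) (nbhs_filter _) (nbhs_filter _) _ _ pl pr).
  have nk : nbhs z (F @^-1` dom (charts AG k)).
    by apply: cF; apply: open_nbhs_nbhs; split=> //; exact: dom_open.
  by apply: filterS3 ni nj nk => y iy jy ky; split.
have cI : Ck r (local_dom (charts AG j) (charts AG k) (fun b => a * b)%g) I.
  apply: Ck_mx => // u v; case: (split_ordP v) => w ->.
    apply: Ck_ext (Ck_cst r _ (Defs.coord (charts AG i) a u w)) => // y _.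
    by rewrite /I row_mxEl.
  apply: Ck_ext (Ck_entry u w oL (Ck_id r _)) => // y _.
  by rewrite /I row_mxEr.
apply: Ck_ext (Ck_comp oL oW _ cI (sM i j k r)) => //.
  by move=> y _; rewrite /= -/(F (I y)) FI.
by move=> y [jy ky]; rewrite /W /= FI /I row_mxKl row_mxKr; split=> //; exact: codom_coord.
Qed.

(** * Isometries of the soliton *)

(** Polarisation using unit vectors only: basis vectors give the diagonal of the Gram matrix, and
    3/5 e_i + 4/5 e_j gives its other entries. *)
Lemma orthogonal_of_unit_vectors (R : realType) n (C : 'M[R]_n) :
  (forall y : 'rV[R]_n, y *m y^T = 1%:M -> (y *m C) *m (y *m C)^T = 1%:M) ->
  C *m C^T = 1%:M.
Proof.
move=> H; pose Q := C *m C^T.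
have QT : Q^T = Q by rewrite /Q trmx_mul trmxK.
have HQ (y : 'rV[R]_n) : y *m y^T = 1%:M -> y *m Q *m y^T = 1%:M.
  by move=> /H; rewrite trmx_mul !mulmxA.
rewrite -/Q; clearbody Q.
pose e i : 'rV[R]_n := delta_mx 0 i.
have ee i j : e i *m (e j)^T = (i == j)%:R%:M.
  rewrite trmx_delta; have [->|ij] := eqVneq i j.
    by rewrite mul_delta_mx; apply/matrixP => u v; rewrite !mxE !ord1.
  by rewrite mul_delta_mx_0 //; apply/matrixP => u v; rewrite !mxE mul0rn.
have eQ i j : e i *m Q *m (e j)^T = (Q i j)%:M.
  rewrite /e -rowE trmx_delta -colE; apply/matrixP => u v.
  by rewrite !mxE !ord1.
have Qd i : Q i i = 1.
  have := HQ (e i); rewrite ee eQ eqxx => /(_ erefl)/matrixP/(_ 0 0).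
  by rewrite !mxE.
apply/matrixP => i j; rewrite [RHS]mxE; have [<-|ij] := eqVneq i j; first exact: Qd.
have ji : j != i by rewrite eq_sym.
pose y : 'rV[R]_n := 3/5 *: e i + 4/5 *: e j.
have yT : y^T = 3/5 *: (e i)^T + 4/5 *: (e j)^T by rewrite /y linearD !linearZ.
have y1 : y *m y^T = 1%:M.
  rewrite yT /y mulmxDl !mulmxDr -!scalemxAl -!scalemxAr !ee !eqxx (negbTE ij) (negbTE ji).
  apply/matrixP => u v; rewrite !mxE !ord1 eqxx /= ?mulr1n ?mulr0; lra.
have := HQ y y1; rewrite yT /y 2!mulmxDl !mulmxDr -!scalemxAl -!scalemxAr !eQ !Qd.
have Qji : Q j i = Q i j by rewrite -[in LHS]QT mxE.
move=> /matrixP/(_ 0 0); rewrite !mxE Qji /= ?mulr1n; lra.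
Qed.

Section SolitonIsometries.
Context {R : realType}.
Local Notation M := (set_type (@off_axis R)).
Local Notation AM := (@soliton_manifold R).
Local Notation g := (@soliton_metric R).

Definition sphere_point (p : M) : 'rV[R]_3 := \row_(k < 3) sphere_coordinate k (\val p).

Lemma sphere_point_unit p : sphere_point p *m (sphere_point p)^T = 1%:M.
Proof.
apply/matrixP => u v; rewrite !ord1 mxE [RHS]mxE /=.
rewrite -(sphere_coordinate_sqr (set_valU p)); apply: eq_bigr => k _.
by rewrite !mxE expr2.
Qed.

Lemma sphere_point_surj (y : 'rV[R]_3) : y *m y^T = 1%:M -> exists p, sphere_point p = y.
Proof.
move=> /matrixP/(_ 0 0); rewrite !mxE eqxx mulr1n => y1.
pose c k := y 0 (inord k).
pose x : 'rV[R]_4 := row_of [:: c 0%N; c 1%N; c 2%N; 0].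
have yc (k : 'I_3) : y 0 k = c k by rewrite /c inord_val.
have r1 : rsq x = 1.
  rewrite /rsq !coordinate_row_of //= -y1 !big_ord_recl big_ord0 !mxE !yc /=; ring.
have x0 : off_axis x by rewrite /off_axis /= r1 oner_neq0.
exists (exist _ x (mem_set x0)); apply/rowP => k.
rewrite mxE /sphere_coordinate /inv_radius r1 sqrtr1 invr1 mul1r yc.
by case: k => [[|[|[|//]]] Hk]; rewrite coordinate_row_of.
Qed.

(** Points of the sphere span R^3. This uniqueness makes matrices selected by choice multiplicative
    in the group element. *)
Lemma sphere_point_ext (C C' : 'M[R]_3) :
  (forall p, sphere_point p *m C = sphere_point p *m C') -> C = C'.
Proof.
move=> H; apply/row_matrixP => i; rewrite !rowE.
have [|p <-] := @sphere_point_surj (delta_mx 0 i); last exact: H.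
by rewrite trmx_delta mul_delta_mx; apply/matrixP => u v; rewrite !mxE !ord1.
Qed.

Lemma isometry_sphere_linear (phi : M -> M) :
  smooth AM AM phi -> pulls_back phi g g ->
  exists C : 'M[R]_3, forall p, sphere_point (phi p) = sphere_point p *m C.
Proof.
move=> [_ sphi] pb.
pose c := set_chart (@off_axis_open R) soliton_base.
have domE : local_dom c c phi = off_axis by exact: local_dom_open.
have [|||C CE] := @sphere_isometry_linear R (local_map c c phi).
- by move=> x _; exact: set_valU.
- by have := sphi tt tt 3; rewrite /= domE.
- by move=> x x0; apply: (pb tt tt x); rewrite /= domE.
exists C => p; have := CE (\val p) (set_valU p).
by rewrite /local_map /= set_valK.
Qed.

Lemma soliton_not_solvmanifold (d : nat) (S : preTopologicalGroupType)
    (AS : manifold R d S) (h : pseudo_metric AS) :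
  solvmanifold h -> ~ isometric g h.
Proof.
move=> [lS sS iS] [f [f' [fK f'K sf sf' pf]]].
pose phi a p := f' (a * f p)%g.
have phiM a b p : phi (a * b)%g p = phi a (phi b p) by rewrite /phi f'K mulgA.
have sL a : smooth AS AS (fun b => a * b)%g by exact: smooth_left_translation.
have sphi a : smooth AM AM (phi a) by exact: (smooth_comp (smooth_comp sf (sL a)) sf').
have pphi a : pulls_back (phi a) g g.
  apply: (pulls_back_comp (smooth_comp sf (sL a)) sf' _ (pulls_back_inverse f'K sf sf' pf)).
  exact: (pulls_back_comp sf (sL a) pf (iS a)).
have [C CE] := choice (fun a => isometry_sphere_linear (sphi a) (pphi a)).
apply: (@no_transitive_solvable R S C) => // [a b|a|y z].
- by apply: sphere_point_ext => p; rewrite -CE phiM !CE mulmxA.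
- apply: orthogonal_of_unit_vectors => y /sphere_point_surj[p <-].
  by rewrite -CE sphere_point_unit.
- move=> /sphere_point_surj[p <-] /sphere_point_surj[q <-].
  exists (f q * (f p)^-1)%g; rewrite -CE /phi.
  by rewrite -mulgA mulVg mulg1 fK.
Qed.

End SolitonIsometries.

Theorem mainTheorem3 (R : realType) :
  exists (m : nat) (G : preTopologicalGroupType) (AG : manifold R m G)
         (H : set G)
         (M : topologicalType) (AM : manifold R 4 M)
         (act : G -> M -> M) (o : M) (g : pseudo_metric AM),
    [/\ lie_group AG /\ homogeneous_space AG AM H act o,
        connected [set: M] /\ ~ compact [set: M],
        positive_dimensional AG H /\ almost_effective act,
        [/\ homogeneous_ricci_soliton act g, invariant_ricci_soliton act g
          & ~ einstein g]
      & forall (d : nat) (S : preTopologicalGroupType) (AS : manifold R d S)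
               (h : pseudo_metric AS),
          solvmanifold h -> ~ isometric g h].
Proof.
exists 5, (quaternion_group R : preTopologicalGroupType), quaternion_manifold, isotropy.
exists (set_type (@off_axis R)), soliton_manifold, soliton_action, soliton_base, soliton_metric.
split.
- by split; [exact: quaternion_lie_group|exact: soliton_homogeneous_space].
- by split; [exact: soliton_connected|exact: soliton_not_compact].
- by split; [exact: isotropy_positive_dimensional|exact: soliton_action_almost_effective].
- split; last exact: soliton_metric_not_einstein.
    split; first exact: soliton_metric_invariant.
    by exists soliton_field, 1; exact: soliton_metric_equation.
  split; first exact: soliton_metric_invariant.
  exists soliton_field, 1.
  by split; [exact: soliton_field_invariant|exact: soliton_metric_equation].
- exact: soliton_not_solvmanifold.
Qed.
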